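(* Let $n\ge1$ and let $\Lambda$ be an $n$-representation infinite algebra over a field $K$. Let $\mathscr{R}:=\{X\in\mathsf{mod}\,\Lambda\mid\operatorname{Ext}^i_\Lambda(\mathscr{P},X)=0=\operatorname{Ext}^i_\Lambda(X,\mathscr{I})\ \forall i>0\}$ be the category of $n$-regular modules. Then $$\mathscr{R}=\{X\in\mathsf{mod}\,\Lambda\mid\nu_n^i(X)\in\mathsf{mod}\,\Lambda\ \forall i\in\mathbb{Z}\}.$$
   Context: $D=\operatorname{Hom}_K(-,K)$; modules are left modules. For a finite dimensional $K$-algebra $\Lambda$ with $\operatorname{gl.dim}\Lambda\le n$, let $\nu=D\mathbf{R}\operatorname{Hom}_\Lambda(-,\Lambda)$ on $\mathsf{D}^{b}(\mathsf{mod}\,\Lambda)$ (an autoequivalence) and $\nu_n:=\nu\circ[-n]$; $\mathsf{mod}\,\Lambda\subset\mathsf{D}^b(\mathsf{mod}\,\Lambda)$ as complexes with cohomology concentrated in degree $0$. $\Lambda$ is $n$-representation infinite if $\operatorname{gl.dim}\Lambda\le n$ and $\nu_n^{-i}(\Lambda)\in\mathsf{mod}\,\Lambda$ for all $i\ge0$ (then also $\nu_n^i(D\Lambda)\in\mathsf{mod}\,\Lambda$ for all $i\ge0$). $\mathscr{P}=\mathsf{add}\{\nu_n^{-i}(\Lambda)\mid i\ge0\}$ and $\mathscr{I}=\mathsf{add}\{\nu_n^{i}(D\Lambda)\mid i\ge0\}$, where $\mathsf{add}$ denotes direct summands of finite direct sums. *)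

(* Defs.v *)
From HB Require Import structures.
From mathcomp Require Import all_boot all_order all_algebra all_field.

Set Implicit Arguments.
Unset Strict Implicit.
Unset Printing Implicit Defensive.

Import GRing.Theory.
Local Open Scope ring_scope.

Lemma linfun_linE (K : fieldType) (U V : vectType K) (f : U -> V) :
  linear f -> linfun f =1 f.
Proof.
move=> lf; pose g : {linear U -> V} :=
  HB.pack f (GRing.isSemilinear.Build K U V _ f (GRing.semilinear_linear lf)).
exact: (lfunE g).
Qed.

Section Modules.
Variables (K : fieldType) (A : falgType K).

(* Finite dimensional modules. [lact a] is v |-> a v, [ract a] is v |-> v a;
   K-bilinearity of the action is contained in the types of these fields. *)
Record lmod := LMod {
  lcar :> vectType K;
  lact : 'Hom(A, 'Hom(lcar, lcar));
  lact1 : lact 1 = \1%VF;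
  lactM : forall a b, lact (a * b) = (lact a \o lact b)%VF }.

Record rmod := RMod {
  rcar :> vectType K;
  ract : 'Hom(A, 'Hom(rcar, rcar));
  ract1 : ract 1 = \1%VF;
  ractM : forall a b, ract (a * b) = (ract b \o ract a)%VF }.

(* Hom_A(M, N), as the kernel of f |-> (a |-> f \o a - a \o f) *)
Definition homv (M N : lmod) : {vspace 'Hom(M, N)} :=
  lker (linfun (fun f : 'Hom(M, N) =>
    linfun (fun a : A => (f \o lact M a)%VF - (lact N a \o f)%VF))).

Lemma homvP (M N : lmod) (f : 'Hom(M, N)) :
  reflect (forall a x, f (lact M a x) = lact N a (f x)) (f \in homv M N).
Proof.
have lin1 (g : 'Hom(M, N)) :
    linear (fun a : A => (g \o lact M a)%VF - (lact N a \o g)%VF).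
  move=> k a b; apply/lfunP => x.
  rewrite !lfun_simp !linearP /= !lfun_simp linearP.
  by rewrite opprD addrACA -scalerBr.
have lin2 : linear (fun g : 'Hom(M, N) =>
    linfun (fun a : A => (g \o lact M a)%VF - (lact N a \o g)%VF)).
  move=> k g h; apply/lfunP => a; rewrite !lfun_simp !linfun_linE //.
  apply/lfunP => x; rewrite !lfun_simp linearD /= linearZ /=.
  by rewrite opprD addrACA -scalerBr.
rewrite /homv memv_ker linfun_linE //; apply: (iffP eqP) => [f0 a x|fE].
  move/lfunP/(_ a): f0; rewrite linfun_linE // => /lfunP/(_ x).
  by rewrite !lfun_simp => /eqP; rewrite subr_eq0 => /eqP.
apply/lfunP => a; rewrite linfun_linE //; apply/lfunP => x.
by rewrite !lfun_simp fE subrr.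
Qed.

Definition mor (M N : lmod) := subvs_of (homv M N).
Coercion mor_fun (M N : lmod) (f : mor M N) : 'Hom(M, N) := vsval f.

Lemma morE (M N : lmod) (f : mor M N) a x :
  f (lact M a x) = lact N a (f x).
Proof. exact: (homvP _ (subvsP f)). Qed.

Lemma mid_subproof (M : lmod) : \1%VF \in homv M M.
Proof. by apply/homvP => a x; rewrite !lfun_simp. Qed.
Definition mid (M : lmod) : mor M M := Subvs (mid_subproof M).

Lemma mcomp_subproof (M N P : lmod) (g : mor N P) (f : mor M N) :
  (g \o f)%VF \in homv M P.
Proof. by apply/homvP => a x; rewrite !lfun_simp !morE. Qed.
Definition mcomp (M N P : lmod) (g : mor N P) (f : mor M N) : mor M P :=
  Subvs (mcomp_subproof g f).

Definition mod_iso (M N : lmod) :=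
  exists (f : mor M N) (g : mor N M), mcomp g f = mid M /\ mcomp f g = mid N.

Definition is_zero (M : lmod) := forall x : M, x = 0.

Definition projective (P : lmod) :=
  forall (M N : lmod) (p : mor M N), limg p = fullv ->
  forall f : mor P N, exists g : mor P M, mcomp p g = f.

Lemma zmod_subproof1 : (0 : 'Hom(A, 'Hom('rV[K]_0, 'rV[K]_0))) 1 = \1%VF.
Proof. by apply/lfunP => x; apply/rowP; case. Qed.
Lemma zmod_subproofM (a b : A) :
  (0 : 'Hom(A, 'Hom('rV[K]_0, 'rV[K]_0))) (a * b) =
  ((0 : 'Hom(A, 'Hom('rV[K]_0, 'rV[K]_0))) a
     \o (0 : 'Hom(A, 'Hom('rV[K]_0, 'rV[K]_0))) b)%VF.
Proof. by apply/lfunP => x; apply/rowP; case. Qed.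
Definition zmod : lmod := LMod zmod_subproof1 zmod_subproofM.

Section DirectSum.
Variables M N : lmod.

Definition dsum_act : 'Hom(A, 'Hom((M * N)%type, (M * N)%type)) :=
  linfun (fun a => linfun (fun x : M * N => (lact M a x.1, lact N a x.2))).

Lemma dsum_actE a x : dsum_act a x = (lact M a x.1, lact N a x.2).
Proof.
have lin1 b : linear (fun x : M * N => (lact M b x.1, lact N b x.2)).
  by move=> k u v; rewrite /= !linearP.
rewrite /dsum_act linfun_linE ?linfun_linE // => k b c.
apply/lfunP => y; rewrite add_lfunE scale_lfunE !linfun_linE //.
by rewrite !linearP /= !add_lfunE !scale_lfunE.
Qed.

Lemma dsum_act1 : dsum_act 1 = \1%VF.
Proof.
by apply/lfunP => -[x y]; rewrite dsum_actE !lact1 !id_lfunE.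
Qed.

Lemma dsum_actM a b : dsum_act (a * b) = (dsum_act a \o dsum_act b)%VF.
Proof.
by apply/lfunP => x; rewrite comp_lfunE !dsum_actE !lactM !comp_lfunE.
Qed.

Definition dsum : lmod := LMod dsum_act1 dsum_actM.
End DirectSum.

(* N 0 (+) ... (+) N (r - 1) *)
Fixpoint bigdsum (r : nat) (N : nat -> lmod) : lmod :=
  if r is r'.+1 then dsum (bigdsum r' N) (N r') else zmod.

Definition dsummand (M N : lmod) := exists M' : lmod, mod_iso (dsum M M') N.

Definition add (S : lmod -> Prop) (M : lmod) :=
  exists (r : nat) (N : nat -> lmod),
    (forall k, (k < r)%N -> S (N k)) /\ dsummand M (bigdsum r N).

Definition regl_act : 'Hom(A, 'Hom(A, A)) := linfun (@amull K A).

Lemma regl_actE a x : regl_act a x = a * x.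
Proof. by rewrite /regl_act lfunE /= /amull lfunE. Qed.

Lemma regl_act1 : regl_act 1 = \1%VF.
Proof. by apply/lfunP => x; rewrite regl_actE mul1r id_lfunE. Qed.

Lemma regl_actM a b : regl_act (a * b) = (regl_act a \o regl_act b)%VF.
Proof. by apply/lfunP => x; rewrite comp_lfunE !regl_actE mulrA. Qed.

Definition regl : lmod := LMod regl_act1 regl_actM.

Definition regr_act : 'Hom(A, 'Hom(A, A)) := linfun (@amulr K A).

Lemma regr_actE a x : regr_act a x = x * a.
Proof. by rewrite /regr_act lfunE /= /amulr lfunE. Qed.

Lemma regr_act1 : regr_act 1 = \1%VF.
Proof. by apply/lfunP => x; rewrite regr_actE mulr1 id_lfunE. Qed.

Lemma regr_actM a b : regr_act (a * b) = (regr_act b \o regr_act a)%VF.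
Proof. by apply/lfunP => x; rewrite comp_lfunE !regr_actE mulrA. Qed.

Definition regr : rmod := RMod regr_act1 regr_actM.

(* D = Hom_K(-, K) from right to left modules: (a phi)(v) = phi (v a) *)
Section Dual.
Variable V : rmod.

Definition dual_act : 'Hom(A, 'Hom('Hom(V, K^o), 'Hom(V, K^o))) :=
  linfun (fun a => linfun (fun phi : 'Hom(V, K^o) => (phi \o ract V a)%VF)).

Lemma dual_actE a phi : dual_act a phi = (phi \o ract V a)%VF.
Proof.
have lin1 b : linear (fun phi : 'Hom(V, K^o) => (phi \o ract V b)%VF).
  by move=> k f g; apply/lfunP => x; rewrite !lfun_simp.
rewrite /dual_act linfun_linE ?linfun_linE // => k b c.
apply/lfunP => f; rewrite !lfun_simp !linfun_linE //.
by apply/lfunP => x; rewrite !linearP /= !lfun_simp !linearP.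
Qed.

Lemma dual_act1 : dual_act 1 = \1%VF.
Proof. by apply/lfunP => f; rewrite dual_actE ract1 comp_lfun1r id_lfunE. Qed.

Lemma dual_actM a b : dual_act (a * b) = (dual_act a \o dual_act b)%VF.
Proof.
by apply/lfunP => f; rewrite comp_lfunE !dual_actE ractM comp_lfunA.
Qed.

Definition dual : lmod := LMod dual_act1 dual_actM.
End Dual.

Definition dual_map (V W : rmod) (g : 'Hom(V, W)) : 'Hom(dual W, dual V) :=
  linfun (fun phi : 'Hom(W, K^o) => (phi \o g)%VF).

Lemma dual_mapE (V W : rmod) (g : 'Hom(V, W)) (phi : 'Hom(W, K^o)) :
  dual_map g phi = (phi \o g)%VF.
Proof.
rewrite /dual_map linfun_linE // => k f h.
by apply/lfunP => x; rewrite !lfun_simp.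
Qed.

(* Hom_A(M, A) as a right module: (f a)(m) = f(m) a *)
Section Star.
Variable M : lmod.

Lemma star_subproof (a : A) (f : mor M regl) :
  (amulr a \o f)%VF \in homv M regl.
Proof.
apply/homvP => b x; rewrite !comp_lfunE (morE f) !regl_actE.
by rewrite /amulr !lfunE /= mulrA.
Qed.

Definition star_car : vectType K := mor M regl.

Definition star_act : 'Hom(A, 'Hom(star_car, star_car)) :=
  linfun (fun a => linfun (fun f : star_car =>
    Subvs (star_subproof a f) : star_car)).

Lemma star_actE a (f : mor M regl) x :
  (star_act a f : mor M regl) x = (f x : A) * a.
Proof.
have lin1 b : linear (fun f : star_car =>
    Subvs (star_subproof b f) : star_car).
  move=> k g h; apply: val_inj; apply/lfunP => y.
  by rewrite /= !lfun_simp /= mulrDl scalerAl.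
have lin2 : linear (fun b => linfun (fun f : star_car =>
    Subvs (star_subproof b f) : star_car)).
  move=> k b c; apply/lfunP => g.
  rewrite add_lfunE scale_lfunE !linfun_linE //.
  apply: val_inj; apply/lfunP => y.
  by rewrite /= !lfun_simp /= mulrDr scalerAr.
rewrite /star_act linfun_linE // linfun_linE //.
by rewrite /mor_fun /= comp_lfunE lfunE.
Qed.

Lemma star_act1 : star_act 1 = \1%VF.
Proof.
apply/lfunP => f; apply: val_inj; apply/lfunP => x.
by rewrite -[LHS]/((star_act 1 f : mor M regl) x) star_actE mulr1 id_lfunE.
Qed.

Lemma star_actM a b : star_act (a * b) = (star_act b \o star_act a)%VF.
Proof.
apply/lfunP => f; apply: val_inj; apply/lfunP => x.
rewrite comp_lfunE -[LHS]/((star_act (a * b) f : mor M regl) x).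
rewrite -[RHS]/((star_act b (star_act a f) : mor M regl) x).
by rewrite !star_actE mulrA.
Qed.

Definition star : rmod := RMod star_act1 star_actM.
End Star.

Definition star_map (M N : lmod) (f : mor M N) : 'Hom(star N, star M) :=
  linfun (fun g : mor N regl => mcomp g f).

Lemma star_mapE (M N : lmod) (f : mor M N) (g : mor N regl) :
  star_map f g = mcomp g f.
Proof.
rewrite /star_map linfun_linE // => k g1 g2.
by apply: val_inj; apply/lfunP => x; rewrite /= !lfun_simp.
Qed.

(* The Nakayama functor D Hom_A(-, A) *)
Definition nak (M : lmod) : lmod := dual (star M).

Lemma nak_map_subproof (M N : lmod) (f : mor M N) :
  dual_map (star_map f) \in homv (nak M) (nak N).
Proof.
apply/homvP => a phi; rewrite !dual_mapE.
rewrite -[lact (nak N) a _]/(dual_act _ a _) -[lact (nak M) a _]/(dual_act _ a _).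
rewrite !dual_actE.
apply/lfunP => g; rewrite !comp_lfunE !star_mapE.
congr (phi _); apply: val_inj; apply/lfunP => x.
rewrite -[LHS]/((star_act M a (mcomp g f) : mor M regl) x).
rewrite -[RHS]/(mcomp (star_act N a g : mor N regl) f x) star_actE.
by rewrite /mor_fun /= !comp_lfunE -[RHS]/((star_act N a g : mor N regl) (f x)) star_actE.
Qed.

Definition nak_map (M N : lmod) (f : mor M N) : mor (nak M) (nak N) :=
  Subvs (nak_map_subproof f).

Lemma nak_mapE (M N : lmod) (f : mor M N) (phi : nak M) (g : star N) :
  (nak_map f phi : 'Hom(star N, K^o)) g = (phi : 'Hom(star M, K^o)) (mcomp g f).
Proof.
have /lfunP/(_ g) := dual_mapE (star_map f) phi.
by rewrite comp_lfunE star_mapE.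
Qed.

Lemma nak_map0 (M N : lmod) : nak_map (0 : mor M N) = 0.
Proof.
apply: val_inj; apply/lfunP => phi; apply/lfunP => g.
rewrite -[LHS]/((nak_map 0 phi : 'Hom(star N, K^o)) g) nak_mapE /= !lfunE /=.
rewrite [mcomp g 0](_ : _ = 0) ?linear0 //.
by apply: val_inj; apply/lfunP => x; rewrite /= !lfun_simp linear0.
Qed.

Lemma nak_map_comp (M N P : lmod) (g : mor N P) (f : mor M N) :
  nak_map (mcomp g f) = mcomp (nak_map g) (nak_map f).
Proof.
apply: val_inj; apply/lfunP => phi; apply/lfunP => h.
rewrite -[LHS]/((nak_map (mcomp g f) phi : 'Hom(star P, K^o)) h) /= comp_lfunE.
rewrite -[RHS]/((nak_map g (nak_map f phi) : 'Hom(star P, K^o)) h) !nak_mapE.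
by congr ((phi : 'Hom(_, _)) _); apply: val_inj; rewrite /= comp_lfunA.
Qed.

End Modules.

Section Complexes.
Variables (K : fieldType) (A : falgType K).
Notation lmod := (lmod A).

(* Cochain complexes indexed by int. The differential is given for all pairs
   of degrees and vanishes unless they are consecutive. *)
Record cplx := Cplx {
  cob :> int -> lmod;
  cd : forall i j, mor (cob i) (cob j);
  cd_shape : forall i j, j != i + 1 -> cd i j = 0;
  cd_cd : forall i j k, mcomp (cd j k) (cd i j) = 0 }.

Record chmap (C D : cplx) := ChMap {
  ch :> forall i, mor (C i) (D i);
  ch_comm : forall i j, mcomp (cd D i j) (ch i) = mcomp (ch j) (cd C i j) }.

Definition bounded (C : cplx) :=
  exists N : nat, forall i : int, (N < `|i|)%N -> is_zero (C i).

Definition cocycles (C : cplx) (i : int) : {vspace C i} :=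
  lker (cd C i (i + 1)).
Definition coboundaries (C : cplx) (i : int) : {vspace C i} :=
  limg (cd C (i - 1) i).

(* H^i(C) = 0 *)
Definition acyclic_at (C : cplx) (i : int) :=
  (cocycles C i <= coboundaries C i)%VS.

(* Injectivity and surjectivity of H^i(C) -> H^i(D) for all i *)
Definition qis (C D : cplx) (f : chmap C D) :=
  forall i : int,
    (forall x, x \in cocycles C i -> f i x \in coboundaries D i ->
       x \in coboundaries C i) /\
    (forall y, y \in cocycles D i ->
       exists2 x, x \in cocycles C i & y - f i x \in coboundaries D i).

(* Isomorphism in D^b(mod A): a roof C <- E -> D of morphisms of bounded
   complexes is invertible iff both of its legs are quasi-isomorphisms. *)
Definition derived_iso (C D : cplx) :=
  exists E : cplx, bounded E /\
    (exists s : chmap E C, qis s) /\ (exists t : chmap E D, qis t).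

Section Stalk.
Variable M : lmod.

Definition stalk_ob (i : int) : lmod := if i == 0 then M else zmod A.

Lemma stalk_shape (i j : int) :
  j != i + 1 -> (0 : mor (stalk_ob i) (stalk_ob j)) = 0.
Proof. by []. Qed.

Lemma stalk_cd (i j k : int) :
  mcomp (0 : mor (stalk_ob j) (stalk_ob k)) (0 : mor (stalk_ob i) (stalk_ob j))
  = 0.
Proof. by apply: val_inj; rewrite /= comp_lfun0l. Qed.

(* M placed in degree 0 *)
Definition stalk : cplx := Cplx stalk_shape stalk_cd.
End Stalk.

Section Shift.
Variables (C : cplx) (m : int).

Definition shift_d (i j : int) : mor (C (i + m)) (C (j + m)) :=
  (-1) ^ m *: cd C (i + m) (j + m).

Lemma shift_shape i j : j != i + 1 -> shift_d i j = 0.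
Proof.
move=> ij; rewrite /shift_d cd_shape ?scaler0 //.
by apply: contra ij; rewrite addrAC => /eqP/addIr->.
Qed.

Lemma shift_cd i j k : mcomp (shift_d j k) (shift_d i j) = 0.
Proof.
have /(congr1 vsval) /= e := cd_cd C (i + m) (j + m) (k + m).
apply: val_inj; rewrite /= -comp_lfunZl -comp_lfunZr.
by rewrite [(_ \o _)%VF]e !scaler0.
Qed.

(* C[m] *)
Definition shift : cplx :=
  @Cplx (fun i => C (i + m)) shift_d shift_shape shift_cd.
End Shift.

Section NakC.
Variable C : cplx.

Lemma nakC_shape i j : j != i + 1 -> nak_map (cd C i j) = 0.
Proof. by move=> ij; rewrite cd_shape ?nak_map0. Qed.

Lemma nakC_cd i j k : mcomp (nak_map (cd C j k)) (nak_map (cd C i j)) = 0.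
Proof. by rewrite -nak_map_comp cd_cd nak_map0. Qed.

Definition nakC : cplx :=
  @Cplx (fun i => nak (C i)) (fun i j => nak_map (cd C i j)) nakC_shape nakC_cd.
End NakC.

Definition proj_resolution (P : cplx) (M : lmod) :=
  [/\ forall i : int, projective (P i),
      forall i : int, 0 < i -> is_zero (P i)
    & exists f : chmap P (stalk M), qis f].

(* gl.dim A <= n *)
Definition gldim_le (n : nat) :=
  forall M : lmod, exists P : cplx, proj_resolution P M /\
    forall i : int, i < - n%:Z -> is_zero (P i).

(* Ext^i_A(M, N) = 0, i.e. H^i(Hom_A(P, N)) = 0 for a projective resolution P
   of M; P_i of homological indexing is P (- i) here. *)
Definition ext_zero (i : nat) (M N : lmod) :=
  exists P : cplx, proj_resolution P M /\
    forall g : mor (P (- i%:Z)) N,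
      mcomp g (cd P (- i%:Z - 1) (- i%:Z)) = 0 ->
      exists h : mor (P (- i%:Z + 1)) N,
        g = mcomp h (cd P (- i%:Z) (- i%:Z + 1)).

(* nu X is isomorphic to Y in D^b(mod A), where nu = D RHom_A(-, A) is computed
   on a bounded projective resolution of X (one exists if gl.dim A is finite). *)
Definition nu (X Y : cplx) :=
  exists P : cplx,
    [/\ bounded P, forall i : int, projective (P i),
        exists f : chmap P X, qis f
      & derived_iso (nakC P) Y].

(* nu_n X = nu (X[-n]) *)
Definition nu_ (n : nat) (X Y : cplx) := nu (shift X (- n%:Z)) Y.

Fixpoint nu_iter (n k : nat) (X Y : cplx) : Prop :=
  if k is k'.+1 then exists Z : cplx, [/\ bounded Z, nu_ n X Z & nu_iter n k' Z Y]
  else derived_iso X Y.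

(* nu_n^i X is isomorphic to Y in D^b(mod A). As nu_n is an autoequivalence when
   gl.dim A is finite, nu_n^(-k) X is the object Y, unique up to isomorphism,
   with nu_n^k Y isomorphic to X. *)
Definition nu_pow (n : nat) (i : int) (X Y : cplx) : Prop :=
  match i with
  | Posz k => nu_iter n k X Y
  | Negz k => nu_iter n k.+1 Y X
  end.

(* Membership of an object of D^b(mod A) in mod A *)
Definition in_mod (Y : cplx) := forall j : int, j != 0 -> acyclic_at Y j.

(* nu_n^i X lies in mod A *)
Definition nu_pow_in_mod (n : nat) (i : int) (X : cplx) :=
  exists Y : cplx, [/\ bounded Y, nu_pow n i X Y & in_mod Y].

End Complexes.

Section Regular.
Variables (K : fieldType) (A : falgType K) (n : nat).

Definition n_rep_infinite :=
  gldim_le A n /\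
  forall i : nat, nu_pow_in_mod n (- i%:Z) (stalk (regl A)).

(* The classes P and I, consisting of modules since A is n-representation
   infinite *)
Definition n_preprojective : lmod A -> Prop :=
  add (fun N => exists i : nat,
    nu_pow n (- i%:Z) (stalk (regl A)) (stalk N)).

Definition n_preinjective : lmod A -> Prop :=
  add (fun N => exists i : nat,
    nu_pow n i%:Z (stalk (dual (regr A))) (stalk N)).

Definition n_regular (X : lmod A) :=
  forall i : nat, (0 < i)%N ->
    (forall M, n_preprojective M -> ext_zero i M X) /\
    (forall M, n_preinjective M -> ext_zero i X M).

End Regular.

(* Main.v *)
From HB Require Import structures.
Require Import Defs.
From mathcomp Require Import all_boot all_order all_algebra all_field.
From mathcomp Require Import zify.
From Stdlib Require Import ClassicalEpsilon.

Set Implicit Arguments.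
Unset Strict Implicit.
Unset Printing Implicit Defensive.

Import Order.TTheory GRing.Theory Num.Theory.
Local Open Scope ring_scope.

(** In the derived category, [Ext^j(nu_n^-i A, X)] is [Hom(A, nu_n^i X [j])],
    the cohomology of [nu_n^i X] in degree [j], because [nu_n] is fully
    faithful.  Likewise [Ext^j(X, nu_n^i DA)] is [Hom(nu_n^-i X, DA[j])], which
    is dual to the cohomology of [nu_n^-i X] in degree [-j].  So if all
    [nu_n^i X] are modules, then [X] is regular.  Conversely, regularity kills
    half of the cohomology of every [nu_n^i X].  The other half vanishes step by
    step: if [M] is a module, then a projective resolution of length [n] puts
    [nu_n M] into degrees [0] to [n], and a coresolution of length [n] by modules
    [nak Q] with [Q] projective puts [nu_n^-1 M] into degrees [-n] to [0].
    Hence each step along the orbit of [X] leads from a module to a module.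

    Everything rests on one duality.  For [P] projective, Hom(M, nak P) and
    Hom(P, M) are dual to each other, naturally in both arguments ([serre_inj],
    [serre_surj], [serre_natl], [serre_natr]).  Taking total complexes, for a
    bounded complex [Q] of projective modules the homotopy classes of maps
    [C -> nak Q] vanish in degree [m] if and only if those of maps [Q -> C]
    vanish in degree [-m] ([serre_hom0]).  Applied twice, this replaces full
    faithfulness of [nu] as far as vanishing of morphisms is concerned
    ([RH_nu]); applied to [nak A], which is [DA], it computes morphisms into
    [DA] ([RH_dual]).  On modules it shows that [nak] is fully faithful on
    projective modules and that its values on them are injective.

    Derived morphism spaces are computed on projective resolutions.  A map from
    a right bounded complex of projective modules to an acyclic complex is null
    homotopic ([acyclic_hom0]); applied to mapping cones, this gives lifting
    through quasi-isomorphisms, unique up to homotopy ([qis_lift],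
    [qis_lift_null]), and so independence of the resolution ([RH_any]).

    The global dimension hypothesis speaks of projective resolutions only.  That
    coresolutions stop after [n] steps is dimension shifting ([pd_lift]): it
    makes the differential out of degree [n] of an infinite coresolution
    von Neumann regular ([cosyzygy_split]), so its kernel splits off
    ([coresolution_exists]).  Finally, [nu_n^i DA] is a module for [i >= 0],
    since its cohomology is dual to that of [nu_n^-i A] ([injective_orbit]), and
    the objects [nu_n^-i A] are represented by modules ([projective_orbit]). *)

(** * Modules and their morphisms *)

Section LinearMaps.
Variables (K : fieldType) (U V : vectType K) (f : 'Hom(U, V)).

Lemma lf0 : f 0 = 0. Proof. exact: linear0. Qed.
Lemma lfD x y : f (x + y) = f x + f y. Proof. exact: linearD. Qed.
Lemma lfB x y : f (x - y) = f x - f y. Proof. exact: linearB. Qed.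
Lemma lfZ k x : f (k *: x) = k *: f x. Proof. exact: linearZ. Qed.
Lemma lfP k x y : f (k *: x + y) = k *: f x + f y. Proof. exact: linearP. Qed.
Lemma lf_sum I (r : seq I) (F : I -> U) :
  f (\sum_(i <- r) F i) = \sum_(i <- r) f (F i).
Proof. exact: linear_sum. Qed.

End LinearMaps.

Arguments mor_fun : simpl never.
Arguments nak : simpl never.
Arguments regl : simpl never.
Arguments dual : simpl never.
Arguments dsum : simpl never.

(* Keyed on [mor], so that the vector space structure of a space of morphisms is
   found without unfolding the two modules. *)
HB.instance Definition _ (K : fieldType) (A : falgType K) (M N : lmod A) :=
  Vector.copy (mor M N) (subvs_of (homv M N)).

Section Morphisms.
Variables (K : fieldType) (A : falgType K).
Implicit Types M N P Q : lmod A.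

Lemma mor_ext M N (f g : mor M N) : (forall x, f x = g x) -> f = g.
Proof. by move=> fg; apply: val_inj; apply/lfunP. Qed.

Lemma mcompE M N P (g : mor N P) (f : mor M N) x : mcomp g f x = g (f x).
Proof. by rewrite /mor_fun /= comp_lfunE. Qed.

Lemma midE M (x : M) : mid M x = x.
Proof. by rewrite /mor_fun /= id_lfunE. Qed.

Lemma morD M N (f g : mor M N) x : (f + g : mor M N) x = f x + g x.
Proof. by rewrite /mor_fun /= add_lfunE. Qed.

Lemma morZ M N (k : K) (f : mor M N) x : (k *: f : mor M N) x = k *: f x.
Proof. by rewrite /mor_fun /= scale_lfunE. Qed.

Lemma mor0 M N x : (0 : mor M N) x = 0.
Proof. by rewrite /mor_fun /= zero_lfunE. Qed.

Lemma morN M N (f : mor M N) x : (- f : mor M N) x = - f x.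
Proof. by rewrite /mor_fun /= opp_lfunE. Qed.

Lemma morB M N (f g : mor M N) x : (f - g : mor M N) x = f x - g x.
Proof. by rewrite morD morN. Qed.

Lemma mor_sum M N I (r : seq I) (F : I -> mor M N) x :
  (\sum_(i <- r) F i : mor M N) x = \sum_(i <- r) F i x.
Proof.
elim: r => [|i r IHr]; first by rewrite !big_nil mor0.
by rewrite !big_cons morD IHr.
Qed.

Lemma mcompA M N P Q (h : mor P Q) (g : mor N P) (f : mor M N) :
  mcomp h (mcomp g f) = mcomp (mcomp h g) f.
Proof. by apply: mor_ext => x; rewrite !mcompE. Qed.

Lemma mcompDl M N P (g h : mor N P) (f : mor M N) :
  mcomp (g + h) f = mcomp g f + mcomp h f.
Proof. by apply: mor_ext => x; rewrite !(mcompE, morD). Qed.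

Lemma mcompDr M N P (h : mor N P) (f g : mor M N) :
  mcomp h (f + g) = mcomp h f + mcomp h g.
Proof. by apply: mor_ext => x; rewrite !(mcompE, morD) lfD. Qed.

Lemma mcompZl M N P (k : K) (g : mor N P) (f : mor M N) :
  mcomp (k *: g) f = k *: mcomp g f.
Proof. by apply: mor_ext => x; rewrite !(mcompE, morZ). Qed.

Lemma mcompZr M N P (k : K) (g : mor N P) (f : mor M N) :
  mcomp g (k *: f) = k *: mcomp g f.
Proof. by apply: mor_ext => x; rewrite !(mcompE, morZ) lfZ. Qed.

Lemma mcompNl M N P (g : mor N P) (f : mor M N) :
  mcomp (- g) f = - mcomp g f.
Proof. by rewrite -scaleN1r mcompZl scaleN1r. Qed.

Lemma mcompNr M N P (g : mor N P) (f : mor M N) :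
  mcomp g (- f) = - mcomp g f.
Proof. by rewrite -scaleN1r mcompZr scaleN1r. Qed.

Lemma mcompBl M N P (g h : mor N P) (f : mor M N) :
  mcomp (g - h) f = mcomp g f - mcomp h f.
Proof. by rewrite mcompDl mcompNl. Qed.

Lemma mcompBr M N P (h : mor N P) (f g : mor M N) :
  mcomp h (f - g) = mcomp h f - mcomp h g.
Proof. by rewrite mcompDr mcompNr. Qed.

Lemma mcomp0l M N P (f : mor M N) : mcomp (0 : mor N P) f = 0.
Proof. by apply: mor_ext => x; rewrite mcompE !mor0. Qed.

Lemma mcomp0r M N P (g : mor N P) : mcomp g (0 : mor M N) = 0.
Proof. by apply: mor_ext => x; rewrite mcompE !mor0 lf0. Qed.

Lemma mcomp1l M N (f : mor M N) : mcomp (mid N) f = f.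
Proof. by apply: mor_ext => x; rewrite mcompE midE. Qed.

Lemma mcomp1r M N (f : mor M N) : mcomp f (mid M) = f.
Proof. by apply: mor_ext => x; rewrite mcompE midE. Qed.

Lemma mor_zero_src M N (f : mor M N) : is_zero M -> f = 0.
Proof. by move=> M0; apply: mor_ext => x; rewrite (M0 x) !lf0. Qed.

Lemma mor_zero_tgt M N (f : mor M N) : is_zero N -> f = 0.
Proof. by move=> N0; apply: mor_ext => x; rewrite (N0 (f x)) mor0. Qed.

Lemma zmod_is_zero : is_zero (zmod A).
Proof. by move=> x; apply/rowP; case. Qed.

Definition mk_mor M N (phi : M -> N) (phi_lin : linear phi)
  (phi_act : forall a x, phi (lact M a x) = lact N a (phi x)) : mor M N.
Proof.
refine (@Subvs _ _ (homv M N) (linfun phi) _).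
by apply/homvP => a x; rewrite !linfun_linE.
Defined.

Lemma mk_morE M N (phi : M -> N) l r x : @mk_mor M N phi l r x = phi x.
Proof. by rewrite /mor_fun /= linfun_linE. Qed.

Lemma mor_imgP M N (f : mor M N) y :
  reflect (exists x, y = f x) (y \in limg f).
Proof.
apply: (iffP memv_imgP) => [[x _ ->]|[x ->]]; first by exists x.
by exists x; rewrite ?memvf.
Qed.

Lemma mor_surjP M N (f : mor M N) :
  limg f = fullv <-> forall y, exists x, y = f x.
Proof.
split=> [f1 y|fS]; first by apply/mor_imgP; rewrite f1 memvf.
by apply/vspaceP => y; rewrite memvf; apply/mor_imgP.
Qed.

(** Dividing by a surjection: the linear section of [e] is not a morphism, but
    the composite does not depend on it. *)
Lemma mor_descend P C N (e : mor P C) (t : mor P N) :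
  limg e = fullv -> (forall x, e x = 0 -> t x = 0) ->
  exists s : mor C N, mcomp s e = t.
Proof.
move=> eS et.
have eq_t x y : e x = e y -> t x = t y.
  move=> exy; have: t (x - y) = 0 by apply: et; rewrite lfB exy subrr.
  by move/eqP; rewrite lfB subr_eq0 => /eqP.
have eK y : e ((e^-1)%VF y) = y by rewrite limg_lfunVK // eS memvf.
have sl : linear (fun y => t ((e^-1)%VF y)).
  by move=> k y z; rewrite !linearP.
have sa a y : t ((e^-1)%VF (lact C a y)) = lact N a (t ((e^-1)%VF y)).
  by rewrite -morE; apply: eq_t; rewrite morE !eK.
exists (mk_mor sl sa); apply: mor_ext => x.
by rewrite mcompE mk_morE; apply: eq_t; rewrite eK.
Qed.

Lemma mor_corestrict P C M (i : mor C M) (f : mor P M) :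
  (forall x, i x = 0 -> x = 0) -> (forall x, f x \in limg i) ->
  exists g : mor P C, mcomp i g = f.
Proof.
move=> i0 fi.
have iI x y : i x = i y -> x = y.
  by move=> ixy; apply/eqP; rewrite -subr_eq0; apply/eqP/i0;
    rewrite lfB ixy subrr.
have iK x : i ((i^-1)%VF (f x)) = f x by rewrite limg_lfunVK.
have sl : linear (fun y => (i^-1)%VF (f y)).
  by move=> k y z; rewrite !linearP.
have sa a y : (i^-1)%VF (f (lact P a y)) = lact C a ((i^-1)%VF (f y)).
  by apply: iI; rewrite iK !morE iK.
by exists (mk_mor sl sa); apply: mor_ext => x; rewrite mcompE mk_morE iK.
Qed.

Section Submodule.
Variables (M : lmod A) (U : {vspace M}).
Hypothesis U_stable : forall a x, x \in U -> lact M a x \in U.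

Definition sub_act : 'Hom(A, 'Hom(subvs_of U, subvs_of U)) :=
  linfun (fun a => linfun (fun x : subvs_of U =>
    vsproj U (lact M a (vsval x)))).

Lemma sub_actE a x : vsval (sub_act a x) = lact M a (vsval x).
Proof.
have lin1 b : linear (fun x : subvs_of U => vsproj U (lact M b (vsval x))).
  by move=> k u v; rewrite !linearP.
have lin2 : linear (fun b => linfun (fun x : subvs_of U =>
    vsproj U (lact M b (vsval x)))).
  move=> k b c; apply/lfunP => y; rewrite add_lfunE scale_lfunE !linfun_linE //.
  by rewrite linearP /= add_lfunE scale_lfunE linearP.
by rewrite /sub_act !linfun_linE // vsprojK // U_stable ?subvsP.
Qed.

Lemma sub_act1 : sub_act 1 = \1%VF.
Proof.
by apply/lfunP => x; apply: subvs_inj; rewrite sub_actE lact1 !id_lfunE.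
Qed.

Lemma sub_actM a b : sub_act (a * b) = (sub_act a \o sub_act b)%VF.
Proof.
apply/lfunP => x; apply: subvs_inj.
by rewrite comp_lfunE !sub_actE lactM comp_lfunE.
Qed.

Definition submod : lmod A := LMod sub_act1 sub_actM.

Lemma sub_incl_subproof : linear (fun x : submod => vsval (x : subvs_of U)).
Proof. by move=> k x y; rewrite !linearP. Qed.

Definition sub_incl : mor submod M := mk_mor sub_incl_subproof sub_actE.

Lemma sub_inclE x : sub_incl x = vsval (x : subvs_of U).
Proof. exact: mk_morE. Qed.

Lemma sub_incl_inj x : sub_incl x = 0 -> x = 0.
Proof. by rewrite sub_inclE => x0; apply: subvs_inj; rewrite x0 linear0. Qed.

Lemma mem_sub_incl y : (y \in limg sub_incl) = (y \in U).
Proof.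
apply/mor_imgP/idP => [[x ->]|yU]; first by rewrite sub_inclE subvsP.
by exists (vsproj U y); rewrite sub_inclE vsprojK.
Qed.

End Submodule.

Lemma kernel_exists M N (f : mor M N) :
  exists (C : lmod A) (i : mor C M),
    (forall x, i x = 0 -> x = 0) /\ (forall y, (y \in limg i) = (f y == 0)).
Proof.
have st a x : x \in lker f -> lact M a x \in lker f.
  by rewrite !memv_ker => /eqP fx; rewrite morE fx lf0.
exists (submod st), (sub_incl st); split; first exact: sub_incl_inj.
by move=> y; rewrite mem_sub_incl memv_ker.
Qed.

(** The quotient of [N] by the image of [f] lives on a linear complement of
    that image, with the action projected along the image. *)
Lemma cokernel_exists M N (f : mor M N) :
  exists (C : lmod A) (p : mor N C),
    limg p = fullv /\ (forall y, (p y == 0) = (y \in limg f)).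
Proof.
have [pr prE] : exists pr : 'Hom(N, N), forall y, pr y = y - projv (limg f) y.
  exists (\1%VF - projv (limg f)) => y.
  by rewrite add_lfunE opp_lfunE id_lfunE.
have pr0 y : (pr y == 0) = (y \in limg f).
  rewrite prE subr_eq0; apply/eqP/idP => [->|yf]; first exact: memv_proj.
  by rewrite projv_id.
have prpr y : pr (pr y) = pr y.
  by apply/eqP; rewrite -subr_eq0 -lfB pr0 prE addrAC subrr add0r memvN memv_proj.
have pr_act a y : pr (lact N a (pr y)) = pr (lact N a y).
  apply/eqP; rewrite -subr_eq0 -lfB -lfB pr0.
  have: pr y - y \in limg f by rewrite -pr0 lfB prpr subrr.
  by case/mor_imgP=> x ->; rewrite -morE; apply/mor_imgP; exists (lact M a x).
pose Q := subvs_of (limg pr).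
have QP (x : Q) : pr (vsval x) = vsval x.
  by have /memv_imgP[y _ ->] := subvsP x.
pose act (a : A) (x : Q) : Q := vsproj (limg pr) (pr (lact N a (vsval x))).
have prQ y : vsval (vsproj (limg pr) (pr y)) = pr y.
  by rewrite vsprojK // memv_img ?memvf.
have lin1 b : linear (act b) by move=> k u v; rewrite /act !linearP.
have lin2 : linear (fun b => linfun (act b)).
  move=> k b c; apply/lfunP => y; rewrite add_lfunE scale_lfunE !linfun_linE //.
  by rewrite /act lfP add_lfunE scale_lfunE !linearP.
pose qact : 'Hom(A, 'Hom(Q, Q)) := linfun (fun b => linfun (act b)).
have qactE a x : qact a x = act a x by rewrite /qact !linfun_linE.
have q1 : qact 1 = \1%VF.
  apply/lfunP => x; apply: subvs_inj; rewrite qactE /act prQ lact1 !id_lfunE.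
  exact: QP.
have qM a b : qact (a * b) = (qact a \o qact b)%VF.
  apply/lfunP => x; apply: subvs_inj.
  by rewrite comp_lfunE !qactE /act !prQ lactM comp_lfunE pr_act.
pose C : lmod A := LMod q1 qM.
have pl : linear (fun y : N => vsproj (limg pr) (pr y) : C).
  by move=> k u v; rewrite !linearP.
have pa a y : (vsproj (limg pr) (pr (lact N a y)) : C)
            = lact C a (vsproj (limg pr) (pr y) : C).
  by apply: subvs_inj; rewrite [lact C a _]qactE /act !prQ pr_act.
exists C, (mk_mor pl pa); split.
  apply/mor_surjP => y; exists (vsval (y : Q)); rewrite mk_morE.
  by apply: subvs_inj; rewrite prQ QP.
move=> y; rewrite mk_morE -pr0.
apply/eqP/eqP => [y0|->]; last by rewrite linear0.
by rewrite -prQ y0 linear0.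
Qed.

End Morphisms.

(** * Elements of [nak M] *)

Section Duality.
Variables (K : fieldType) (A : falgType K).
Implicit Types M N P Q : lmod A.
Notation regl := (regl A).

(** The image of an elementary tensor under the map from the tensor product of
    Hom(P, A) and [M] to Hom(P, M). *)
Definition tens P M (a : mor P regl) (y : M) : mor P M.
Proof.
refine (@mk_mor _ _ P M (fun x => lact M (a x : A) y) _ _).
- by move=> k u v; rewrite !lfP add_lfunE scale_lfunE.
- by move=> c x; rewrite morE regl_actE lactM comp_lfunE.
Defined.

Lemma tensE P M (a : mor P regl) (y : M) x : tens a y x = lact M (a x : A) y.
Proof. exact: mk_morE. Qed.

Lemma mcomp_tens P M N (u : mor M N) (a : mor P regl) (y : M) :
  mcomp u (tens a y) = tens a (u y).
Proof. by apply: mor_ext => x; rewrite mcompE !tensE morE. Qed.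

Lemma tens_mcomp P Q M (v : mor Q P) (a : mor P regl) (y : M) :
  mcomp (tens a y) v = tens (mcomp a v) y.
Proof. by apply: mor_ext => x; rewrite mcompE !tensE mcompE. Qed.

Definition nev M (phi : nak M) (g : mor M regl) : K :=
  (phi : 'Hom(star M, K^o)) g.

Lemma nevP M (phi : nak M) k g h :
  nev phi (k *: g + h) = k * nev phi g + nev phi h.
Proof. exact: (lfP (phi : 'Hom(star M, K^o)) k (g : star M) (h : star M)). Qed.

Lemma nev_ext M (phi psi : nak M) : (forall g, nev phi g = nev psi g) -> phi = psi.
Proof. by move=> e; apply/lfunP => g; apply: e. Qed.

Lemma nev_lin M (g : mor M regl) k (phi psi : nak M) :
  nev (k *: phi + psi) g = k * nev phi g + nev psi g.
Proof. by rewrite /nev add_lfunE scale_lfunE. Qed.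

Lemma nev0 M (g : mor M regl) : nev (0 : nak M) g = 0.
Proof. by rewrite /nev zero_lfunE. Qed.

Lemma nev_mk M (theta : mor M regl -> K) :
  (forall k g h, theta (k *: g + h) = k * theta g + theta h) ->
  exists phi : nak M, forall g, nev phi g = theta g.
Proof.
move=> tl; have tl' : linear (theta : star M -> K^o) by move=> k g h; apply: tl.
by exists (linfun (theta : star M -> K^o)) => g; rewrite /nev linfun_linE.
Qed.

Lemma nev_act M (phi : nak M) a (g : mor M regl) :
  nev (lact (nak M) a phi) g = nev phi (tens g (a : regl)).
Proof.
rewrite /nev -[lact (nak M) a]/(dual_act _ a) dual_actE comp_lfunE.
congr (_ _); apply: mor_ext => x.
by rewrite -[LHS]/((star_act M a g : mor M regl) x) star_actE tensE regl_actE.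
Qed.

Lemma nev_map M N (f : mor M N) (phi : nak M) (g : mor N regl) :
  nev (nak_map f phi) g = nev phi (mcomp g f).
Proof. exact: nak_mapE. Qed.

Lemma nak_map1 M : nak_map (mid M) = mid (nak M).
Proof.
by apply: mor_ext => x; apply: nev_ext => g; rewrite nev_map mcomp1r midE.
Qed.

Lemma nak_mapP M N k (f g : mor M N) :
  nak_map (k *: f + g) = k *: nak_map f + nak_map g.
Proof.
apply: mor_ext => x; apply: nev_ext => h.
by rewrite nev_map mcompDr mcompZr morD morZ nev_lin nevP !nev_map.
Qed.

Lemma nak_mapB M N (f g : mor M N) : nak_map (f - g) = nak_map f - nak_map g.
Proof. by rewrite addrC -scaleN1r nak_mapP scaleN1r addrC. Qed.

Lemma nak_zero M : is_zero M -> is_zero (nak M).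
Proof.
move=> M0 phi; apply: nev_ext => g; rewrite nev0 (mor_zero_src g M0).
exact: (lf0 (phi : 'Hom(star M, K^o))).
Qed.

(** * Projective modules and dual bases *)

Section FreeModule.
Variable r : nat.

Let fcar : vectType K := {ffun 'I_r -> A}.

Definition free_act : 'Hom(A, 'Hom(fcar, fcar)) :=
  linfun (fun a : A => linfun (fun c : fcar => [ffun k => a * c k] : fcar)).

Lemma free_actE a (c : fcar) k : (free_act a c : {ffun _ -> _}) k = a * c k.
Proof.
have lin1 b : linear (fun c : fcar => [ffun k => b * c k] : fcar).
  by move=> l u v; apply/ffunP => i; rewrite !ffunE mulrDr scalerAr.
have lin2 : linear (fun b : A => linfun (fun c : fcar => [ffun k => b * c k] : fcar)).
  move=> l b b'; apply/lfunP => y; rewrite add_lfunE scale_lfunE !linfun_linE //.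
  by apply/ffunP => i; rewrite !ffunE mulrDl scalerAl.
by rewrite /free_act !linfun_linE // ffunE.
Qed.

Lemma free_act1 : free_act 1 = \1%VF.
Proof.
by apply/lfunP => c; apply/ffunP => k; rewrite free_actE id_lfunE mul1r.
Qed.

Lemma free_actM a b : free_act (a * b) = (free_act a \o free_act b)%VF.
Proof.
by apply/lfunP => c; apply/ffunP => k; rewrite comp_lfunE !free_actE mulrA.
Qed.

Definition freem : lmod A := LMod free_act1 free_actM.

Definition free_coord (k : 'I_r) : mor freem regl.
Proof.
refine (@mk_mor _ _ freem regl (fun c => (c : {ffun 'I_r -> A}) k) _ _).
- by move=> l u v; rewrite !ffunE.
- by move=> a c; rewrite free_actE regl_actE.
Defined.

Lemma free_coordE k c : free_coord k c = (c : {ffun 'I_r -> A}) k.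
Proof. exact: mk_morE. Qed.

Definition free_gen (k : 'I_r) : freem := [ffun l => (l == k)%:R].

End FreeModule.

(** The type is informative, so that pairings can be defined from a dual basis. *)
Definition dual_basis P := {r : nat & {a : 'I_r -> mor P regl &
  {b : 'I_r -> P | forall x, x = \sum_k lact P (a k x : A) (b k)}}}.

Lemma free_dual_basis r : dual_basis (freem r).
Proof.
exists r, (@free_coord r), (@free_gen r) => x.
apply/ffunP => j; rewrite sum_ffunE (bigD1 j) //= big1 => [|k kj].
  by rewrite free_actE free_coordE ffunE eqxx mulr1 addr0.
by rewrite free_actE ffunE eq_sym (negPf kj) mulr0.
Qed.

Lemma dual_basis_lift P M N (p : mor M N) (f : mor P N) :
  dual_basis P -> (forall x, f x \in limg p) -> exists g, mcomp p g = f.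
Proof.
move=> [r [a [b abE]]] fp.
exists (\sum_k tens (a k) ((p^-1)%VF (f (b k)))); apply: mor_ext => x.
rewrite mcompE mor_sum lf_sum [in RHS](abE x) lf_sum; apply: eq_bigr => k _.
by rewrite tensE !morE limg_lfunVK.
Qed.

Lemma dual_basis_projective P : dual_basis P -> projective P.
Proof.
by move=> bP M N p pS f; apply: dual_basis_lift => // x; rewrite pS memvf.
Qed.

(** A dual basis is a section of a surjection from a free module. *)
Lemma projective_dual_basis P : projective P -> dual_basis P.
Proof.
move=> prP; pose r := \dim {:P}; pose e := vbasis {:P}.
pose p : mor (freem r) P := \sum_k tens (free_coord k) e`_k.
have pE c : p c = \sum_k lact P ((c : {ffun 'I_r -> A}) k) e`_k.
  by rewrite mor_sum; apply: eq_bigr => k _; rewrite tensE free_coordE.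
have /constructive_indefinite_description[s ps] : exists s, mcomp p s = mid P.
  apply: prP; apply/mor_surjP => y.
  exists ([ffun k => (coord e k y)%:A] : freem r).
  rewrite pE [LHS](coord_vbasis (memvf y)); apply: eq_bigr => k _.
  by rewrite ffunE lfZ lact1 scale_lfunE id_lfunE.
exists r, (fun k => mcomp (free_coord k) s), (fun k => e`_k) => x.
rewrite -[LHS]midE -ps mcompE pE; apply: eq_bigr => k _.
by rewrite mcompE free_coordE.
Qed.

Lemma projective_lift P M N (p : mor M N) (f : mor P N) :
  projective P -> (forall x, f x \in limg p) -> exists g, mcomp p g = f.
Proof. by move=> /projective_dual_basis; apply: dual_basis_lift. Qed.

Lemma projective_retract P Q (i : mor P Q) (r : mor Q P) :
  mcomp r i = mid P -> projective Q -> projective P.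
Proof.
move=> ri prQ M N p pS f.
have [g pg] := prQ _ _ p pS (mcomp f r).
by exists (mcomp g i); rewrite mcompA pg -mcompA ri mcomp1r.
Qed.

Lemma projective_zero P : is_zero P -> projective P.
Proof. by move=> P0 M N p _ f; exists 0; rewrite mcomp0r (mor_zero_src f P0). Qed.

Lemma projective_regl : projective regl.
Proof.
apply: dual_basis_projective; exists 1%N, (fun=> mid regl), (fun=> 1) => x.
by rewrite big_ord1 midE regl_actE mulr1.
Qed.

(** * The Nakayama functor on projective modules *)

(** Serre duality on modules: for projective [P] the spaces Hom(M, nak P) and
    Hom(P, M) are dual to each other.  A functional on Hom(P, M) is determined
    by its values on the maps [tens a y], because the dual basis writes every
    map as a sum of these; this also makes naturality immediate. *)
Definition serre P (bP : dual_basis P) M (f : mor M (nak P)) (g : mor P M) : K :=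
  let: existT _ (existT a (exist b _)) := bP in \sum_k nev (f (g (b k))) (a k).

Section Serre.
Variables (P : lmod A) (bP : dual_basis P).

Lemma serreP M (f : mor M (nak P)) k g h :
  serre bP f (k *: g + h) = k * serre bP f g + serre bP f h.
Proof.
rewrite /serre; case: bP => r [a [b _]]; rewrite mulr_sumr -big_split.
by apply: eq_bigr => i _; rewrite morD morZ lfP nev_lin.
Qed.

Lemma serre_linl M k (f f' : mor M (nak P)) g :
  serre bP (k *: f + f') g = k * serre bP f g + serre bP f' g.
Proof.
rewrite /serre; case: bP => r [a [b _]]; rewrite mulr_sumr -big_split.
by apply: eq_bigr => i _; rewrite morD morZ nev_lin.
Qed.

Lemma serre_tens M (f : mor M (nak P)) a y :
  serre bP f (tens a y) = nev (f y) a.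
Proof.
rewrite /serre; case: bP => r [c [b cbE]].
have aE : a = \sum_k tens (c k) (a (b k)).
  apply: mor_ext => x; rewrite mor_sum {1}(cbE x) lf_sum.
  by apply: eq_bigr => k _; rewrite tensE morE.
have lev (phi : nak P) I (s : seq I) (F : I -> mor P regl) :
    nev phi (\sum_(i <- s) F i) = \sum_(i <- s) nev phi (F i).
  exact: (lf_sum (phi : 'Hom(star P, K^o)) s (F : I -> star P)).
rewrite [in RHS]aE lev; apply: eq_bigr => k _.
by rewrite tensE morE nev_act.
Qed.

(** The dual basis writes every map out of [P] as a sum of maps [tens a y]. *)
Lemma serre_ind M (L L' : mor P M -> K) :
  (forall k g h, L (k *: g + h) = k * L g + L h) ->
  (forall k g h, L' (k *: g + h) = k * L' g + L' h) ->
  (forall a y, L (tens a y) = L' (tens a y)) -> L =1 L'.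
Proof.
move=> Ll Ll' LL' g; case: bP => r [c [b cbE]].
have gE : g = \sum_k tens (c k) (g (b k)).
  apply: mor_ext => x; rewrite mor_sum {1}(cbE x) lf_sum.
  by apply: eq_bigr => k _; rewrite tensE morE.
have L0 (F : mor P M -> K) :
    (forall k g h, F (k *: g + h) = k * F g + F h) -> F 0 = 0.
  by move=> Fl; have:= Fl (-1) 0 0; rewrite scaler0 addr0 mulN1r addNr.
rewrite gE; elim: (index_enum _) => [|k s IHs]; first by rewrite big_nil !L0.
by rewrite big_cons -[tens _ _]scale1r Ll Ll' IHs LL'.
Qed.

Lemma serre_inj M (f : mor M (nak P)) : (forall g, serre bP f g = 0) -> f = 0.
Proof.
move=> f0; apply: mor_ext => y; apply: nev_ext => a.
by rewrite -serre_tens f0 mor0 nev0.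
Qed.

(** The values on the maps [tens a y] dictate the only possible [f]. *)
Lemma serre_surj M (L : mor P M -> K) :
  (forall k g h, L (k *: g + h) = k * L g + L h) ->
  exists f, forall g, serre bP f g = L g.
Proof.
move=> Ll.
have tdef y : {phi : nak P | forall a, nev phi a = L (tens a y)}.
  apply: constructive_indefinite_description; apply: nev_mk => k g h.
  rewrite -Ll; congr L; apply: mor_ext => x.
  by rewrite morD morZ !tensE morD morZ lfP add_lfunE scale_lfunE.
have tl : linear (fun y => sval (tdef y)).
  move=> k y z; apply: nev_ext => a; rewrite nev_lin !(svalP (tdef _)) -Ll.
  by congr L; apply: mor_ext => x; rewrite morD morZ !tensE lfP.
have ta c y : sval (tdef (lact M c y)) = lact (nak P) c (sval (tdef y)).
  apply: nev_ext => a; rewrite nev_act !(svalP (tdef _)).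
  congr L; apply: mor_ext => x.
  by rewrite !tensE regl_actE lactM comp_lfunE.
exists (mk_mor tl ta); apply: serre_ind => // [k g h|a y].
  exact: serreP.
by rewrite serre_tens mk_morE (svalP (tdef _)).
Qed.

Lemma serre_natl M N (f : mor N (nak P)) (u : mor M N) g :
  serre bP (mcomp f u) g = serre bP f (mcomp u g).
Proof.
move: g; apply: serre_ind => [k g h|k g h|a y]; first exact: serreP.
  by rewrite mcompDr mcompZr serreP.
by rewrite mcomp_tens !serre_tens mcompE.
Qed.

End Serre.

Lemma serre_natr P Q (bP : dual_basis P) (bQ : dual_basis Q) M (v : mor P Q)
  (f : mor M (nak P)) (g : mor Q M) :
  serre bQ (mcomp (nak_map v) f) g = serre bP f (mcomp g v).
Proof.
move: g; apply: (serre_ind bQ) => [k g h|k g h|a y]; first exact: serreP.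
  by rewrite mcompDl mcompZl serreP.
by rewrite tens_mcomp !serre_tens mcompE nev_map.
Qed.

Lemma functional_extend (U V : vectType K) (i : 'Hom(U, V)) (L : 'Hom(U, K^o)) :
  (forall x, i x = 0 -> L x = 0) -> exists L' : 'Hom(V, K^o), forall x, L' (i x) = L x.
Proof.
move=> iL; exists (L \o i^-1)%VF => x; rewrite comp_lfunE.
apply/eqP; rewrite -subr_eq0 -lfB; apply/eqP/iL.
by rewrite lfB limg_lfunVK ?subrr // memv_img ?memvf.
Qed.

Lemma functional_sep (V : vectType K) (U : {vspace V}) v :
  v \notin U -> exists L : 'Hom(V, K^o), L v != 0 /\ forall u, u \in U -> L u = 0.
Proof.
move=> vU; pose w := v - projv U v.
have [e wE] : exists k, coord (vbasis fullv) k w != 0.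
  apply/existsP; apply: contraR vU; rewrite negb_exists => /forallP w0.
  have w00 : w = 0.
    rewrite (coord_vbasis (memvf w)) big1 // => k _.
    by have /negPn/eqP-> := w0 k; rewrite scale0r.
  by have /eqP := w00; rewrite subr_eq0 => /eqP->; apply: memv_proj.
have Ll : linear (fun x : V => coord (vbasis fullv) e (x - projv U x) : K^o).
  by move=> k x y; rewrite -linearP /= scalerBr lfP opprD addrACA.
exists (linfun (fun x : V => coord (vbasis fullv) e (x - projv U x) : K^o)).
rewrite linfun_linE //; split=> // u uU.
by rewrite linfun_linE // projv_id // subrr linear0.
Qed.

Lemma bidual_eval (V : vectType K) (T : 'Hom(V, K^o) -> K) :
  (forall k g h, T (k *: g + h) = k * T g + T h) ->
  exists v, forall g, T g = g v.
Proof.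
move=> Tl.
have cl (i : 'I_(\dim {:V})) : linear (coord (vbasis fullv) i : V -> K^o).
  by move=> k u v; rewrite linearP.
pose c i : 'Hom(V, K^o) := linfun (coord (vbasis fullv) i : V -> K^o).
have cE i v : c i v = coord (vbasis fullv) i v by rewrite linfun_linE.
exists (\sum_(i < \dim {:V}) T (c i) *: (vbasis fullv)`_i) => g.
have gE : g = \sum_(i < \dim {:V}) (g (vbasis fullv)`_i : K) *: c i.
  apply/lfunP => v; rewrite sum_lfunE {1}(coord_vbasis (memvf v)) lf_sum.
  apply: eq_bigr => i _; rewrite lfZ scale_lfunE cE.
  exact: mulrC.
rewrite {1}gE lf_sum.
have T0 : T 0 = 0.
  by have:= Tl (-1) 0 0; rewrite scaler0 addr0 mulN1r addNr.
elim: (index_enum _) => [|k s IHs]; first by rewrite !big_nil.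
by rewrite !big_cons Tl IHs lfZ; congr (_ + _); apply: mulrC.
Qed.

(** By Serre duality this is the extension of a functional from Hom(P, M) to
    Hom(P, N). *)
Lemma nak_injective P M N (i : mor M N) (f : mor M (nak P)) :
  projective P -> (forall x, i x = 0 -> x = 0) ->
  exists g, mcomp g i = f.
Proof.
move=> /projective_dual_basis bP i0.
have il : linear (fun h : mor P M => mcomp i h).
  by move=> k g h; rewrite mcompDr mcompZr.
have Sl : linear (fun h : mor P M => serre bP f h : K^o).
  by move=> k g h; rewrite serreP.
have [|L' LE] := @functional_extend _ _ (linfun (fun h : mor P M => mcomp i h))
    (linfun (fun h : mor P M => serre bP f h : K^o)).
  move=> h; rewrite !linfun_linE // => ih.
  suff -> : h = 0 by have:= serreP bP f (-1) 0 0; rewrite scaler0 addr0 mulN1r addNr.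
  by apply: mor_ext => x; rewrite mor0; apply: i0; rewrite -mcompE ih mor0.
have [|g gE] := serre_surj bP (L := L') _; first by move=> k x y; apply: (lfP L').
exists g; apply/eqP; rewrite -subr_eq0; apply/eqP/(serre_inj (bP := bP)) => h.
have:= serre_linl bP (-1) f (mcomp g i) h; rewrite scaleN1r addrC => ->.
have := LE h; rewrite !linfun_linE // serre_natl gE => ->.
by rewrite mulN1r addNr.
Qed.

(** If the composite of [f] with every map [Q -> A] vanishes, then so does [f],
    as the dual basis of [Q] consists of such maps. *)
Lemma nak_faithful P Q (f : mor P Q) : projective Q -> nak_map f = 0 -> f = 0.
Proof.
move=> /projective_dual_basis[r [a [b abE]]] f0.
have af k : mcomp (a k) f = 0.
  apply/eqP; apply/negPn/negP => nz.
  have [|L [/eqP Lf _]] := @functional_sep (star P) 0%VS (mcomp (a k) f).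
    by rewrite memv0.
  apply: Lf; rewrite -[LHS]/(nev (L : nak P) _) -nev_map f0 mor0.
  exact: nev0.
apply: mor_ext => x; rewrite mor0 (abE (f x)) big1 // => k _.
by rewrite -mcompE af mor0 lf0 zero_lfunE.
Qed.

(** By Serre duality a map [nak P -> nak Q] is a functional on Hom(Q, nak P),
    which is dual to Hom(P, Q); so it is evaluation at some [f : P -> Q]. *)
Lemma nak_full P Q (phi : mor (nak P) (nak Q)) :
  projective P -> projective Q -> exists f, nak_map f = phi.
Proof.
move=> /projective_dual_basis bP /projective_dual_basis bQ.
pose T (L : 'Hom(mor P Q, K^o)) : K :=
  serre bQ phi (sval (constructive_indefinite_description _
    (serre_surj bP (fun k g h => lfP L k g h)))).
have TE (G : mor Q (nak P)) (L : 'Hom(mor P Q, K^o)) :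
    (forall g, serre bP G g = L g) -> T L = serre bQ phi G.
  move=> GL; rewrite /T; case: constructive_indefinite_description => G' G'L /=.
  congr (serre _ _ _); apply/eqP; rewrite -subr_eq0; apply/eqP.
  apply: (serre_inj (bP := bP)) => h.
  have:= serre_linl bP (-1) G G' h; rewrite scaleN1r addrC => ->.
  by rewrite GL G'L mulN1r addNr.
have Sl (G : mor Q (nak P)) : linear (fun g : mor P Q => serre bP G g : K^o).
  by move=> k g h; rewrite serreP.
have Sur (L : 'Hom(mor P Q, K^o)) := serre_surj bP (fun k g h => lfP L k g h).
have [|f fE] := @bidual_eval (mor P Q) T.
  move=> k L L'; have [G GL] := Sur L; have [G' GL'] := Sur L'.
  rewrite (TE G L) // (TE G' L') // (TE (k *: G + G')) ?serreP //.
  by move=> g; rewrite serre_linl GL GL' add_lfunE scale_lfunE.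
exists f; apply/eqP; rewrite -subr_eq0; apply/eqP/(serre_inj (bP := bQ)) => G.
have:= serre_linl bQ (-1) phi (nak_map f) G; rewrite scaleN1r addrC => ->.
rewrite -(TE G (linfun (fun g : mor P Q => serre bP G g : K^o))); last first.
  by move=> g; rewrite linfun_linE.
rewrite fE linfun_linE // -[nak_map f]mcomp1r (serre_natr bP).
by rewrite -serre_natl mcomp1l mulN1r addNr.
Qed.

(** Take [P] free of rank the dimension of [N]. The coordinates of [N] modulo
    the image of [f], applied to the images of the generators of [P], form a
    functional on Hom(P, N), and [g] corresponds to it under Serre duality. *)
Lemma nak_kernel M N (f : mor M N) :
  exists (P : lmod A) (g : mor N (nak P)),
    projective P /\ (forall y, (g y == 0) = (y \in limg f)).
Proof.
pose r := \dim {:N}; pose P := freem r.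
pose lam (k : 'I_r) (y : N) : K :=
  coord (vbasis fullv) k (y - projv (limg f) y).
have lamP k c y z : lam k (c *: y + z) = c * lam k y + lam k z.
  rewrite /lam -linearP /=; congr coord.
  by rewrite scalerBr lfP opprD addrACA.
have lam0 y : (forall k, lam k y = 0) -> y \in limg f.
  move=> l0; suff /eqP : y - projv (limg f) y = 0.
    by rewrite subr_eq0 => /eqP->; apply: memv_proj.
  by rewrite [LHS](coord_vbasis (memvf _)) big1 // => k _;
     rewrite [coord _ _ _]l0 scale0r.
have lamf k y : y \in limg f -> lam k y = 0.
  by move=> yf; rewrite /lam projv_id // subrr linear0.
have [|g gE] := serre_surj (free_dual_basis r)
    (L := fun h : mor P N => \sum_k lam k (h (free_gen k))) _.
  move=> c h h'; rewrite mulr_sumr -big_split; apply: eq_bigr => k _.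
  by rewrite morD morZ lamP.
exists P, g; split; first exact/dual_basis_projective/free_dual_basis.
have nevg y a : nev (g y) a = \sum_k lam k (lact N (a (free_gen k) : A) y).
  by rewrite -(serre_tens (free_dual_basis r)) gE; apply: eq_bigr => k _;
     rewrite tensE.
move=> y; apply/eqP/idP => [gy|yf].
  apply: lam0 => j; have:= nevg y (free_coord j); rewrite gy nev0.
  rewrite (bigD1 j) //= big1 => [|k kj].
    by rewrite free_coordE ffunE eqxx lact1 id_lfunE addr0.
  rewrite free_coordE ffunE eq_sym (negPf kj) lf0 zero_lfunE.
  by apply: lamf; apply: mem0v.
apply: nev_ext => a; rewrite nevg nev0 big1 // => k _; apply: lamf.
by have /mor_imgP[x ->] := yf; rewrite -morE; apply/mor_imgP; eexists.
Qed.

End Duality.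

(** * Duality for exactness of a finite total complex *)

Section GradedDuality.
Variable K : fieldType.

Lemma product_exists (I : eqType) (s : seq I) (W : I -> vectType K) :
  uniq s ->
  exists (V : vectType K) (inj : forall i, 'Hom(W i, V))
         (pr : forall i, 'Hom(V, W i)),
  [/\ forall i x, i \in s -> pr i (inj i x) = x,
      forall i j x, i != j -> pr j (inj i x) = 0
    & forall v, v = \sum_(i <- s) inj i (pr i v)].
Proof.
elim: s => [_|i0 s IHs /andP[i0s /IHs[V [inj [pr [prinj prinj0 vE]]]]]].
  exists 'rV[K]_0, (fun=> 0), (fun=> 0); split=> // [i j x _|v].
    by rewrite zero_lfunE.
  by rewrite big_nil; apply/rowP; case.
pose V' : vectType K := (W i0 * V)%type.
pose i1 : 'Hom(W i0, V') := linfun (fun x : W i0 => (x, 0) : V').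
pose i2 : 'Hom(V, V') := linfun (fun x : V => (0, x) : V').
pose p1 : 'Hom(V', W i0) := linfun (fun x : V' => x.1).
pose p2 : 'Hom(V', V) := linfun (fun x : V' => x.2).
have i1E x : i1 x = (x, 0).
  by rewrite linfun_linE // => k u v; congr pair; rewrite /= scaler0 addr0.
have i2E x : i2 x = (0, x).
  by rewrite linfun_linE // => k u v; congr pair; rewrite /= scaler0 addr0.
have p1E x : p1 x = x.1 by rewrite linfun_linE.
have p2E x : p2 x = x.2 by rewrite linfun_linE.
pose inj' i : 'Hom(W i, V') :=
  if i0 =P i is ReflectT e then ecast z 'Hom(W z, V') e i1 else (i2 \o inj i)%VF.
pose pr' i : 'Hom(V', W i) :=
  if i0 =P i is ReflectT e then ecast z 'Hom(V', W z) e p1 else (pr i \o p2)%VF.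
have inj'0 : inj' i0 = i1.
  by rewrite /inj'; case: eqP => // e; rewrite (eq_irrelevance e erefl).
have pr'0 : pr' i0 = p1.
  by rewrite /pr'; case: eqP => // e; rewrite (eq_irrelevance e erefl).
have inj'N i : i0 != i -> inj' i = (i2 \o inj i)%VF.
  by rewrite /inj'; case: eqP.
have pr'N i : i0 != i -> pr' i = (pr i \o p2)%VF by rewrite /pr'; case: eqP.
exists V', inj', pr'; split=> [i x|i j x|v].
- rewrite inE; have [e|/negPf i0i /= is_] := eqVneq i i0.
    by subst i; rewrite inj'0 pr'0 p1E i1E.
  by rewrite inj'N ?pr'N 1?eq_sym ?i0i // !comp_lfunE p2E i2E prinj.
- have [e ij|i0i ij] := eqVneq i0 i.
    by subst i; rewrite inj'0 pr'N // comp_lfunE p2E i1E lf0.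
  have [e|i0j] := eqVneq i0 j.
    by subst j; rewrite pr'0 inj'N // p1E comp_lfunE i2E.
  by rewrite inj'N ?pr'N // !comp_lfunE p2E i2E prinj0.
rewrite big_cons inj'0 pr'0 i1E p1E.
rewrite (_ : \sum_(i <- s) _ = (0, v.2)); last first.
  rewrite [in RHS](vE v.2) -i2E lf_sum !big_seq; apply: eq_bigr => i is_.
  have i0i : i0 != i by apply: contraNneq i0s => ->.
  by rewrite inj'N // pr'N // !comp_lfunE p2E.
by case: v => v1 v2; congr pair; rewrite /= ?addr0 ?add0r.
Qed.

Section Exactness.
Variables (s : seq int) (X Y Z : int -> vectType K).
Hypothesis s_uniq : uniq s.
Hypotheses (X0 : forall l, l \notin s -> forall x : X l, x = 0)
           (Y0 : forall l, l \notin s -> forall y : Y l, y = 0)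
           (Z0 : forall l, l \notin s -> forall z : Z l, z = 0).
Variables (a0 : forall l, 'Hom(X l, Y l)) (a1 : forall l l', 'Hom(X l, Y l')).
Variables (b0 : forall l, 'Hom(Y l, Z l)) (b1 : forall l l', 'Hom(Y l, Z l')).

(** Exactness in the middle of the products of the [X l], the [Y l] and the [Z l],
    where each map has a component that preserves the index and one that lowers
    it by one. *)
Definition total_exact :=
  forall y : forall l, Y l,
    (forall l l', l' = l + 1 -> b0 l (y l) + b1 l' l (y l') = 0) ->
  exists x : forall l, X l,
    forall l l', l' = l + 1 -> y l = a0 l (x l) + a1 l' l (x l').

Definition total_dual_exact :=
  forall lam : forall l, 'Hom(Y l, K^o),
    (forall l l', l' = l + 1 ->
       forall x, lam l' (a0 l' x) + lam l (a1 l' l x) = 0) ->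
  exists mu : forall l, 'Hom(Z l, K^o),
    forall l l', l' = l + 1 ->
      forall y, lam l' y = mu l' (b0 l' y) + mu l (b1 l' l y).

Section Total.
Variables (P R : int -> vectType K).
Hypotheses (P0 : forall l, l \notin s -> forall x : P l, x = 0)
           (R0 : forall l, l \notin s -> forall x : R l, x = 0).
Variables (c0 : forall l, 'Hom(P l, R l)) (c1 : forall l l', 'Hom(P l, R l')).
Variables (U V : vectType K).
Variables (iU : forall l, 'Hom(P l, U)) (pU : forall l, 'Hom(U, P l)).
Variables (iV : forall l, 'Hom(R l, V)) (pV : forall l, 'Hom(V, R l)).
Hypotheses (UK : forall l x, l \in s -> pU l (iU l x) = x)
           (UN : forall l l' x, l != l' -> pU l' (iU l x) = 0)
           (UE : forall v, v = \sum_(l <- s) iU l (pU l v)).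
Hypotheses (VK : forall l x, l \in s -> pV l (iV l x) = x)
           (VN : forall l l' x, l != l' -> pV l' (iV l x) = 0)
           (VE : forall v, v = \sum_(l <- s) iV l (pV l v)).

Lemma product_pr (F : forall l, R l) l : pV l (\sum_(i <- s) iV i (F i)) = F l.
Proof.
have [ls|ls] := boolP (l \in s); last by rewrite (R0 ls (F l)) (R0 ls (pV l _)).
rewrite lf_sum (bigD1_seq l) //= VK // big1 ?addr0 // => i il.
by rewrite VN.
Qed.

Lemma product_ext v w : (forall l, pV l v = pV l w) -> v = w.
Proof. by move=> vw; rewrite (VE v) (VE w); apply: eq_bigr => i _; rewrite vw. Qed.

Definition total_map : 'Hom(U, V) :=
  \sum_(l <- s) (iV l \o ((c0 l \o pU l) + (c1 (l + 1) l \o pU (l + 1))))%VF.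

Lemma total_mapE v l l' : l' = l + 1 ->
  pV l (total_map v) = c0 l (pU l v) + c1 l' l (pU l' v).
Proof.
move=> ->; rewrite /total_map sum_lfunE.
under eq_bigr do rewrite comp_lfunE add_lfunE !comp_lfunE.
exact: (product_pr (fun l => c0 l (pU l v) + c1 (l + 1) l (pU (l + 1) v))).
Qed.

Lemma total_map_inj l l' (x : P l') : l' = l + 1 ->
  total_map (iU l' x) = iV l' (c0 l' x) + iV l (c1 l' l x).
Proof.
move=> l'E; apply: product_ext => i; rewrite (total_mapE _ (erefl (i + 1))) lfD.
have UK' j y : pU j (iU j y) = y.
  by have [js|js] := boolP (j \in s); [exact: UK | rewrite (P0 js y) (P0 js (pU j _))].
have VK' j y : pV j (iV j y) = y.
  by have [js|js] := boolP (j \in s); [exact: VK | rewrite (R0 js y) (R0 js (pV j _))].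
have [il'|il'] := eqVneq l' i.
  subst i; rewrite UK' VK' UN ?lf0 ?VN //; lia.
have [il|il] := eqVneq l i.
  by subst i l'; rewrite UN // lf0 UK' VK' VN.
by rewrite !UN ?VN ?lf0 //; lia.
Qed.

End Total.

(** Passing to the product over all indices turns the two statements into
    exactness of a sequence of three finite dimensional spaces and of its dual
    sequence. *)
Lemma total_exact_dual : total_exact <-> total_dual_exact.
Proof.
have [VX [iX [pX [XK XN XE]]]] := product_exists X s_uniq.
have [VY [iY [pY [YK YN YE]]]] := product_exists Y s_uniq.
have [VZ [iZ [pZ [ZK ZN ZE]]]] := product_exists Z s_uniq.
pose a := total_map a0 a1 pX iY; pose b := total_map b0 b1 pY iZ.
have aE := total_mapE Y0 a0 a1 pX YK YN.
have bE := total_mapE Z0 b0 b1 pY ZK ZN.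
have aI := total_map_inj X0 Y0 a0 a1 XK XN YK YN YE.
have bI := total_map_inj Y0 Z0 b0 b1 YK YN ZK ZN ZE.
have iY0 l (y : Y l) : l \notin s -> iY l y = 0.
  by move=> ls; rewrite (Y0 ls y) lf0.
have YK' l y : pY l (iY l y) = y.
  by have [ls|ls] := boolP (l \in s); [exact: YK | rewrite (Y0 ls y) (Y0 ls (pY l _))].
split=> [ex lam lam0|dex y yb].
  pose L : 'Hom(VY, K^o) := \sum_(l <- s) (lam l \o pY l)%VF.
  have LE l y : L (iY l y) = lam l y.
    rewrite /L sum_lfunE; have [ls|ls] := boolP (l \in s).
      rewrite (bigD1_seq l) //= comp_lfunE YK // big1 ?addr0 // => i il.
      by rewrite comp_lfunE YN 1?eq_sym // lf0.
    by rewrite (Y0 ls y) !lf0 big1 // => i _; rewrite lf0.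
  have La v : L (a v) = 0.
    rewrite (XE v) !lf_sum big1 // => l _.
    rewrite /a (aI (l - 1)) ?lfD ?LE; last by lia.
    by apply: lam0; lia.
  have [|M ME] := @functional_extend _ _ _ b L.
    move=> v bv; pose yv l := pY l v.
    have [|x xE] := ex yv.
      by move=> l l' ll'; rewrite -(bE _ _ _ ll') [total_map _ _ _ _ v]bv lf0.
    suff -> : v = a (\sum_(l <- s) iX l (x l)) by exact: La.
    apply: (product_ext YE) => l; rewrite (aE _ _ _ (erefl (l + 1))).
    by rewrite !(product_pr X0 XK XN) -xE.
  exists (fun l => (M \o iZ l)%VF) => l l' ll' y.
  by rewrite !comp_lfunE -LE -ME /b (bI l) // lfD.
pose v := \sum_(l <- s) iY l (y l).
have pv l : pY l v = y l by exact: (product_pr Y0 YK YN).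
have bv : b v = 0.
  apply: (product_ext ZE) => l; rewrite (bE _ _ _ (erefl (l + 1))) !pv lf0.
  exact: yb.
have [/memv_imgP[w _ vE]|va] := boolP (v \in limg a).
  exists (fun l => pX l w) => l l' ll'.
  by rewrite -pv vE (aE _ _ _ ll').
have [L [/eqP Lv La]] := functional_sep va; case: Lv.
have [|mu muE] := dex (fun l => (L \o iY l)%VF).
  move=> l l' ll' x; rewrite !comp_lfunE -lfD -(aI l) //.
  by apply: La; rewrite memv_img ?memvf.
pose M : 'Hom(VZ, K^o) := \sum_(l <- s) (mu l \o pZ l)%VF.
have ME l z : M (iZ l z) = mu l z.
  rewrite /M sum_lfunE; have [ls|ls] := boolP (l \in s).
    rewrite (bigD1_seq l) //= comp_lfunE ZK // big1 ?addr0 // => i il.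
    by rewrite comp_lfunE ZN 1?eq_sym // lf0.
  by rewrite (Z0 ls z) !lf0 big1 // => i _; rewrite lf0.
have LM u : L u = M (b u).
  rewrite (YE u) !lf_sum; apply: eq_bigr => l _.
  have l1 : l = l - 1 + 1 by lia.
  have := muE _ _ l1 (pY l u); rewrite comp_lfunE => ->.
  by rewrite /b (bI _ _ _ l1) lfD !ME.
by rewrite LM bv lf0.
Qed.

End Exactness.
End GradedDuality.

(** * Maps between complexes up to homotopy *)

Section Families.
Variables (K : fieldType) (A : falgType K).
Notation cplx := (cplx A).
Implicit Types C D E P Q : cplx.

(** A map of degree [m] is a family over all pairs of degrees of which only the
    entries at [(i, i + m)] count. Keeping all pairs avoids transport along
    equations between degrees. *)
Definition fam C D := forall i j : int, mor (C i) (D j).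

(** The scalar [c] absorbs the signs that come from shifts and dualities. *)
Definition cyc C D (c : K) (m : int) (f : fam C D) :=
  forall i i' j j' : int, i' = i + 1 -> j = i + m -> j' = j + 1 ->
  mcomp (cd D j j') (f i j) = c *: mcomp (f i' j') (cd C i i').

Definition nulby C D (c : K) (m : int) (f h : fam C D) :=
  forall i i' j' j : int, i' = i + 1 -> j = i + m -> j = j' + 1 ->
  f i j = mcomp (cd D j' j) (h i j') + c *: mcomp (h i' j) (cd C i i').

Definition hom0 (c : K) C D (m : int) :=
  forall f : fam C D, cyc c m f -> exists h, nulby c m f h.

(** The identity transported along [i = j], and zero if the degrees differ; it
    compares terms whose degrees agree only up to arithmetic. *)
Definition idf C (i j : int) : mor (C i) (C j) :=
  if i =P j is ReflectT e then ecast z (mor (C i) (C z)) e (mid (C i)) else 0.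

Lemma idf_id C i : idf C i i = mid (C i).
Proof. by rewrite /idf; case: eqP => // e; rewrite (eq_irrelevance e erefl). Qed.

Lemma idf_r C D (f : fam C D) i i' j : i = i' -> mcomp (f i' j) (idf C i i') = f i j.
Proof. by move=> <-; rewrite idf_id mcomp1r. Qed.

Lemma idf_l C D (f : fam C D) i j j' : j = j' -> mcomp (idf D j j') (f i j) = f i j'.
Proof. by move=> <-; rewrite idf_id mcomp1l. Qed.

Lemma idf_comp C i j k : i = j -> mcomp (idf C j k) (idf C i j) = idf C i k.
Proof. exact: idf_r. Qed.

Lemma cd_idf C i i' j : i = i' -> mcomp (cd C i' j) (idf C i i') = cd C i j.
Proof. exact: (@idf_r C C (cd C)). Qed.

Lemma idf_cd C i j j' : j = j' -> mcomp (idf C j j') (cd C i j) = cd C i j'.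
Proof. exact: (@idf_l C C (cd C)). Qed.

(** Multiplication by [u ^ i] in degree [i] divides the scalar of a map by
    [u]. *)
Lemma hom0_twist (c c' : K) C D m : c != 0 -> c' != 0 ->
  hom0 c C D m -> hom0 c' C D m.
Proof.
move=> c0 c'0 H f fc; pose u := c' / c.
have u0 : u != 0 by rewrite mulf_neq0 ?invr_neq0.
have [|h hE] := H (fun i j => u ^ i *: f i j).
  move=> i i' j j' -> ji jj'; rewrite mcompZr mcompZl (fc _ (i + 1) _ j') // !scalerA.
  congr (_ *: _); rewrite expfzDr // expr1z mulrCA; congr (_ * _).
  by rewrite /u mulrC divfK.
exists (fun i j => u ^ (- i) *: h i j) => i i' j' j ii' ji jj'.
apply: (scalerI (expfz_neq0 i u0)).
rewrite (hE _ _ _ _ ii' ji jj') scalerDr mcompZr mcompZl !scalerA.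
rewrite -expfzDr // subrr expr0z scale1r; congr (_ + _ *: _).
have e : u ^ i * u ^ (- i') = u^-1.
  by rewrite -expfzDr // -exprN1 ii'; congr (u ^ _); lia.
by rewrite -?mulrA mulrCA e /u invf_div mulrC divfK.
Qed.

Definition proj_bounded Q :=
  (forall i, projective (Q i)) /\ bounded Q.

(** Serre duality for complexes: the complex of maps [C -> nak Q] is the dual of
    the complex of maps [Q -> C]. The relation between the scalars is the sign
    that a transposed differential acquires. *)
Lemma serre_hom0_scalars (c c' : K) C Q m : c * c' = -1 -> proj_bounded Q ->
  hom0 c' Q C (- m) <-> hom0 c C (nakC Q) m.
Proof.
move=> cc' [prQ [N QN]].
have cN : - c' * c = 1 by rewrite mulNr mulrC cc' opprK.
have bQ i := projective_dual_basis (prQ i).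
(* Outside of these degrees [Q] vanishes. *)
pose s : seq int := [seq k%:Z - N%:Z | k <- iota 0 (N + N).+1].
have s_uniq : uniq s.
  by rewrite map_inj_uniq ?iota_uniq // => x y; lia.
have Q0 l : l \notin s -> is_zero (Q l).
  move=> ls; apply: QN; rewrite ltnNge; apply: contra ls => lN.
  apply/mapP; exists (absz (l + N%:Z)); last by lia.
  by rewrite mem_iota; lia.
pose X l : vectType K := mor (Q l) (C (l - m - 1)).
pose Y l : vectType K := mor (Q l) (C (l - m)).
pose Z l : vectType K := mor (Q l) (C (l - m + 1)).
have X0 l : l \notin s -> forall x : X l, x = 0.
  by move=> /Q0 ls x; apply: mor_zero_src.
have Y0 l : l \notin s -> forall x : Y l, x = 0.
  by move=> /Q0 ls x; apply: mor_zero_src.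
have Z0 l : l \notin s -> forall x : Z l, x = 0.
  by move=> /Q0 ls x; apply: mor_zero_src.
pose a0 l : 'Hom(X l, Y l) := linfun (fun x : mor (Q l) (C (l - m - 1)) =>
  mcomp (cd C (l - m - 1) (l - m)) x : Y l).
pose a1 l l' : 'Hom(X l, Y l') := linfun (fun x : mor (Q l) (C (l - m - 1)) =>
  c' *: mcomp (idf C (l - m - 1) (l' - m)) (mcomp x (cd Q l' l)) : Y l').
pose b0 l : 'Hom(Y l, Z l) := linfun (fun x : mor (Q l) (C (l - m)) =>
  mcomp (cd C (l - m) (l - m + 1)) x : Z l).
pose b1 l l' : 'Hom(Y l, Z l') := linfun (fun x : mor (Q l) (C (l - m)) =>
  - c' *: mcomp (idf C (l - m) (l' - m + 1)) (mcomp x (cd Q l' l)) : Z l').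
have a0E l (x : mor (Q l) (C (l - m - 1))) :
    a0 l x = mcomp (cd C (l - m - 1) (l - m)) x.
  by rewrite /a0 linfun_linE // => k u v; rewrite mcompDr mcompZr.
have a1E l l' (x : mor (Q l) (C (l - m - 1))) :
    a1 l l' x = c' *: mcomp (idf C (l - m - 1) (l' - m)) (mcomp x (cd Q l' l)).
  rewrite /a1 linfun_linE // => k u v.
  by rewrite mcompDl mcompZl mcompDr mcompZr scalerDr !scalerA mulrC.
have b0E l (x : mor (Q l) (C (l - m))) :
    b0 l x = mcomp (cd C (l - m) (l - m + 1)) x.
  by rewrite /b0 linfun_linE // => k u v; rewrite mcompDr mcompZr.
have b1E l l' (x : mor (Q l) (C (l - m))) :
    b1 l l' x = - c' *: mcomp (idf C (l - m) (l' - m + 1)) (mcomp x (cd Q l' l)).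
  rewrite /b1 linfun_linE // => k u v.
  by rewrite mcompDl mcompZl mcompDr mcompZr scalerDr !scalerA mulrC.
(* The left hand side is exactness of the total complex of the spaces of maps
   from [Q l] to [C (l - m)]; below, [serre] identifies the dual statement with
   the right hand side. *)
have TE : hom0 c' Q C (- m) <-> total_exact a0 a1 b0 b1.
  split=> [H y yb|H f fc].
    have [|h hE] := H (fun l j => mcomp (idf C (l - m) j) (y l)).
      move=> i i' j j' ii' -> ->; have:= yb _ _ ii'.
      rewrite b0E b1E scaleNr => /eqP; rewrite subr_eq0 => /eqP.
      by rewrite idf_id mcomp1l mcompA.
    exists (fun l => h l (l - m - 1)) => l l' ll'.
    have := hE l l' (l - m - 1) (l - m) ll' erefl ltac:(lia).
    rewrite idf_id mcomp1l a0E a1E => ->; congr (_ + _ *: _).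
    by rewrite mcompA idf_l //; lia.
  have [|x xE] := H (fun l => f l (l - m)).
    move=> l l' ll'; rewrite b0E b1E mcompA idf_l; last by lia.
    rewrite (fc l l' (l - m) (l - m + 1)) //.
    by rewrite scaleNr subrr.
  exists (fun l j => mcomp (idf C (l - m - 1) j) (x l)) => i i' j' j ii' -> jj'.
  rewrite (xE _ _ ii') a0E a1E !mcompA; congr (_ + _).
  have -> : j' = i - m - 1 by lia.
  by rewrite idf_id mcomp1r.
have serre0 l M (f : mor M (nak (Q l))) k g : serre (bQ l) f (k *: g) = k * serre (bQ l) f g.
  have := serreP (bQ l) f k g 0; rewrite !addr0 => ->.
  have := serreP (bQ l) f (-1) 0 0; rewrite scaler0 addr0 mulN1r addNr => ->.
  by rewrite addr0.
have serreZ l M (f : mor M (nak (Q l))) k g : serre (bQ l) (k *: f) g = k * serre (bQ l) f g.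
  have := serre_linl (bQ l) k f 0 g; rewrite !addr0 => ->.
  have := serre_linl (bQ l) (-1) (0 : mor M (nak (Q l))) 0 g.
  by rewrite scaler0 addr0 mulN1r addNr => ->; rewrite addr0.
have serreD l M (f f' : mor M (nak (Q l))) g :
    serre (bQ l) (f + f') g = serre (bQ l) f g + serre (bQ l) f' g.
  by have := serre_linl (bQ l) 1 f f' g; rewrite scale1r mul1r.
have serreB l M (f f' : mor M (nak (Q l))) g :
    serre (bQ l) (f - f') g = serre (bQ l) f g - serre (bQ l) f' g.
  by rewrite serreD -scaleN1r serreZ mulN1r.
rewrite TE (total_exact_dual s_uniq X0 Y0 Z0); split=> [H f fc|H lam lam0].
  have Sl l : linear (fun g : mor (Q l) (C (l - m)) =>
      serre (bQ l) (f (l - m) l : mor _ (nak (Q l))) g : K^o).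
    by move=> k u v; rewrite serreP.
  pose lam l : 'Hom(Y l, K^o) := linfun (fun g : mor (Q l) (C (l - m)) =>
    serre (bQ l) (f (l - m) l : mor _ (nak (Q l))) g : K^o).
  have lamE l (g : mor (Q l) (C (l - m))) :
      lam l g = serre (bQ l) (f (l - m) l : mor _ (nak (Q l))) g.
    exact: (linfun_linE (Sl l)). 
  have [|mu muE] := H lam.
    move=> l l' ll' x; rewrite a0E a1E !lamE serre0 -serre_natl -serre_natl.
    have := fc (l' - m - 1) (l' - m) l l' ltac:(lia) ltac:(lia) ll'.
    rewrite (idf_r f); last by lia.
    rewrite -(serre_natr (bQ l) (bQ l') (cd Q l l')).
    rewrite -[nak_map _]/(cd (nakC Q) l l') => ->.
    by rewrite serreZ mulrA [c' * c]mulrC cc' mulN1r subrr.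
  have Hd l : exists F : mor (C (l - m + 1)) (nak (Q l)),
      forall g, serre (bQ l) F g = mu l g.
    by apply: serre_surj => k g h; apply: (lfP (mu l)).
  pose F l := sval (constructive_indefinite_description _ (Hd l)).
  have FE l g : serre (bQ l) (F l) g = mu l g.
    exact: (svalP (constructive_indefinite_description _ (Hd l))).
  exists (fun i j => - c' *: mcomp (F j) (idf C i (j - m + 1))).
  move=> i i' j' j ii' ji jj'; have {ji} iE : i = j - m by lia.
  subst i.
  apply/eqP; rewrite -subr_eq0; apply/eqP/(serre_inj (bP := bQ j)) => g.
  have -> : serre (bQ j) (f (j - m) j - (mcomp (cd (nakC Q) j' j)
       (- c' *: mcomp (F j') (idf C (j - m) (j' - m + 1))) +
     c *: mcomp (- c' *: mcomp (F j) (idf C i' (j - m + 1))) (cd C (j - m) i')))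
     g = lam j g - (- c' * serre (bQ j) (mcomp (cd (nakC Q) j' j)
       (mcomp (F j') (idf C (j - m) (j' - m + 1)))) g +
       serre (bQ j) (mcomp (F j) (cd C (j - m) (j - m + 1))) g).
    rewrite serreB lamE serreD mcompZr !serreZ mcompZl serreZ.
    rewrite [c * _]mulrA [c * - c']mulrC cN mul1r -mcompA idf_cd //; lia.
  rewrite (muE j' j jj') b0E b1E -!FE serre0.
  rewrite [serre (bQ j) (mcomp (F j) _) g]serre_natl.
  rewrite [X in _ - (_ * X + _)](serre_natr (bQ j') (bQ j) (cd Q j' j)).
  rewrite [X in _ - (_ * X + _)]serre_natl.
  by rewrite [X in _ - X]addrC subrr.
have Hd l : exists F : mor (C (l - m)) (nak (Q l)),
    forall g, serre (bQ l) F g = lam l g.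
  by apply: serre_surj => k g h; apply: (lfP (lam l)).
pose F l := sval (constructive_indefinite_description _ (Hd l)).
have FE l g : serre (bQ l) (F l) g = lam l g.
  exact: (svalP (constructive_indefinite_description _ (Hd l))).
have [|h hE] := H (fun i j => mcomp (F j) (idf C i (j - m))).
  move=> i i' j j' ii' ji jj'; have iE : i = j - m by lia.
  subst i; rewrite idf_id mcomp1r; apply/eqP; rewrite -subr_eq0.
  apply/eqP/(serre_inj (bP := bQ j')) => g.
  rewrite serreB serreZ (serre_natr (bQ j) (bQ j') (cd Q j j')).
  rewrite -mcompA idf_cd; last by lia.
  rewrite serre_natl !FE.
  have := lam0 j j' jj' (mcomp (idf C (j - m) (j' - m - 1)) g).
  rewrite a0E a1E lfZ.
  rewrite mcompA cd_idf; last by lia.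
  rewrite -[mcomp (mcomp _ g) _]mcompA [mcomp (idf _ _ _) (mcomp (idf _ _ _) _)]mcompA.
  rewrite idf_comp; last by lia.
  rewrite idf_id mcomp1l => e.
  have {e} : lam j' (mcomp (cd C (j - m) (j' - m)) g) +
    c' * lam j (mcomp g (cd Q j j')) = 0 :> K := e.
  move/eqP; rewrite addr_eq0 => /eqP->.
  by rewrite mulrN mulrA cc' mulN1r opprK subrr.
have hE' j j' g : j' = j + 1 ->
  lam j' g = serre (bQ j') (mcomp (cd (nakC Q) j j') (h (j' - m) j)) g
    + c * serre (bQ j') (h (j' - m + 1) j') (mcomp (cd C (j' - m) (j' - m + 1)) g).
  move=> jj'; have := hE (j' - m) (j' - m + 1) j j' erefl ltac:(lia) jj'.
  rewrite idf_id mcomp1r -FE => ->.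
  by rewrite serreD serreZ [X in _ + _ * X]serre_natl.
have Ml l : linear (fun z : mor (Q l) (C (l - m + 1)) =>
    c * serre (bQ l) (h (l - m + 1) l : mor _ (nak (Q l))) z : K^o).
  by move=> k u v; rewrite serreP mulrDr mulrCA.
exists (fun l => linfun (fun z : mor (Q l) (C (l - m + 1)) =>
    c * serre (bQ l) (h (l - m + 1) l : mor _ (nak (Q l))) z : K^o)).
move=> l l' ll' y.
rewrite (hE' _ _ _ ll') addrC b0E b1E.
congr (_ + _); first exact: (esym (linfun_linE (Ml l') _)).
rewrite lfZ (linfun_linE (Ml l)) [RHS]mulrA cN mul1r mcompA.
rewrite -(serre_natr (bQ l) (bQ l') (cd Q l l')) -serre_natl -mcompA (idf_r h) //; lia.
Qed.

Lemma serre_hom0 C Q m : proj_bounded Q ->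
  hom0 1 Q C (- m) <-> hom0 1 C (nakC Q) m.
Proof.
move=> bQ; rewrite -(@serre_hom0_scalars 1 (-1)) ?mul1r //.
by split; apply: hom0_twist; rewrite ?oppr_eq0 oner_eq0.
Qed.

End Families.

(** * Lifting along quasi-isomorphisms *)

Section Lifting.
Variables (K : fieldType) (A : falgType K).
Notation cplx := (cplx A).
Implicit Types C D E P Q : cplx.

Definition proj_above P :=
  (forall i, projective (P i)) /\
  exists N : int, forall i, N < i -> is_zero (P i).

Lemma proj_bounded_above Q : proj_bounded Q -> proj_above Q.
Proof.
by move=> [prQ [N QN]]; split=> //; exists N%:Z => i iN; exact: (QN i ltac:(lia)).
Qed.

Lemma cocP C i j x : j = i + 1 -> (x \in cocycles C i) = (cd C i j x == 0).
Proof. by move=> ->; rewrite memv_ker. Qed.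

Lemma cobP C i j x : i = j + 1 ->
  reflect (exists y, x = cd C j i y) (x \in coboundaries C i).
Proof.
move=> ij; have -> : j = i - 1 by lia.
exact: mor_imgP.
Qed.

Lemma cd_cd0 C i j k x : cd C j k (cd C i j x) = 0.
Proof. by rewrite -mcompE cd_cd mor0. Qed.

Definition lift_along (M N P : lmod A) (p : mor M N) (f : mor P N) : mor P M :=
  epsilon (inhabits 0) (fun g => mcomp p g = f).

Lemma lift_alongK (M N P : lmod A) (p : mor M N) (f : mor P N) :
  projective P -> (forall x, f x \in limg p) -> mcomp p (lift_along p f) = f.
Proof.
move=> prP fp.
exact: (epsilon_spec (inhabits 0) _ (projective_lift prP fp)).
Qed.

(** The null homotopy is built downwards from the top degree of [P]: each step
    lifts the remaining error through a differential of [E]. *)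
Lemma acyclic_hom0 (c : K) P E m :
  proj_above P -> (forall i, acyclic_at E i) -> hom0 c P E m.
Proof.
move=> [prP [N PN]] acE f fc.
pose fix H (k : nat) : fam P E := if k is k'.+1 then fun i j =>
    if i == N - k'%:Z then
      lift_along (cd E j (j + 1))
        (f i (j + 1) - c *: mcomp (H k' (i + 1) (j + 1)) (cd P i (i + 1)))
    else H k' i j
  else fun i j => 0.
have HS k i j : N - k%:Z < i -> H k.+1 i j = H k i j.
  by move=> ik /=; case: eqP => //; lia.
have HK k : forall i i' j' j, N - k%:Z < i -> i' = i + 1 -> j = i + m ->
    j = j' + 1 ->
    f i j = mcomp (cd E j' j) (H k i j') + c *: mcomp (H k i' j) (cd P i i').
  elim: k => [|k IHk] i i' j' j ik ii' ji jj'.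
    have Pi : is_zero (P i) := PN i ltac:(lia).
    by rewrite (mor_zero_src (f i j) Pi) (mor_zero_src (cd P i i') Pi)
      (mor_zero_src (H 0%N i j') Pi) !mcomp0r scaler0 addr0.
  rewrite (HS k i'); last by lia.
  have [ik'|ik'] := ltrP (N - k%:Z) i; first by rewrite HS //; apply: IHk.
  have iE : i = N - k%:Z by lia.
  rewrite /= iE eqxx -iE -ii' -jj'.
  rewrite lift_alongK ?subrK // => x.
  apply/mor_imgP/(cobP _ jj').
  have /subvP := acE j; apply; rewrite (cocP _ (erefl (j + 1))).
  rewrite -mcompE mcompBr (fc i i' j (j + 1)) // mcompZr mcompA.
  rewrite (IHk i' (i' + 1) j) //; try lia.
  rewrite mcompDl mcompZl -(mcompA (H k _ _)) cd_cd mcomp0r scaler0 addr0.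
  by rewrite subrr mor0.
exists (fun i j => H (absz (N - i)).+1 i j) => i i' j' j ii' ji jj'.
have [iN|iN] := ltrP N i.
  have Pi : is_zero (P i) by exact: PN.
  by rewrite (mor_zero_src (f i j) Pi) (mor_zero_src (cd P i i') Pi)
    (mor_zero_src (H _ i j') Pi) !mcomp0r scaler0 addr0.
rewrite (HK (absz (N - i)).+1 i i' j' j) //; last by lia.
congr (_ + _ *: mcomp _ _).
have [iN'|iN'] := ltrP N i'.
  by rewrite !(mor_zero_src (H _ i' j)) //; apply: PN.
have -> : absz (N - i) = (absz (N - i')).+1 by lia.
by rewrite HS //; lia.
Qed.

Section DirectSumMaps.
Implicit Types M N L : lmod A.

Definition dpair L M N (f : mor L M) (g : mor L N) : mor L (dsum M N).
Proof.
refine (@mk_mor _ _ L (dsum M N) (fun x => (f x, g x) : (M * N)%type) _ _).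
- by move=> k u v; rewrite !lfP.
- by move=> a x; rewrite dsum_actE !morE.
Defined.

Definition dfst M N : mor (dsum M N) M.
Proof.
refine (@mk_mor _ _ (dsum M N) M (fun x : (M * N)%type => x.1) _ _).
- by [].
- by move=> a x; rewrite dsum_actE.
Defined.

Definition dsnd M N : mor (dsum M N) N.
Proof.
refine (@mk_mor _ _ (dsum M N) N (fun x : (M * N)%type => x.2) _ _).
- by [].
- by move=> a x; rewrite dsum_actE.
Defined.

Lemma dfstK L M N (f : mor L M) (g : mor L N) : mcomp (dfst M N) (dpair f g) = f.
Proof. by apply: mor_ext => x; rewrite mcompE !mk_morE. Qed.

Lemma dsndK L M N (f : mor L M) (g : mor L N) : mcomp (dsnd M N) (dpair f g) = g.
Proof. by apply: mor_ext => x; rewrite mcompE !mk_morE. Qed.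

Lemma dsum_ext L M N (f g : mor L (dsum M N)) :
  mcomp (dfst M N) f = mcomp (dfst M N) g ->
  mcomp (dsnd M N) f = mcomp (dsnd M N) g -> f = g.
Proof.
move=> f1 f2; apply: mor_ext => x.
have := congr1 (fun h : mor L M => h x) f1.
have := congr1 (fun h : mor L N => h x) f2.
rewrite !mcompE !mk_morE.
by case: (f x) (g x) => [a b] [a' b'] /= -> ->.
Qed.

End DirectSumMaps.

(** The cone of a map [s] of degree [k]: shifting [D] by [k] makes [s] a chain
    map. *)
Section Cone.
Variables (C D : cplx) (k : int) (s : fam C D).
Hypothesis s_cyc : cyc 1 k s.

Definition cone_ob (i : int) : lmod A := dsum (C (i + 1)) (D (i + k)).

Definition cone_pair L i (f : mor L (C (i + 1))) (g : mor L (D (i + k))) :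
  mor L (cone_ob i) := dpair f g.
Definition cone_fst i : mor (cone_ob i) (C (i + 1)) := dfst _ _.
Definition cone_snd i : mor (cone_ob i) (D (i + k)) := dsnd _ _.

Lemma cone_fstK L i (f : mor L (C (i + 1))) (g : mor L (D (i + k))) :
  mcomp (cone_fst i) (cone_pair f g) = f.
Proof. exact: dfstK. Qed.

Lemma cone_sndK L i (f : mor L (C (i + 1))) (g : mor L (D (i + k))) :
  mcomp (cone_snd i) (cone_pair f g) = g.
Proof. exact: dsndK. Qed.

Lemma cone_ext L i (f g : mor L (cone_ob i)) :
  mcomp (cone_fst i) f = mcomp (cone_fst i) g ->
  mcomp (cone_snd i) f = mcomp (cone_snd i) g -> f = g.
Proof. exact: dsum_ext. Qed.

Lemma cone_el_ext i (z z' : cone_ob i) :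
  cone_fst i z = cone_fst i z' -> cone_snd i z = cone_snd i z' -> z = z'.
Proof.
rewrite /cone_fst /cone_snd !mk_morE.
by case: z z' => [a b] [a' b'] /= -> ->.
Qed.

Definition cone_d (i j : int) : mor (cone_ob i) (cone_ob j) :=
  if j == i + 1 then
    cone_pair (- mcomp (cd C (i + 1) (j + 1)) (cone_fst i))
      (mcomp (s (i + 1) (j + k)) (cone_fst i) +
       mcomp (cd D (i + k) (j + k)) (cone_snd i))
  else 0.

Lemma cone_shape i j : j != i + 1 -> cone_d i j = 0.
Proof. by rewrite /cone_d => /negPf->. Qed.

Lemma cone_fst_d i j : j = i + 1 ->
  mcomp (cone_fst j) (cone_d i j) = - mcomp (cd C (i + 1) (j + 1)) (cone_fst i).
Proof. by rewrite /cone_d => ->; rewrite eqxx cone_fstK. Qed.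

Lemma cone_snd_d i j : j = i + 1 ->
  mcomp (cone_snd j) (cone_d i j)
  = mcomp (s (i + 1) (j + k)) (cone_fst i) +
    mcomp (cd D (i + k) (j + k)) (cone_snd i).
Proof. by rewrite /cone_d => ->; rewrite eqxx cone_sndK. Qed.

Lemma cone_cd i j l : mcomp (cone_d j l) (cone_d i j) = 0.
Proof.
have [ij|ij] := eqVneq j (i + 1); last by rewrite (cone_shape ij) mcomp0r.
have [jl|jl] := eqVneq l (j + 1); last by rewrite (cone_shape jl) mcomp0l.
apply: cone_ext; rewrite mcomp0r mcompA.
  rewrite cone_fst_d // mcompNl -mcompA cone_fst_d //.
  by rewrite mcompNr mcompA cd_cd mcomp0l oppr0 oppr0.
rewrite cone_snd_d // mcompDl -!mcompA cone_fst_d // cone_snd_d //.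
rewrite mcompNr mcompDr !mcompA cd_cd mcomp0l addr0.
rewrite (@s_cyc (i + 1) (j + 1) (j + k) (l + k)); try lia.
by rewrite scale1r addNr.
Qed.

Definition cone : cplx := Cplx cone_shape cone_cd.

End Cone.

Section ConeMaps.
Variables (P C D : cplx) (k : int) (s : fam C D) (s_cyc : cyc 1 k s).

Lemma cone_cyc (c : K) m (g : forall i j, mor (P i) (C (j + 1)))
    (f : forall i j, mor (P i) (D (j + k))) :
  (forall i i' j j', i' = i + 1 -> j = i + m -> j' = j + 1 ->
     - mcomp (cd C (j + 1) (j' + 1)) (g i j) = c *: mcomp (g i' j') (cd P i i')) ->
  (forall i i' j j', i' = i + 1 -> j = i + m -> j' = j + 1 ->
     mcomp (s (j + 1) (j' + k)) (g i j) + mcomp (cd D (j + k) (j' + k)) (f i j)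
     = c *: mcomp (f i' j') (cd P i i')) ->
  @cyc _ _ P (cone s_cyc) c m (fun i j => cone_pair (g i j) (f i j)).
Proof.
move=> gH fH i i' j j' ii' ji jj'.
change (mcomp (cone_d k s j j') (cone_pair (g i j) (f i j)) =
  c *: mcomp (cone_pair (g i' j') (f i' j')) (cd P i i')).
apply: cone_ext; rewrite mcompA mcompZr [in RHS]mcompA.
  by rewrite cone_fstK cone_fst_d // mcompNl -mcompA cone_fstK (gH i i' j j').
by rewrite cone_sndK cone_snd_d // mcompDl -!mcompA cone_fstK !cone_sndK (fH i i' j j').
Qed.

(** A null homotopy of a map into the cone consists of a map into each of the two
    summands. *)
Lemma cone_nulby (c : K) m (g : forall i j, mor (P i) (C (j + 1)))
    (f : forall i j, mor (P i) (D (j + k))) :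
  (exists h, @nulby _ _ P (cone s_cyc) c m (fun i j => cone_pair (g i j) (f i j)) h) ->
  exists (u : fam P C) (v : fam P D),
    (forall i i' j' j, i' = i + 1 -> j = i + m -> j = j' + 1 ->
       g i j = - mcomp (cd C (j' + 1) (j + 1)) (u i (j' + 1))
         + c *: mcomp (u i' (j + 1)) (cd P i i')) /\
    (forall i i' j' j, i' = i + 1 -> j = i + m -> j = j' + 1 ->
       f i j = mcomp (s (j' + 1) (j + k)) (u i (j' + 1))
         + mcomp (cd D (j' + k) (j + k)) (v i (j' + k))
         + c *: mcomp (v i' (j + k)) (cd P i i')).
Proof.
move=> [h hE].
pose u : fam P C := fun i j =>
  mcomp (idf C (j - 1 + 1) j) (mcomp (cone_fst C D k _) (h i (j - 1))).
pose v : fam P D := fun i j =>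
  mcomp (idf D (j - k + k) j) (mcomp (cone_snd C D k _) (h i (j - k))).
have uE i j : u i (j + 1) = mcomp (cone_fst C D k j) (h i j).
  rewrite /u; have -> : j + 1 - 1 = j by lia.
  by rewrite idf_id mcomp1l.
have vE i j : v i (j + k) = mcomp (cone_snd C D k j) (h i j).
  rewrite /v; have -> : j + k - k = j by lia.
  by rewrite idf_id mcomp1l.
have {}hE i i' j' j : i' = i + 1 -> j = i + m -> j = j' + 1 ->
    cone_pair (g i j) (f i j) = mcomp (cone_d k s j' j) (h i j') +
    c *: mcomp (h i' j : mor (P i') (cone_ob C D k j)) (cd P i i').
  exact: hE.
exists u, v; split=> i i' j' j ii' ji jj'.
  rewrite -(cone_fstK (g i j) (f i j)) (hE i i' j') // mcompDr mcompZr.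
  rewrite [mcomp _ (mcomp (cone_d _ _ _ _) _)]mcompA cone_fst_d //.
  by rewrite mcompNl -mcompA !uE; congr (_ + _ *: _); apply: mcompA.
rewrite -(cone_sndK (g i j) (f i j)) (hE i i' j') // mcompDr mcompZr.
rewrite [mcomp _ (mcomp (cone_d _ _ _ _) _)]mcompA cone_snd_d //.
by rewrite !uE !vE mcompDl -!mcompA; congr (_ + _ *: _); rewrite ?mcompA.
Qed.

End ConeMaps.

(** Quasi-isomorphisms of degree [k]. *)
Definition qism C D (k : int) (f : fam C D) :=
  forall i j : int, j = i + k ->
    (forall x, x \in cocycles C i -> f i j x \in coboundaries D j ->
       x \in coboundaries C i) /\
    (forall y, y \in cocycles D j ->
       exists2 x, x \in cocycles C i & y - f i j x \in coboundaries D j).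

Lemma cyc_appl C D k (f : fam C D) i i' j j' x : cyc 1 k f ->
  i' = i + 1 -> j = i + k -> j' = j + 1 ->
  cd D j j' (f i j x) = f i' j' (cd C i i' x).
Proof. by move=> fc *; rewrite -!mcompE (fc i i') // scale1r. Qed.

Lemma cone_acyclic C D k (s : fam C D) (sc : cyc 1 k s) :
  qism k s -> forall i, acyclic_at (cone sc) i.
Proof.
move=> sq i; apply/subvP => z; rewrite (cocP _ (erefl (i + 1))) => /eqP dz.
have iE : i = i - 1 + 1 by lia.
move: (i - 1) iE z dz => i0 ->{i} z dz.
set x := cone_fst C D k _ z; set y := cone_snd C D k _ z.
have dx : cd C (i0 + 1 + 1) (i0 + 1 + 1 + 1) x = 0.
  have := congr1 (cone_fst C D k _) dz; rewrite lf0 -mcompE.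
  rewrite (cone_fst_d k s (erefl (i0 + 1 + 1))) morN mcompE.
  by move/eqP; rewrite oppr_eq0 => /eqP.
have sx : s (i0 + 1 + 1) (i0 + 1 + 1 + k) x =
    - cd D (i0 + 1 + k) (i0 + 1 + 1 + k) y.
  have := congr1 (cone_snd C D k _) dz; rewrite lf0 -mcompE.
  rewrite (cone_snd_d k s (erefl (i0 + 1 + 1))) morD !mcompE.
  by move/eqP; rewrite addr_eq0 => /eqP.
have [x' xE] : exists x', x = cd C (i0 + 1) (i0 + 1 + 1) x'.
  apply/cobP => //; have [+ _] := sq (i0 + 1 + 1) (i0 + 1 + 1 + k) erefl.
  apply; first by rewrite (cocP _ (erefl (i0 + 1 + 1 + 1))) dx.
  rewrite sx memvN; apply/(@cobP _ _ (i0 + 1 + k)); first by lia.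
  by exists y.
have [_ /(_ (y + s (i0 + 1) (i0 + 1 + k) x'))] := sq (i0 + 1) (i0 + 1 + k) erefl.
case=> [|u uc].
  rewrite (@cocP _ _ (i0 + 1 + 1 + k)); last by lia.
  rewrite lfD (cyc_appl (i' := i0 + 1 + 1) _ sc) //; last by lia.
  by rewrite -xE sx subrr.
case/(@cobP _ _ (i0 + k)); first by lia.
move=> w wE; apply/(@cobP _ _ i0) => //.
pose z' : cone_ob C D k i0 := ((u - x', w) : prod (C (i0 + 1)) (D (i0 + k))).
have z'1 : cone_fst C D k i0 z' = u - x' by exact: mk_morE.
have z'2 : cone_snd C D k i0 z' = w by exact: mk_morE.
exists z'; apply/esym/cone_el_ext.
  rewrite -mcompE (cone_fst_d k s (erefl (i0 + 1))) morN mcompE z'1 lfB.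
  by move: uc; rewrite (cocP _ (erefl (i0 + 1 + 1))) => /eqP->;
    rewrite sub0r opprK -xE.
rewrite -mcompE (cone_snd_d k s (erefl (i0 + 1))) morD !mcompE z'1 z'2.
by rewrite -wE lfB [LHS]addrC [LHS]addrA subrK addrK.
Qed.

Lemma addr_cancel (V : zmodType) (a b c : V) : a + b + c - a = b + c.
Proof. by rewrite -[a + b + c]addrA addrAC subrr add0r. Qed.

(** ** Maps up to homotopy *)

Definition hmt C D m (f g : fam C D) :=
  exists h, nulby 1 m (fun i j => f i j - g i j) h.

Definition fcomp C D E m (g : fam D E) (f : fam C D) : fam C E :=
  fun i j => mcomp (g (i + m) j) (f i (i + m)).

Lemma fcompE C D E m (g : fam D E) (f : fam C D) i l j :
  l = i + m -> fcomp m g f i j = mcomp (g l j) (f i l).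
Proof. by move=> ->. Qed.

Lemma fcompA C D E Q m m' (t : fam E Q) (s : fam D E) (f : fam C D) i j :
  fcomp (m + m') t (fcomp m s f) i j = fcomp m (fcomp m' t s) f i j.
Proof. by rewrite /fcomp addrA mcompA. Qed.

Lemma cyc_comp C D E m k (g : fam D E) (f : fam C D) :
  cyc 1 k g -> cyc 1 m f -> cyc 1 (m + k) (fcomp m g f).
Proof.
move=> gc fc i i' j j' ii' ji jj'.
rewrite (fcompE _ _ j (erefl (i + m))) (fcompE _ _ j' (erefl (i' + m))).
rewrite scale1r mcompA (gc _ (i' + m) _ j') ?scale1r //; try lia.
by rewrite -!mcompA (fc _ i' _ (i' + m)) ?scale1r //; lia.
Qed.

Lemma hmt_trans C D m (f g h : fam C D) : hmt m f g -> hmt m g h -> hmt m f h.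
Proof.
move=> [u uE] [v vE]; exists (fun i j => u i j + v i j) => i i' j' j a b d.
rewrite mcompDr mcompDl scalerDr addrACA -(uE i i' j' j) // -(vE i i' j' j) //.
by rewrite addrA subrK.
Qed.

Lemma hmt_sym C D m (f g : fam C D) : hmt m f g -> hmt m g f.
Proof.
move=> [u uE]; exists (fun i j => - u i j) => i i' j' j a b d.
by rewrite mcompNr mcompNl scalerN -opprD -(uE i i' j' j) // opprB.
Qed.

Lemma hmt_eq C D m (f g : fam C D) :
  (forall i j, j = i + m -> f i j = g i j) -> hmt m f g.
Proof.
move=> fg; exists (fun _ _ => 0) => i i' j' j a b d.
by rewrite fg // subrr mcomp0r mcomp0l scaler0 addr0.
Qed.

Lemma hmt_compl C D E m k (s : fam D E) (f g : fam C D) :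
  cyc 1 k s -> hmt m f g -> hmt (m + k) (fcomp m s f) (fcomp m s g).
Proof.
move=> sc [h hE]; exists (fcomp (m - 1) s h) => i i' j' j ii' ji jj'.
rewrite /fcomp -mcompBr (hE i i' (i + (m - 1)) (i + m)) //; last by lia.
rewrite mcompDr mcompZr !scale1r !mcompA; congr (_ + _).
  rewrite -[in RHS](scale1r (mcomp _ (h _ _))).
  rewrite (sc _ (i + m) _ j) ?scale1r //; lia.
have -> : i' + (m - 1) = i + m by lia.
by [].
Qed.

Lemma hmt_compr C D E m k (s : fam C D) (f g : fam D E) :
  cyc 1 k s -> hmt m f g -> hmt (k + m) (fcomp k f s) (fcomp k g s).
Proof.
move=> sc [h hE]; exists (fcomp k h s) => i i' j' j ii' ji jj'.
rewrite /fcomp -mcompBl (hE (i + k) (i' + k) j' j) //; try lia.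
rewrite mcompDl mcompZl !scale1r !mcompA; congr (_ + _).
rewrite -!mcompA (sc _ i' _ (i' + k)) ?scale1r //; lia.
Qed.

Definition zfam C D : fam C D := fun _ _ => 0.

Lemma hom0_hmt P D m : hom0 1 P D m <->
  (forall f : fam P D, cyc 1 m f -> hmt m f (@zfam P D)).
Proof.
split=> H f /H[h hE]; exists h => i i' j' j a b d;
  have := hE i i' j' j a b d; rewrite subr0 //.
Qed.

Section LiftQis.
Variables (P C D : cplx) (k : int) (s : fam C D).
Hypotheses (bP : proj_above P) (s_cyc : cyc 1 k s) (s_qis : qism k s).

(** A homotopy from [(0, f)] to zero in the cone of [s] consists of a lift of
    [f] and of a homotopy witnessing it. *)
Lemma qis_lift m (f : fam P D) : cyc 1 (m + k) f ->
  exists g : fam P C, cyc 1 m g /\ hmt (m + k) f (fcomp m s g).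
Proof.
move=> fc.
have [|u [v [uE vE]]] := @cone_nulby P C D k s s_cyc 1 m (fun _ _ => 0)
    (fun i j => f i (j + k)).
  apply: acyclic_hom0 => //; first exact: cone_acyclic.
  apply: cone_cyc => i i' j j' ii' ji jj'.
    by rewrite mcomp0r mcomp0l oppr0 scaler0.
  by rewrite mcomp0r add0r (fc i i') //; lia.
exists u; split=> [i i' j j' ii' ji jj'|].
  have [l jE] : exists l, j = l + 1 by exists (j - 1); lia.
  have := uE i i' l (l + 1) ii' ltac:(lia) erefl.
  by rewrite jj' jE => /esym/eqP; rewrite addr_eq0 eqr_opp => /eqP.
exists v => i i' j' j ii' ji jj'.
have [l jE] : exists l, j = l + 1 + k by exists (j - 1 - k); lia.
have j'E : j' = l + k by lia.
rewrite jE j'E (vE i i' l (l + 1)) //; last by lia.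
rewrite (@fcompE _ _ _ _ _ _ _ (l + 1)); last by lia.
exact: addr_cancel.
Qed.

Lemma qis_lift_null m (g : fam P C) : cyc 1 m g ->
  hmt (m + k) (fcomp m s g) (@zfam P D) -> hmt m g (@zfam P C).
Proof.
move=> gc [h hE].
(* The cone changes the sign of the differential of [C], whence the scalar -1. *)
have [|u [v [uE _]]] := @cone_nulby P C D k s s_cyc (-1) (m - 1)
    (fun i j => g i (j + 1)) (fun i j => - h i (j + k)).
  apply: acyclic_hom0 => //; first exact: cone_acyclic.
  apply: cone_cyc => i i' j j' ii' ji jj'; rewrite scaleN1r.
    rewrite (gc i i') ?scale1r //; lia.
  have := hE i i' (j + k) (j' + k) ii' ltac:(lia) ltac:(lia).
  rewrite /zfam subr0 scale1r (@fcompE _ _ _ _ _ _ _ (j + 1)); last by lia.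
  by move=> ->; rewrite mcompNr mcompNl opprK [LHS]addrAC subrr add0r.
exists (fun i j => - u i j) => i i' j' j ii' ji jj'; rewrite /zfam subr0 scale1r.
have [l jE] : exists l, j = l + 1 by exists (j - 1); lia.
have [l' j'E] : exists l', j' = l' + 1 by exists (j' - 1); lia.
rewrite jE j'E (uE i i' l' l) //; try lia.
by rewrite scaleN1r mcompNr mcompNl.
Qed.

Lemma hom0_qis m : hom0 1 P C m <-> hom0 1 P D (m + k).
Proof.
rewrite !hom0_hmt; split=> H f fc.
  have [g [gc fg]] := qis_lift fc.
  apply: (hmt_trans fg); apply: (hmt_trans (hmt_compl s_cyc (H g gc))).
  by apply: hmt_eq => i j _; rewrite /fcomp mcomp0r.
by apply: qis_lift_null => //; apply: H; apply: cyc_comp.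
Qed.

End LiftQis.
End Lifting.

(** * Morphisms in the derived category *)

Section Derived.
Variables (K : fieldType) (A : falgType K).
Notation cplx := (cplx A).
Implicit Types C D E P Q X Y Z : cplx.

Definition qres P X (k : int) := exists f : fam P X, cyc 1 k f /\ qism k f.

Lemma cyc_coc C D k (f : fam C D) i j x : cyc 1 k f -> j = i + k ->
  x \in cocycles C i -> f i j x \in cocycles D j.
Proof.
move=> fc ji; rewrite (cocP _ (erefl (i + 1))) (cocP _ (erefl (j + 1))).
by rewrite (cyc_appl (i' := i + 1) _ fc) // => /eqP->; rewrite lf0.
Qed.

Lemma cyc_cob C D k (f : fam C D) i j x : cyc 1 k f -> j = i + k ->
  x \in coboundaries C i -> f i j x \in coboundaries D j.
Proof.
move=> fc ji /(@cobP _ _ _ _ (i - 1)) [|w ->]; first by lia.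
apply/(@cobP _ _ _ _ (j - 1)); first by lia.
by exists (f (i - 1) (j - 1) w); rewrite (cyc_appl (i' := i) _ fc) //; lia.
Qed.

Lemma hmt_cob C D k (f g : fam C D) i j x : hmt k f g -> j = i + k ->
  x \in cocycles C i -> f i j x - g i j x \in coboundaries D j.
Proof.
move=> [h hE] ji; rewrite (cocP _ (erefl (i + 1))) => /eqP dx.
apply/(@cobP _ _ _ _ (j - 1)); first by lia.
exists (h i (j - 1) x); rewrite -morB (hE i (i + 1) (j - 1)) //; last by lia.
by rewrite scale1r morD !mcompE dx lf0 addr0.
Qed.

Lemma qism_comp C D E m k (t : fam D E) (f : fam C D) :
  cyc 1 k t -> cyc 1 m f -> qism k t -> qism m f -> qism (m + k) (fcomp m t f).
Proof.
move=> tc fc tq fq i j ji.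
have jE : j = i + m + k by lia.
have [ti ts] := tq (i + m) j jE; have [fi fs] := fq i (i + m) erefl.
split=> [x xc|y yc].
  rewrite mcompE => /ti H; apply: fi => //; apply: H.
  exact: (cyc_coc fc).
have [z zc yz] := ts y yc; have [x xc zx] := fs z zc.
exists x => //; rewrite mcompE.
have -> : y - t (i + m) j (f i (i + m) x)
    = (y - t (i + m) j z) + t (i + m) j (z - f i (i + m) x).
  by rewrite lfB addrA subrK.
by apply: memvD => //; apply: (cyc_cob tc).
Qed.

(** Two out of three: homotopic maps agree on cohomology. *)
Lemma qism_lift P C D m k (s : fam C D) (g : fam P C) (f : fam P D) :
  cyc 1 k s -> cyc 1 m g -> cyc 1 (m + k) f -> qism k s -> qism (m + k) f ->
  hmt (m + k) f (fcomp m s g) -> qism m g.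
Proof.
move=> sc gc fc sq fq fsg i j ji; subst j.
have jE : i + m + k = i + (m + k) by lia.
have [si _] := sq (i + m) (i + (m + k)) (esym jE).
have [fi fs] := fq i (i + (m + k)) erefl.
have sgE x : fcomp m s g i (i + (m + k)) x
    = s (i + m) (i + (m + k)) (g i (i + m) x) by rewrite /fcomp mcompE.
split=> [x xc gx|y yc].
  apply: fi => //; have := hmt_cob fsg erefl xc; rewrite sgE => fx.
  rewrite -[f _ _ x](subrK (s (i + m) (i + (m + k)) (g i (i + m) x))).
  by apply: memvD => //; apply: (cyc_cob sc).
have [x xc yx] := fs _ (cyc_coc sc (esym jE) yc).
exists x => //; apply: si.
  by apply: memvB => //; apply: (cyc_coc gc).
rewrite lfB -sgE.
have addB (V : zmodType) (a b c : V) : a - b = a - c + (c - b).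
  by rewrite addrA subrK.
rewrite (addB _ _ _ (f i (i + (m + k)) x)).
by apply: memvD => //; apply: (hmt_cob fsg).
Qed.

Lemma qres_comp P C D m k : qres P C m -> qres C D k -> qres P D (m + k).
Proof.
move=> [f [fc fq]] [t [tc tq]]; exists (fcomp m t f).
by split; [apply: cyc_comp | apply: qism_comp].
Qed.

Lemma qres_lift P C D m k : proj_above P ->
  qres P D (m + k) -> qres C D k -> qres P C m.
Proof.
move=> bP [f [fc fq]] [s [sc sq]].
have [g [gc fg]] := qis_lift bP sc sq fc.
by exists g; split=> //; apply: (qism_lift sc gc fc).
Qed.

Lemma idf_cyc C : cyc 1 0 (idf C).
Proof.
move=> i i' j j' ii' ji jj'; rewrite scale1r cd_idf; last by lia.
by rewrite idf_cd //; lia.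
Qed.

Lemma qres_refl C : qres C C 0.
Proof.
exists (idf C); split; first exact: idf_cyc.
move=> i j; rewrite addr0 => ->; split=> [x _|y yc]; rewrite idf_id ?midE //.
by exists y => //; rewrite midE subrr mem0v.
Qed.

Lemma qres0 C D : (exists f : chmap C D, qis f) <-> qres C D 0.
Proof.
split=> [[f fq]|[F [Fc Fq]]].
  exists (fun i j => mcomp (idf D i j) (f i)); split.
    move=> i i' j j' ii' ji jj'; rewrite mcompA cd_idf; last by lia.
    rewrite scale1r -mcompA -ch_comm mcompA idf_cd; last by lia.
    by [].
  move=> i j; rewrite addr0 => ->; have [fi fs] := fq i.
  by split=> [x xc|y yc]; rewrite idf_id mcomp1l; [exact: fi | exact: fs].
have comm i j : mcomp (cd D i j) (F i i) = mcomp (F j j) (cd C i j).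
  have [ji|ji] := eqVneq j (i + 1).
    by rewrite (Fc i j i j) ?addr0 // scale1r.
  by rewrite !cd_shape // mcomp0l mcomp0r.
exists (ChMap comm) => i; exact: Fq (esym (addr0 i)).
Qed.

Section Shifts.
Variables (X : cplx) (k : int).

(* The sign of the differential of the shift; rescaling degree [i] by [w ^ i]
   removes it. *)
Let w : K := (-1) ^ k.

Let w_neq0 : w != 0.
Proof. by rewrite expfz_neq0 // oppr_eq0 oner_eq0. Qed.

Let ww : w * w = 1.
Proof. by rewrite /w -expfzMl mulrNN mulr1 exp1rz. Qed.

Lemma coc_shift i (x : shift X k i) :
  (x \in cocycles (shift X k) i) = ((x : X (i + k)) \in cocycles X (i + k)).
Proof.
rewrite (cocP _ (erefl (i + 1))) (@cocP _ _ _ _ (i + 1 + k)); last by lia.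
by rewrite morZ scaler_eq0 (negPf w_neq0).
Qed.

Lemma cob_shift i (x : shift X k i) :
  (x \in coboundaries (shift X k) i) = ((x : X (i + k)) \in coboundaries X (i + k)).
Proof.
apply/(@cobP _ _ _ _ (i - 1))/(@cobP _ _ _ _ (i - 1 + k)) => [| |[y yE]|[y ->]];
  try lia.
  by exists (w *: y); rewrite lfZ yE morZ.
by exists (w *: y); rewrite lfZ [cd (shift X k) _ _ _]morZ scalerA ww scale1r.
Qed.

Let wi i : w ^ i * w = w ^ (i + 1).
Proof. by rewrite expfzDr // expr1z. Qed.

Let wi' i : w ^ i = w ^ (i + 1) * w.
Proof. by rewrite -wi -mulrA ww mulr1. Qed.

Let wi_neq0 i : w ^ i != 0.
Proof. exact: expfz_neq0. Qed.

Lemma qres_shift P : (exists f : chmap P (shift X k), qis f) <-> qres P X k.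
Proof.
split=> [[f fq]|[F [Fc Fq]]].
  exists (fun i j => w ^ i *: mcomp (idf X (i + k) j) (f i)); split.
    move=> i i' j j' ii' ji jj'; subst i' j j'.
    rewrite idf_id mcomp1l scale1r mcompZr mcompZl.
    have := ch_comm f i (i + 1).
    rewrite -[cd (shift X k) _ _]/(w *: cd X (i + k) (i + 1 + k)) mcompZl.
    rewrite -[mcomp (mcomp _ _) _]mcompA => <-.
    rewrite mcompZr scalerA -wi'; congr (_ *: _).
    rewrite -(@idf_cd _ _ X (i + k) (i + 1 + k) (i + k + 1)); last by lia.
    exact: esym (mcompA _ _ _).
  move=> i j ->; have [fi fs] := fq i; rewrite idf_id mcomp1l.
  split=> [x xc|y yc].
    rewrite morZ rpredZeq (negPf (wi_neq0 i)) /= -cob_shift; exact: fi.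
  have [|x xc yx] := fs y; first by rewrite coc_shift.
  exists ((w ^ i)^-1 *: x); first by rewrite memvZ.
  by rewrite morZ lfZ scalerA mulfV // scale1r -cob_shift.
have comm i j : mcomp (cd (shift X k) i j) (w ^ i *: F i (i + k))
    = mcomp (w ^ j *: F j (j + k)) (cd P i j).
  have [ji|ji] := eqVneq j (i + 1); last first.
    by rewrite !cd_shape // mcomp0l mcomp0r.
  subst j; rewrite -[cd (shift X k) _ _]/(w *: cd X (i + k) (i + 1 + k)).
  rewrite mcompZl !mcompZr mcompZl scalerA mulrC wi; congr (_ *: _).
  by rewrite (Fc i (i + 1) (i + k) (i + 1 + k)) ?scale1r //; lia.
exists (ChMap comm) => i; have [Fi Fs] := Fq i (i + k) erefl.
split=> [x xc /=|y yc /=].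
  by rewrite morZ rpredZeq (negPf (wi_neq0 i)) /= cob_shift; apply: Fi.
have [|x xc yx] := Fs y; first by rewrite -coc_shift.
exists ((w ^ i)^-1 *: x); first by rewrite memvZ.
by rewrite morZ lfZ scalerA mulfV // scale1r cob_shift.
Qed.

End Shifts.

Lemma derived_isoE X Y : derived_iso X Y <->
  exists E, [/\ bounded E, qres E X 0 & qres E Y 0].
Proof.
split=> [[E [bE [/qres0 EX /qres0 EY]]]|[E [bE EX EY]]]; exists E => //.
by split=> //; split; apply/qres0.
Qed.

Lemma derived_iso_sym X Y : derived_iso X Y -> derived_iso Y X.
Proof. by move=> [E [bE [EX EY]]]; exists E. Qed.

Lemma derived_iso_refl X : bounded X -> derived_iso X X.
Proof.
by move=> bX; apply/derived_isoE; exists X; split=> //; apply: qres_refl.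
Qed.

Lemma qres_iso P X Y k : proj_above P -> derived_iso X Y ->
  qres P X k -> qres P Y k.
Proof.
move=> bP /derived_isoE[E [_ EX EY]] PX; rewrite -(addr0 k).
by apply: qres_comp EY; apply: (qres_lift bP) EX; rewrite addr0.
Qed.

Lemma hom0_qres P C D k m : proj_above P -> qres C D k ->
  hom0 1 P C m <-> hom0 1 P D (m + k).
Proof. by move=> bP [s [sc sq]]; apply: hom0_qis sq m. Qed.

Lemma hom0_iso P C D m : proj_above P -> derived_iso C D ->
  hom0 1 P C m <-> hom0 1 P D m.
Proof.
move=> bP /derived_isoE[E [_ EC ED]].
by have := hom0_qres m bP EC; have := hom0_qres m bP ED; rewrite addr0 => <- ->.
Qed.

Lemma acyclic_qres C D k i : qres C D k ->
  acyclic_at C i <-> acyclic_at D (i + k).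
Proof.
move=> [f [fc fq]]; have [fi fs] := fq i _ erefl.
split=> /subvP ac; apply/subvP.
  move=> y /fs[x xc yx]; rewrite -[y](subrK (f i (i + k) x)).
  by apply: memvD => //; apply: (cyc_cob fc) => //; apply: ac.
by move=> x xc; apply: fi => //; apply: ac; apply: (cyc_coc fc).
Qed.

(** ** Vanishing of morphism spaces *)

Definition resolvable X := exists P k, proj_above P /\ qres P X k.

(** [RH C D m]: there is no non-zero morphism from [C] to [D[m]] in the derived
    category.  It is tested on a projective resolution of [C], which may be
    shifted by [k]. *)
Definition RH C D m :=
  exists P k, [/\ proj_above P, qres P C k & hom0 1 P D (m + k)].

Lemma qis_lift_uniq P C D k m (s : fam C D) (g g' : fam P C) :
  proj_above P -> cyc 1 k s -> qism k s -> cyc 1 m g -> cyc 1 m g' ->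
  hmt (m + k) (fcomp m s g) (fcomp m s g') -> hmt m g g'.
Proof.
move=> bP sc sq gc gc' [h hE].
have [||u uE] := @qis_lift_null _ _ P C D k s bP sc sq m (fun i j => g i j - g' i j).
- move=> i i' j j' a b d.
  by rewrite mcompBr mcompBl scalerBr (gc i i') // (gc' i i').
- exists h => i i' j' j a b d.
  by rewrite /zfam subr0 -(hE i i' j' j) // /fcomp mcompBr.
by exists u => i i' j' j a b d; have := uE i i' j' j a b d; rewrite /zfam subr0.
Qed.

(** Two resolutions of [C] lift through each other, and the composite of the two
    lifts is homotopic to the identity by uniqueness. *)
Lemma RH_any P C D k m : proj_above P -> qres P C k ->
  RH C D m -> hom0 1 P D (m + k).
Proof.
move=> bP [s [sc sq]] [P0 [k0 [bP0 [s0 [s0c s0q]] H]]].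
have ek0 : k0 - k + k = k0 by lia.
have ek : k - k0 + k0 = k by lia.
have [|g [gc gs]] := @qis_lift _ _ P0 P C k s bP0 sc sq (k0 - k) s0.
  by rewrite ek0.
have [|g' [gc' gs']] := @qis_lift _ _ P P0 C k0 s0 bP s0c s0q (k - k0) s.
  by rewrite ek.
rewrite ek0 in gs; rewrite ek in gs'.
have e0 : k - k0 + (k0 - k) = 0 by lia.
have ggid : hmt 0 (fcomp (k - k0) g g') (idf P).
  apply: (qis_lift_uniq bP sc sq).
  - by rewrite -e0; apply: cyc_comp.
  - exact: idf_cyc.
  rewrite add0r -[in X in hmt X]ek.
  apply: (@hmt_trans _ _ _ _ _ _ s); last first.
    by apply: hmt_eq => i j _; rewrite /fcomp addr0 idf_id mcomp1r.
  rewrite ek; apply: (hmt_trans _ (hmt_sym gs')).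
  apply: (@hmt_trans _ _ _ _ _ _ (fcomp (k - k0) (fcomp (k0 - k) s g) g')).
    by apply: hmt_eq => i j _; rewrite -fcompA e0.
  apply: hmt_sym.
  by have := hmt_compr gc' gs; rewrite ek.
move/hom0_hmt: H => H; apply/hom0_hmt => f fc.
have fgc : cyc 1 (m + k0) (fcomp (k0 - k) f g).
  have -> : m + k0 = k0 - k + (m + k) by lia.
  exact: cyc_comp.
have := hmt_compr gc' (H _ fgc).
have -> : k - k0 + (m + k0) = m + k by lia.
move=> fgg.
apply: (@hmt_trans _ _ _ _ _ _ (fcomp 0 f (idf P))).
  by apply: hmt_eq => i j _; rewrite /fcomp addr0 idf_id mcomp1r.
apply: (@hmt_trans _ _ _ _ _ _ (fcomp 0 f (fcomp (k - k0) g g'))).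
  by have := hmt_compl fc (hmt_sym ggid); rewrite add0r.
apply: (@hmt_trans _ _ _ _ _ _ (fcomp (k - k0) (fcomp (k0 - k) f g) g')).
  by apply: hmt_eq => i j _; rewrite -fcompA e0.
apply: (hmt_trans fgg); apply: hmt_eq => i j _.
by rewrite /fcomp /zfam mcomp0l.
Qed.

Lemma RH_E P C D k m : proj_above P -> qres P C k ->
  RH C D m <-> hom0 1 P D (m + k).
Proof. by move=> bP PC; split=> [|H]; [exact: RH_any | exists P, k]. Qed.

Lemma RH_iso C C' D D' m : derived_iso C C' -> derived_iso D D' ->
  RH C D m -> RH C' D' m.
Proof.
move=> CC' DD' [P [k [bP PC H]]]; exists P, k; split=> //.
  exact: qres_iso PC.
by apply/(hom0_iso _ bP DD').
Qed.

Section Nu.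
Variable n : nat.

Lemma nu_E X Z : nu_ n X Z <->
  exists P, [/\ proj_bounded P, qres P X (- n%:Z) & derived_iso (nakC P) Z].
Proof.
split=> [[P [bP prP /qres_shift PX PZ]]|[P [[prP bP] /qres_shift PX PZ]]].
  by exists P.
by exists P.
Qed.

Lemma nu_resolvable X Z : nu_ n X Z -> resolvable X.
Proof.
move/nu_E=> [P [bP PX _]]; exists P, (- n%:Z); split=> //.
exact: proj_bounded_above.
Qed.

Lemma iso_resolvable X Y : derived_iso X Y -> resolvable X -> resolvable Y.
Proof.
by move=> XY [P [k [bP PX]]]; exists P, k; split=> //; apply: qres_iso PX.
Qed.

(** By Serre duality both sides are dual to morphisms from a resolution of [D]
    to the image of [C] under the Nakayama functor. *)
Lemma RH_nu C C' D D' m : nu_ n C C' -> nu_ n D D' -> resolvable C' ->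
  RH C D m <-> RH C' D' m.
Proof.
move=> /nu_E[P [bP PC PC']] /nu_E[Q [bQ QD QD']] [R [k [bR RC']]].
have bP' := proj_bounded_above bP; have bQ' := proj_bounded_above bQ.
have RP : qres R (nakC P) k by apply: qres_iso RC' => //; apply: derived_iso_sym.
rewrite (RH_E _ _ bP' PC) -(hom0_qres _ bP' QD) (RH_E _ _ bR RC').
rewrite -(hom0_iso _ bR QD') -(serre_hom0 _ _ bQ).
rewrite (hom0_qres _ bQ' RP) -[m in X in X <-> _]opprK (serre_hom0 _ _ bP).
by have -> : - (m + k) + k = - m by lia.
Qed.

Lemma iter_resolvable i X Y : nu_iter n i X Y -> resolvable Y -> resolvable X.
Proof.
case: i => [|i] /=; last by move=> [Z [_ /nu_resolvable]].
by move=> XY; apply: iso_resolvable; apply: derived_iso_sym.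
Qed.

Lemma RH_nu_iter i C C' D D' m : nu_iter n i C C' -> nu_iter n i D D' ->
  resolvable C' -> RH C D m <-> RH C' D' m.
Proof.
elim: i C D => [|i IHi] C D /=.
  move=> CC' DD' _; split; apply: RH_iso => //; exact: derived_iso_sym.
move=> [Z [_ CZ ZC']] [W [_ DW WD']] rC'.
rewrite (RH_nu _ CZ DW) ?(IHi _ _ ZC' WD') //.
exact: iter_resolvable ZC' rC'.
Qed.

Lemma nu_iter_rcons i X Y Z : bounded Z -> nu_iter n i X Y -> nu_ n Y Z ->
  nu_iter n i.+1 X Z.
Proof.
move=> bZ; elim: i X => [|i IHi] X /=; last first.
  by move=> [W [bW XW WY]] YZ; exists W; split=> //; apply: IHi.
move=> XY /nu_E[P [bP PY PZ]]; exists Z; split=> //; last exact: derived_iso_refl.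
apply/nu_E; exists P; split=> //.
by apply: qres_iso PY; [apply: proj_bounded_above | apply: derived_iso_sym].
Qed.

End Nu.
End Derived.

(** * Stalk complexes, cohomology and extensions *)

Section Stalks.
Variables (K : fieldType) (A : falgType K).
Notation cplx := (cplx A).
Notation regl := (regl A).
Implicit Types (M N : lmod A) (C D P Q X Y : cplx).

Lemma stalk_zero M i : i != 0 -> is_zero (stalk M i).
Proof.
by rewrite /= /stalk_ob => /negPf->; apply: zmod_is_zero.
Qed.

Lemma stalk_bounded M : bounded (stalk M).
Proof. by exists 0%N => i i0; apply: stalk_zero; lia. Qed.

Lemma nakC_bounded C : bounded C -> bounded (nakC C).
Proof. by move=> [N CN]; exists N => i iN; apply: nak_zero; apply: CN. Qed.

Definition from_stalk M D (u : forall j, mor M (D j)) : fam (stalk M) D :=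
  fun i j => if 0 =P i is ReflectT e
    then ecast z (mor (stalk M z) (D j)) e (u j : mor (stalk M 0) (D j)) else 0.

Definition to_stalk C M (u : forall i, mor (C i) M) : fam C (stalk M) :=
  fun i j => if 0 =P j is ReflectT e
    then ecast z (mor (C i) (stalk M z)) e (u i : mor (C i) (stalk M 0)) else 0.

Lemma from_stalkE M D (u : forall j, mor M (D j)) j :
  from_stalk u 0 j = u j :> mor M (D j).
Proof. by rewrite /from_stalk; case: eqP => // e; rewrite (eq_irrelevance e erefl). Qed.

Lemma to_stalkE C M (u : forall i, mor (C i) M) i :
  to_stalk u i 0 = u i :> mor (C i) M.
Proof. by rewrite /to_stalk; case: eqP => // e; rewrite (eq_irrelevance e erefl). Qed.

Lemma stalk_cocP M i (x : stalk M i) : x \in cocycles (stalk M) i.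
Proof. by rewrite (cocP _ (erefl (i + 1))) mor0. Qed.

Lemma stalk_cobP M i (x : stalk M i) : (x \in coboundaries (stalk M) i) = (x == 0).
Proof.
apply/(@cobP _ _ _ _ (i - 1))/eqP => [|[y ->]|->]; first by lia.
  by rewrite mor0.
by exists 0; rewrite lf0.
Qed.

Lemma from_stalk_qres M D k (u : mor M (D k)) :
  (forall x, u x = 0 -> x = 0) ->
  (forall y, (y \in cocycles D k) = (y \in limg u)) ->
  (forall i, i < k -> acyclic_at D i) -> (forall i, k < i -> acyclic_at D i) ->
  (forall x, x \in coboundaries D k -> x = 0) ->
  qres (stalk M) D k.
Proof.
move=> u0 uc acl acr cob0.
pose F := from_stalk (fun j => mcomp (idf D k j) u).
have F0 : F 0 k = u by rewrite /F from_stalkE idf_id mcomp1l.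
exists F; split.
  move=> i i' j j' ii' ji jj'.
  have [i0|i0] := eqVneq i 0; last first.
    rewrite (mor_zero_src (F i j) (stalk_zero (M := M) i0)).
    by rewrite (mor_zero_src (cd _ i i') (stalk_zero (M := M) i0)) !mcomp0r scaler0.
  subst i; have jk : j = k by lia.
  clear ji; subst j; rewrite -[cd (stalk M) _ _]/0 mcomp0r scaler0 F0.
  apply: mor_ext => x; rewrite mcompE mor0; apply/eqP.
  by rewrite -(cocP _ jj') uc; apply/mor_imgP; exists x.
move=> i j ji; have [i0|i0] := eqVneq i 0.
  subst i; have jk : j = k by lia.
  clear ji; subst j; split=> [x _|y]; rewrite F0.
    by move/cob0/u0 => ->; apply: mem0v.
  rewrite uc => /mor_imgP[x ->]; exists x; first exact: stalk_cocP.
  by rewrite subrr mem0v.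
split=> [x _ _|y yc].
  by rewrite (stalk_zero i0 x) mem0v.
exists 0; first exact: mem0v.
rewrite lf0 subr0.
have /subvP : acyclic_at D j by case: (ltrP j k) => ?; [apply: acl | apply: acr; lia].
exact.
Qed.

Lemma to_stalk_qres C M k (u : mor (C k) M) :
  limg u = fullv ->
  (forall x, (u x == 0) = (x \in coboundaries C k)) ->
  (forall i, i != k -> acyclic_at C i) ->
  (forall x, x \in cocycles C k) ->
  qres C (stalk M) (- k).
Proof.
move=> uS ub ac cocT.
pose F : fam C (stalk M) := to_stalk (fun i => mcomp u (idf C i k)).
have F0 : F k 0 = u by rewrite /F to_stalkE idf_id mcomp1r.
exists F; split.
  move=> i i' j j' ii' ji jj'.
  rewrite scale1r -[cd (stalk M) _ _]/0 mcomp0l.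
  have [j0|j0] := eqVneq j' 0; last first.
    by rewrite (mor_zero_tgt (F i' j') (stalk_zero (M := M) j0)) mcomp0l.
  have ik : i' = k by lia.
  rewrite j0 ik; apply/esym/mor_ext => x; rewrite F0 mcompE mor0.
  apply/eqP; rewrite ub; apply/(@cobP _ _ _ _ i); first by lia.
  by exists x.
move=> i j ji; have [j0|j0] := eqVneq j 0.
  rewrite j0 in ji *; have ik : i = k by lia.
  clear ji; subst i; rewrite F0; split=> [x _|y _].
    by rewrite stalk_cobP ub.
  have [x ->] := (mor_surjP u).1 uS y.
  by exists x; rewrite ?cocT // subrr mem0v.
split=> [x xc _|y _].
  have /subvP := ac i ltac:(lia); exact.
by exists 0; rewrite ?mem0v // (stalk_zero j0 (y - _)) mem0v.
Qed.

Lemma stalk_proj_bounded M : projective M -> proj_bounded (stalk M).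
Proof.
move=> prM; split; last exact: stalk_bounded.
move=> i; have [->|i0] := eqVneq i 0; first exact: prM.
exact/projective_zero/stalk_zero.
Qed.

(** Maps out of the regular module are elements. *)
Lemma hom0_regl Y j : hom0 1 (stalk regl) Y j <-> acyclic_at Y j.
Proof.
pose el (N : lmod A) (y : N) : mor regl N := tens (mid regl) y.
have elE (N : lmod A) (y : N) a : el N y a = lact N a y by rewrite tensE midE.
have el1 (N : lmod A) (y : N) : el N y 1 = y by rewrite elE lact1 id_lfunE.
split=> [H|ac f fc].
  apply/subvP => y; rewrite (cocP _ (erefl (j + 1))) => /eqP dy.
  pose F := from_stalk (fun l => mcomp (idf Y j l) (el _ y)).
  have F0 : F 0 j = el _ y by rewrite /F from_stalkE idf_id mcomp1l.
  have [|h hE] := H F.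
    move=> i i' l l' ii' li ll'.
    have [i0|i0] := eqVneq i 0; last first.
      rewrite (mor_zero_src (F i l) (stalk_zero (M := regl) i0)).
      by rewrite (mor_zero_src (cd _ i i') (stalk_zero (M := regl) i0)) !mcomp0r scaler0.
    subst i; have lj : l = j by lia.
    clear li; subst l; rewrite -[cd (stalk regl) _ _]/0 mcomp0r scaler0 F0.
    apply: mor_ext => x; rewrite mcompE elE morE ll' dy lf0 mor0 //.
  have := hE 0 1 (j - 1) j ltac:(lia) ltac:(lia) ltac:(lia).
  rewrite -[cd (stalk regl) _ _]/0 mcomp0r scaler0 addr0 F0 => e.
  apply/(@cobP _ _ _ _ (j - 1)); first by lia.
  exists (h 0 (j - 1) (1 : A)).
  by rewrite -mcompE -e el1.
have [y yE] : exists y, f 0 j (1 : A) = cd Y (j - 1) j y.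
  apply/cobP; first by lia.
  have /subvP := ac; apply; rewrite (cocP _ (erefl (j + 1))).
  rewrite -mcompE (fc 0 1 j (j + 1)) //; last by lia.
  by rewrite -[cd (stalk regl) _ _]/0 mcomp0r scaler0 mor0.
exists (from_stalk (fun l => mcomp (idf Y (j - 1) l) (el _ y))).
move=> i i' l' l ii' li ll'.
have [i0|i0] := eqVneq i 0; last first.
  rewrite (mor_zero_src (f i l) (stalk_zero (M := regl) i0)).
  rewrite (mor_zero_src (cd _ i i') (stalk_zero (M := regl) i0)) mcomp0r scaler0.
  by rewrite (mor_zero_src (from_stalk _ i l') (stalk_zero (M := regl) i0)) mcomp0r addr0.
subst i; have lj : l = j by lia.
have l'j : l' = j - 1 by lia.
clear li ll'; subst l l'; rewrite -[cd (stalk regl) _ _]/0 mcomp0r scaler0 addr0.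
rewrite from_stalkE idf_id mcomp1l.
apply: mor_ext => a; rewrite mcompE elE morE -yE -morE.
by congr (_ _); rewrite -[lact _ a _]/(regl_act A a 1) regl_actE mulr1.
Qed.

Lemma stalk_regl_above : proj_above (stalk regl).
Proof. exact/proj_bounded_above/stalk_proj_bounded/projective_regl. Qed.

Lemma RH_regl Y j : RH (stalk regl) Y j <-> acyclic_at Y j.
Proof.
by rewrite (RH_E _ _ stalk_regl_above (qres_refl _)) addr0 hom0_regl.
Qed.

(** Endomorphisms of the regular module are right multiplications, so functionals
    on them are functionals on [A]. *)
Lemma nak_regl_qres : qres (nakC (stalk regl)) (stalk (dual (regr A))) 0.
Proof.
pose D := dual (regr A).
pose mul (a : A) : mor regl regl := tens (mid regl) (a : regl).
have mulE a (x : A) : mul a x = x * a by rewrite tensE midE regl_actE.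
have phil (phi : nak regl) : linear (fun a : A => nev phi (mul a) : K^o).
  move=> k a b; transitivity (nev phi (k *: mul a + mul b)); last exact (nevP phi k (mul a) (mul b)).
  apply: (congr1 (nev phi)); apply: mor_ext => x.
  by rewrite morD morZ !mulE mulrDr scalerAr.
pose theta (phi : nak regl) : D := linfun (fun a : A => nev phi (mul a) : K^o).
have thetaE phi (a : A) : (theta phi : 'Hom(A, K^o)) a = nev phi (mul a).
  exact: (linfun_linE (phil phi)).
have thl : linear theta.
  move=> k phi psi; apply/lfunP => a; rewrite add_lfunE scale_lfunE !thetaE.
  exact (nev_lin (mul a) k phi psi).
have tha a phi : theta (lact (nak regl) a phi) = lact D a (theta phi).
  apply/lfunP => b; rewrite thetaE nev_act -[lact D a]/(dual_act _ a) dual_actE.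
  rewrite comp_lfunE thetaE; apply: (congr1 (nev phi)); apply: mor_ext => x.
  rewrite -[ract _ a b]/(regr_act A a b) regr_actE.
  by rewrite tensE !mulE regl_actE mulrA.
have mulK (g : mor regl regl) : g = mul (g (1 : A)).
  apply: mor_ext => x; rewrite mulE.
  have e1 : lact regl x (1 : A) = x := etrans (regl_actE _ _) (mulr1 _).
  have e2 : lact regl x (g (1 : A)) = (x : A) * g (1 : A) := regl_actE _ _.
  by rewrite -e2 -morE e1.
pose th : mor (nak regl) D := mk_mor thl tha.
apply: (@to_stalk_qres (nakC (stalk regl)) D 0 th).
- apply/mor_surjP => y.
  have [|phi phiE] := @nev_mk _ _ regl (fun g => (y : 'Hom(A, K^o)) (g (1 : A))).
    move=> k g h; rewrite morD morZ.
    exact: (lfP (y : 'Hom(A, K^o))).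
  exists phi; rewrite mk_morE; apply/lfunP => a.
  by rewrite thetaE phiE mulE mul1r.
- move=> phi; rewrite mk_morE.
  have -> : (phi \in coboundaries (nakC (stalk regl)) 0) = (phi == 0).
    apply/(@cobP _ _ _ _ (-1))/eqP => [//|[y ->]|->].
      by rewrite -[cd _ _ _]/(nak_map 0) nak_map0 mor0.
    by exists 0; rewrite lf0.
  apply/eqP/eqP => [t0|->]; last by apply/lfunP => a; rewrite thetaE nev0 zero_lfunE.
  apply: nev_ext => g; rewrite (mulK g) -thetaE t0 zero_lfunE.
  by rewrite nev0.
- move=> i i0; apply/subvP => x _.
  by rewrite (nak_zero (stalk_zero (M := regl) i0) x) mem0v.
by move=> x; rewrite (@cocP _ _ _ _ 1) // -[cd _ _ _]/(nak_map 0) nak_map0 mor0.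
Qed.

Lemma nakC_regl_iso : derived_iso (nakC (stalk regl)) (stalk (dual (regr A))).
Proof.
apply/derived_isoE; exists (nakC (stalk regl)); split.
- exact/nakC_bounded/stalk_bounded.
- exact: qres_refl.
exact: nak_regl_qres.
Qed.

(** Serre duality exchanges maps from [Y] to [DA], that is to [nak A], with maps
    from [A] to [Y]. *)
Lemma RH_dual Y j : resolvable Y ->
  RH Y (stalk (dual (regr A))) j <-> acyclic_at Y (- j).
Proof.
move=> [P [k [bP PY]]]; rewrite (RH_E _ _ bP PY).
rewrite -(hom0_iso _ bP nakC_regl_iso).
have bA := stalk_proj_bounded (@projective_regl _ A).
rewrite -(serre_hom0 _ _ bA) hom0_regl (acyclic_qres _ PY).
by have -> : - (j + k) + k = - j by lia.
Qed.

End Stalks.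

(** * Extensions and additive closures *)

Section ExtAdd.
Variables (K : fieldType) (A : falgType K).
Notation cplx := (cplx A).
Implicit Types (M N : lmod A) (C D P Q X Y : cplx).

Lemma resolution_above P M : proj_resolution P M -> proj_above P.
Proof. by move=> [prP P0 _]; split=> //; exists 0. Qed.

Lemma resolution_qres P M : proj_resolution P M -> qres P (stalk M) 0.
Proof. by move=> [_ _ /qres0]. Qed.

(** A map into a stalk complex has a single non-zero entry. *)
Lemma hom0_stalk P N (k : int) :
  hom0 1 P (stalk N) k <->
  (forall g : mor (P (- k)) N, mcomp g (cd P (- k - 1) (- k)) = 0 ->
   exists h : mor (P (- k + 1)) N, g = mcomp h (cd P (- k) (- k + 1))).
Proof.
split=> [H g g0|H f fc].
  pose F : fam P (stalk N) := to_stalk (fun l => mcomp g (idf P l (- k))).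
  have FE l : F l 0 = mcomp g (idf P l (- k)) by rewrite /F to_stalkE.
  have [|h hE] := H F.
    move=> i i' j j' ii' ji jj'; rewrite -[cd (stalk N) _ _]/0 mcomp0l scale1r.
    have [j0|j0] := eqVneq j' 0; last first.
      by rewrite (mor_zero_tgt (F i' j') (stalk_zero (M := N) j0)) mcomp0l.
    rewrite j0 FE -mcompA idf_cd; last by lia.
    by have -> : i = - k - 1 by [lia]; rewrite g0.
  exists (h (- k + 1) 0).
  have := hE (- k) (- k + 1) (-1) 0 erefl ltac:(lia) ltac:(lia).
  rewrite -[cd (stalk N) _ _]/0 mcomp0l add0r scale1r FE idf_id.
  by rewrite mcomp1r.
have [|h hE] := H (f (- k) 0 : mor (P (- k)) N).
  have := fc (- k - 1) (- k) (-1) 0 ltac:(lia) ltac:(lia) ltac:(lia).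
  by rewrite -[cd (stalk N) _ _]/0 mcomp0l scale1r => <-.
exists (to_stalk (fun l => mcomp h (idf P l (- k + 1)))) => i i' j' j ii' ji jj'.
rewrite -[cd (stalk N) _ _]/0 mcomp0l add0r scale1r.
have [j0|j0] := eqVneq j 0; last first.
  have Z := stalk_zero (M := N) j0.
  exact: etrans (mor_zero_tgt _ Z) (esym (mor_zero_tgt _ Z)).
have iE : i = - k by lia.
rewrite j0 to_stalkE -mcompA idf_cd; last by lia.
by rewrite {}iE; apply: hE.
Qed.

Lemma ext_zeroE n i M N : gldim_le A n ->
  ext_zero i M N <-> RH (stalk M) (stalk N) i%:Z.
Proof.
move=> gl; split=> [[P [PM H]]|].
  rewrite (RH_E _ _ (resolution_above PM) (resolution_qres PM)) addr0.
  exact/hom0_stalk.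
have [P [PM _]] := gl M.
rewrite (RH_E _ _ (resolution_above PM) (resolution_qres PM)) addr0.
by move/hom0_stalk => H; exists P.
Qed.

Lemma gldim_resolvable n M : gldim_le A n -> resolvable (stalk M).
Proof.
move=> /(_ M)[P [PM _]]; exists P, 0.
by split; [exact: resolution_above PM | exact: resolution_qres].
Qed.

Definition stalk_map M N (a : mor M N) : fam (stalk M) (stalk N) :=
  from_stalk (fun j => if 0 =P j is ReflectT e
    then ecast z (mor M (stalk N z)) e (a : mor M (stalk N 0)) else 0).

Lemma stalk_mapE M N (a : mor M N) : stalk_map a 0 0 = a :> mor M N.
Proof.
rewrite /stalk_map from_stalkE.
by case: eqP => // e; rewrite (eq_irrelevance e erefl).
Qed.

Lemma stalk_map_cyc M N (a : mor M N) : cyc 1 0 (stalk_map a).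
Proof.
move=> i i' j j' *.
by rewrite -[cd (stalk N) _ _]/0 -[cd (stalk M) _ _]/0 mcomp0l mcomp0r scaler0.
Qed.

Lemma hmt_add C D m (f f' g g' : fam C D) : hmt m f g -> hmt m f' g' ->
  hmt m (fun i j => f i j + f' i j) (fun i j => g i j + g' i j).
Proof.
move=> [h hE] [h' hE']; exists (fun i j => h i j + h' i j) => i i' j' j a b d.
rewrite mcompDr mcompDl scalerDr addrACA -(hE i i') // -(hE' i i') //.
by rewrite opprD addrACA.
Qed.

Section Decomposition.
Variables (M N1 N2 : lmod A).
Variables (a1 : mor M N1) (b1 : mor N1 M) (a2 : mor M N2) (b2 : mor N2 M).
Hypothesis id_sum : mcomp b1 a1 + mcomp b2 a2 = mid M.

Lemma stalk_map_sum :
  hmt 0 (fun i j => fcomp 0 (stalk_map b1) (stalk_map a1) i j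
                  + fcomp 0 (stalk_map b2) (stalk_map a2) i j) (idf (stalk M)).
Proof.
apply: hmt_eq => i j; rewrite addr0 => ->; rewrite /fcomp addr0.
have [->|i0] := eqVneq i 0.
  have e N (a : mor M N) (b : mor N M) : mcomp (stalk_map b 0 0) (stalk_map a 0 0) =
    mcomp b a :> mor M M by rewrite !stalk_mapE.
  by rewrite idf_id [LHS](congr2 +%R (e _ _ _) (e _ _ _)) id_sum.
rewrite (mor_zero_src (idf _ i i) (stalk_zero (M := M) i0)).
by rewrite !(mor_zero_src (stalk_map _ i i) (stalk_zero (M := M) i0)) !mcomp0r addr0.
Qed.

Lemma RH_tgt_sum X m : resolvable X ->
  RH X (stalk N1) m -> RH X (stalk N2) m -> RH X (stalk M) m.
Proof.
move=> [P [k [bP PX]]]; rewrite !(RH_E _ _ bP PX) !hom0_hmt => H1 H2 f fc.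
have Hab N (a : mor M N) (b : mor N M) :
    (forall f : fam P (stalk N), cyc 1 (m + k) f ->
       hmt (m + k) f (@zfam _ _ P (stalk N))) ->
    hmt (m + k) (fcomp (m + k) (fcomp 0 (stalk_map b) (stalk_map a)) f) (@zfam _ _ P (stalk M)).
  move=> H; have afc : cyc 1 (m + k) (fcomp (m + k) (stalk_map a) f).
    by have := cyc_comp (stalk_map_cyc a) fc; rewrite addr0.
  have := hmt_compl (stalk_map_cyc b) (H _ afc); rewrite addr0 => e.
  apply: (@hmt_trans _ _ _ _ _ _ (fcomp (m + k) (stalk_map b) (fcomp (m + k) (stalk_map a) f))).
    by apply: hmt_eq => i j _; rewrite -fcompA addr0.
  by apply: (hmt_trans e); apply: hmt_eq => i j _; rewrite /fcomp mcomp0r.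
have := hmt_add (Hab _ a1 b1 H1) (Hab _ a2 b2 H2) => e.
apply: (@hmt_trans _ _ _ _ _ _ (fcomp (m + k) (idf (stalk M)) f)).
  by apply: hmt_eq => i j ->; rewrite /fcomp idf_id mcomp1l.
have := hmt_compr fc (hmt_sym stalk_map_sum); rewrite addr0 => e'.
apply: (hmt_trans e'); apply: hmt_trans (hmt_trans e _); apply: hmt_eq => i j _.
  by rewrite /fcomp mcompDl.
by rewrite /zfam addr0.
Qed.

(** The two maps through [N1] and [N2] lift to endomorphisms of a resolution of
    [M] whose sum is homotopic to the identity. *)
Lemma RH_src_sum n D m : gldim_le A n ->
  RH (stalk N1) D m -> RH (stalk N2) D m -> RH (stalk M) D m.
Proof.
move=> gl; have [P [PM _]] := gl M.
have [P1 [PN1 _]] := gl N1; have [P2 [PN2 _]] := gl N2.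
rewrite (RH_E _ _ (resolution_above PM) (resolution_qres PM)).
rewrite (RH_E _ _ (resolution_above PN1) (resolution_qres PN1)).
rewrite (RH_E _ _ (resolution_above PN2) (resolution_qres PN2)).
rewrite !addr0 !hom0_hmt => H1 H2 f fc.
have bP := resolution_above PM.
have [p [pc pq]] := resolution_qres PM.
have factor N P' (a : mor M N) (b : mor N M) : proj_resolution P' N ->
    (forall f : fam P' D, cyc 1 m f -> hmt m f (@zfam _ _ P' D)) ->
    exists g : fam P P, [/\ cyc 1 0 g, hmt m (fcomp 0 f g) (@zfam _ _ P D)
      & hmt 0 (fcomp 0 p g) (fcomp 0 (fcomp 0 (stalk_map b) (stalk_map a)) p)].
  move=> PN H; have bP' := resolution_above PN.
  have [p' [pc' pq']] := resolution_qres PN.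
  have [|u [uc us]] := @qis_lift _ _ P P' (stalk N) 0 p' bP pc' pq' 0
      (fcomp 0 (stalk_map a) p).
    exact: cyc_comp (stalk_map_cyc a) pc.
  have [|v [vc vs]] := @qis_lift _ _ P' P (stalk M) 0 p bP' pc pq 0
      (fcomp 0 (stalk_map b) p').
    exact: cyc_comp (stalk_map_cyc b) pc'.
  have aA X1 X2 X3 X4 (x : fam X3 X4) (y : fam X2 X3) (z : fam X1 X2) l :
      hmt l (fcomp 0 x (fcomp 0 y z)) (fcomp 0 (fcomp 0 x y) z).
    by apply: hmt_eq => i j _; rewrite -fcompA addr0.
  exists (fcomp 0 v u); split.
  - exact: cyc_comp vc uc.
  - have fvc : cyc 1 m (fcomp 0 f v).
      by have := cyc_comp fc vc; rewrite add0r.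
    apply: (hmt_trans (aA _ _ _ _ f v u m)).
    have := hmt_compr uc (H _ fvc); rewrite add0r => e.
    by apply: (hmt_trans e); apply: hmt_eq => i j _; rewrite /fcomp mcomp0l.
  apply: (hmt_trans (aA _ _ _ _ p v u 0)).
  have := hmt_compr uc (hmt_sym vs); rewrite !addr0 => e; apply: (hmt_trans e).
  apply: (hmt_trans (hmt_sym (aA _ _ _ _ (stalk_map b) p' u 0))).
  have := hmt_compl (stalk_map_cyc b) (hmt_sym us); rewrite !addr0 => e'.
  exact: hmt_trans e' (aA _ _ _ _ _ _ _ _).
have [g1 [g1c fg1 pg1]] := factor _ _ a1 b1 PN1 H1.
have [g2 [g2c fg2 pg2]] := factor _ _ a2 b2 PN2 H2.
have gid : hmt 0 (fun i j => g1 i j + g2 i j) (idf P).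
  apply: (qis_lift_uniq bP pc pq).
  - move=> i i' j j' ii' ji jj'; rewrite mcompDr mcompDl scalerDr.
    by rewrite (g1c i i') // (g2c i i').
  - exact: idf_cyc.
  rewrite addr0.
  apply: (@hmt_trans _ _ _ _ _ _ (fun i j => fcomp 0 p g1 i j + fcomp 0 p g2 i j)).
    by apply: hmt_eq => i j _; rewrite /fcomp mcompDr.
  apply: (hmt_trans (hmt_add pg1 pg2)).
  have := hmt_compr pc stalk_map_sum; rewrite addr0 => e.
  apply: hmt_trans (hmt_trans e _); apply: hmt_eq => i j ji.
    by rewrite /fcomp mcompDl.
  have ij : j = i by lia.
  by rewrite /fcomp !addr0 ij !idf_id mcomp1l mcomp1r.
apply: (@hmt_trans _ _ _ _ _ _ (fcomp 0 f (idf P))).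
  by apply: hmt_eq => i j _; rewrite /fcomp addr0 idf_id mcomp1r.
have := hmt_compl fc (hmt_sym gid); rewrite add0r => e; apply: (hmt_trans e).
apply: hmt_trans (hmt_trans (hmt_add fg1 fg2) _); apply: hmt_eq => i j _.
  by rewrite /fcomp mcompDr.
by rewrite /zfam addr0.
Qed.

End Decomposition.

Lemma dsum_id M N : exists (p1 : mor (dsum M N) M) (i1 : mor M (dsum M N))
  (p2 : mor (dsum M N) N) (i2 : mor N (dsum M N)),
  mcomp i1 p1 + mcomp i2 p2 = mid (dsum M N) /\ mcomp p1 i1 = mid M.
Proof.
exists (dfst M N), (dpair (mid M) 0), (dsnd M N), (dpair 0 (mid N)).
split; last exact: dfstK.
apply: dsum_ext; rewrite mcompDr !mcompA ?dfstK ?dsndK !(mcomp1l, mcomp0l) mcomp1r.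
  by rewrite addr0.
by rewrite add0r.
Qed.

(** Vanishing conditions pass to summands of finite direct sums because the
    identity of such a summand is a sum of maps through the given modules. *)
Lemma add_closed (S T : lmod A -> Prop) :
  T (zmod A) ->
  (forall M N1 N2 (a1 : mor M N1) (b1 : mor N1 M) (a2 : mor M N2) (b2 : mor N2 M),
     mcomp b1 a1 + mcomp b2 a2 = mid M -> T N1 -> T N2 -> T M) ->
  (forall N, S N -> T N) -> forall M, Defs.add S M -> T M.
Proof.
move=> T0 Tsum ST M [r [N [SN [M' [f [g [gf _]]]]]]].
have TN : T (bigdsum r N).
  elim: r SN {f g gf} => [//|r IHr] SN /=.
  have [p1 [i1 [p2 [i2 [id12 _]]]]] := dsum_id (bigdsum r N) (N r).
  apply: (Tsum _ _ _ _ _ _ _ id12); last by apply: ST; apply: SN.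
  by apply: IHr => k kr; apply: SN; apply: leq_trans kr _.
have [p1 [i1 [p2 [i2 [_ id1]]]]] := dsum_id M M'.
apply: (Tsum _ _ _ (mcomp f i1) (mcomp p1 g) 0 0 _ TN T0).
by rewrite mcomp0l addr0 -mcompA [mcomp g _]mcompA gf mcomp1l.
Qed.

Lemma add_self (S : lmod A -> Prop) N : S N -> Defs.add S N.
Proof.
move=> SN; exists 1%N, (fun=> N); split=> //; exists (zmod A).
exists (dpair (dsnd _ _) (dfst _ _)), (dpair (dsnd _ _) (dfst _ _)).
by split; apply: dsum_ext; rewrite mcompA ?dfstK ?dsndK ?mcomp1r ?dfstK ?dsndK.
Qed.

Lemma RH_zero_src D m M : is_zero M -> RH (stalk M) D m.
Proof.
move=> M0; exists (stalk M), 0; split; last 1 first.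
- move=> f _; exists (fun _ _ => 0) => i i' j' j _ _ _.
  have Mi : is_zero (stalk M i).
    by have [->|/stalk_zero] := eqVneq i 0.
  by rewrite (mor_zero_src (f i j) Mi) mcomp0r mcomp0l scaler0 addr0.
- exact/proj_bounded_above/stalk_proj_bounded/projective_zero.
exact: qres_refl.
Qed.

Lemma RH_zero_tgt X m M : resolvable X -> is_zero M -> RH X (stalk M) m.
Proof.
move=> [P [k [bP PX]]] M0; exists P, k; split=> // f _.
exists (fun _ _ => 0) => i i' j' j _ _ _.
have Mj : is_zero (stalk M j).
  by have [->|/stalk_zero] := eqVneq j 0.
by rewrite (mor_zero_tgt (f i j) Mj) mcomp0r mcomp0l scaler0 addr0.
Qed.

End ExtAdd.

(** * Coresolutions by images of projective modules *)

Section Coresolutions.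
Variables (K : fieldType) (A : falgType K).
Notation cplx := (cplx A).
Implicit Types (M N : lmod A) (P : cplx).

Lemma acyclicP (C : cplx) i j l : i = j + 1 -> l = i + 1 ->
  acyclic_at C i <-> (forall y, cd C i l y = 0 -> exists w, y = cd C j i w).
Proof.
move=> ij li; split=> [/subvP ac y dy|ac].
  by apply/(cobP _ ij)/ac; rewrite (cocP _ li) dy.
apply/subvP => y; rewrite (cocP _ li) => /eqP /ac ?.
exact/(cobP _ ij).
Qed.

Lemma acyclic_zero (C : cplx) i : is_zero (C i) -> acyclic_at C i.
Proof. by move=> Ci; apply/subvP => x _; rewrite (Ci x) mem0v. Qed.

Lemma stalk_acyclic M i : i != 0 -> acyclic_at (stalk M) i.
Proof. by move=> /(stalk_zero (M := M)); apply: acyclic_zero. Qed.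

(** Projective dimension less than [k]. *)
Fixpoint pd (k : nat) (C : lmod A) : Prop :=
  if k is k'.+1 then
    exists (P : lmod A) (e : mor P C) (L : lmod A) (i : mor L P),
    [/\ projective P, limg e = fullv, (forall x, i x = 0 -> x = 0),
        (forall y, (y \in limg i) = (e y == 0)) & pd k' L]
  else is_zero C.

(** The syzygies of [C] are the kernels of the differentials of [P]. *)
Lemma pd_resolution P (N : int) k : (forall i, projective (P i)) ->
  (forall i, i < 0 -> acyclic_at P i) -> (forall i, i < N -> is_zero (P i)) ->
  forall i (C : lmod A) (g : mor (P i) C), i <= 0 -> i - k%:Z < N ->
  limg g = fullv -> (forall y, (g y == 0) = (y \in coboundaries P i)) -> pd k C.
Proof.
move=> prP acP PN; elim: k => [|k IHk] i C g i0 ik gS g0.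
  move=> x; have [y ->] := (mor_surjP g).1 gS x.
  by rewrite (PN i _ y) ?lf0 //; lia.
have [L [h [h0 hg]]] := kernel_exists g.
exists (P i), g, L, h; split=> //.
have [|d dE] := @mor_corestrict _ _ _ _ _ h (cd P (i - 1) i) h0.
  move=> x; rewrite hg g0; apply/(@cobP _ _ _ _ (i - 1)); first by lia.
  by exists x.
apply: (IHk (i - 1) L d); try lia.
  apply/mor_surjP => z.
  have : h z \in coboundaries P i by rewrite -g0 -hg; apply/mor_imgP; exists z.
  case/(@cobP _ _ _ _ (i - 1)); first by lia.
  move=> x; rewrite -dE mcompE => hz; exists x.
  have : h (z - d x) = 0 by rewrite lfB hz subrr.
  by move/h0/eqP; rewrite subr_eq0 => /eqP.
move=> y.
have -> : (d y == 0) = (cd P (i - 1) i y == 0).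
  rewrite -dE mcompE; apply/eqP/eqP => [->|/h0 //]; exact: lf0.
rewrite -(@cocP _ _ _ (i - 1)); last by lia.
apply/idP/idP; first by have /subvP := acP (i - 1) ltac:(lia); apply.
case/(@cobP _ _ _ _ (i - 1 - 1)); first by lia.
move=> x ->; rewrite (@cocP _ _ _ _ i); last by lia.
by rewrite cd_cd0.
Qed.

Lemma gldim_pd n M : gldim_le A n -> pd n.+1 M.
Proof.
move=> /(_ M)[P [PM Pn]].
have [prP _ [f fq]] := PM; have [fi fs] := fq 0.
apply: (@pd_resolution P (- n%:Z) n.+1 prP _ Pn 0 M (f 0)) => //; try lia.
- move=> i i0; apply/(acyclic_qres _ (resolution_qres PM)).
  by rewrite addr0; apply: stalk_acyclic; lia.
- apply/mor_surjP => y.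
  have [x _] := fs y (stalk_cocP _).
  by rewrite stalk_cobP subr_eq0 => /eqP ->; exists x.
move=> y; rewrite -[(f 0 y == 0)]/(_ == 0 :> stalk M 0) -stalk_cobP.
apply/idP/idP => [|/(@cobP _ _ _ _ (-1)) [//|x ->]].
  apply: fi; rewrite (@cocP _ _ _ _ 1) //.
  have [_ P0 _] := PM; apply/eqP; exact: P0.
rewrite stalk_cobP -mcompE -ch_comm -[cd (stalk M) _ _]/0 mcomp0l mor0.
by [].
Qed.

Section Sequence.
Variables (Q : nat -> lmod A) (u : forall k, mor (Q k) (Q k.+1)).
Hypothesis Q_proj : forall k, projective (Q k).
Hypothesis u_exact : forall k y,
  (nak_map (u k.+1) y == 0) = (y \in limg (nak_map (u k))).

Let v k := nak_map (u k).

Let vv k : mcomp (v k.+1) (v k) = 0.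
Proof.
apply: mor_ext => x; rewrite mcompE mor0; apply/eqP.
by rewrite u_exact; apply/mor_imgP; exists x.
Qed.

Lemma u_cplx k : mcomp (u k.+1) (u k) = 0.
Proof. by apply: nak_faithful => //; rewrite nak_map_comp vv. Qed.

Lemma descend_lift k (C P L : lmod A) (e : mor P C) (i : mor L P)
    (psi : mor C (nak (Q k.+1))) (th rho : mor P (nak (Q k))) :
  limg e = fullv -> (forall y, (y \in limg i) = (e y == 0)) ->
  mcomp (v k) th = mcomp psi e -> mcomp (v k) rho = 0 ->
  mcomp rho i = mcomp th i -> exists psi', mcomp (v k) psi' = psi.
Proof.
move=> eS ie thE vrho rhoi.
have [|s sE] := @mor_descend _ _ _ _ _ e (th - rho) eS.
  move=> x /eqP; rewrite -ie => /mor_imgP[y ->].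
  by rewrite -mcompE mcompBl rhoi subrr mor0.
exists s; apply: mor_ext => x; have [y ->] := (mor_surjP e).1 eS x.
by rewrite -!mcompE -mcompA sE mcompBr vrho subr0 thE.
Qed.

(** Dimension shifting: a lifting problem for [C] against [v k.+1] reduces to
    one for the first syzygy of [C] against [v k]. The induction starts with a
    syzygy that is zero. *)
Lemma pd_lift k (C : lmod A) (psi : mor C (nak (Q k.+1))) : pd k.+1 C ->
  (forall x, psi x \in limg (v k)) -> exists psi', mcomp (v k) psi' = psi.
Proof.
elim: k C psi => [|k IHk] C psi [P [e [L [i [prP eS i0 ie pL]]]]] psiv.
  have [|th thE] := @projective_lift _ _ _ _ _ (v 0%N) (mcomp psi e) prP.
    by move=> x; rewrite mcompE.
  apply: (descend_lift eS ie thE (mcomp0r _ _)).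
  by rewrite mcomp0l; apply/esym/mor_zero_src.
have [|th thE] := @projective_lift _ _ _ _ _ (v k.+1) (mcomp psi e) prP.
  by move=> x; rewrite mcompE.
have [||chi chiE] := IHk L (mcomp th i); first exact: pL.
  move=> x; rewrite -u_exact -[nak_map _ _]mcompE mcompA thE !mcompE.
  have /eqP-> : e (i x) == 0 by rewrite -ie; apply/mor_imgP; exists x.
  by rewrite lf0.
have [chi' chi'E] := nak_injective chi (@Q_proj k) i0.
apply: (@descend_lift k.+1 C P L e i psi th (mcomp (v k) chi') eS ie thE).
  by rewrite mcompA vv mcomp0l.
by rewrite -mcompA chi'E.
Qed.

(** If all projective dimensions are at most [n], the [n]-th cosyzygy is
    injective, so [u n] has a generalized inverse. *)
Lemma cosyzygy_split n : (forall C, pd n.+1 C) ->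
  exists t, mcomp (u n) (mcomp t (u n)) = u n.
Proof.
move=> pdn.
have [C [j [j0 jv]]] := kernel_exists (v n.+1).
have jv' y : (y \in limg j) = (y \in limg (v n)) by rewrite jv u_exact.
have [|s sE] := @pd_lift n C j (pdn C).
  by move=> x; rewrite -jv'; apply/mor_imgP; exists x.
have [t' t'E] := nak_injective s (@Q_proj n) j0.
have [t tE] := nak_full t' (@Q_proj n.+1) (@Q_proj n).
exists t; apply/eqP; rewrite -subr_eq0; apply/eqP/nak_faithful => //.
rewrite nak_mapB !nak_map_comp tE; apply/eqP; rewrite subr_eq0; apply/eqP.
apply: mor_ext => x; rewrite !mcompE.
have /mor_imgP[c ->] : v n x \in limg j by rewrite jv'; apply/mor_imgP; exists x.
by rewrite -[t' _]mcompE t'E -[nak_map _ _]mcompE sE.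
Qed.

(** ** The complex of a sequence *)

Definition seq_ob (i : int) : lmod A := if i is Posz k then Q k else zmod A.

Definition seq_d (i j : int) : mor (seq_ob i) (seq_ob j) :=
  match i, j return mor (seq_ob i) (seq_ob j) with
  | Posz a, Posz b => if a.+1 =P b is ReflectT e
                      then ecast z (mor (Q a) (Q z)) e (u a) else 0
  | _, _ => 0
  end.

Lemma seq_dE k : seq_d k k.+1 = u k :> mor (Q k) (Q k.+1).
Proof. by rewrite /seq_d; case: eqP => // e; rewrite (eq_irrelevance e erefl). Qed.

Lemma seq_shape i j : j != i + 1 -> seq_d i j = 0.
Proof.
by case: i j => [a|a] [b|b] //= ij; case: eqP => // e; case/eqP: ij; lia.
Qed.

Lemma seq_cd i j k : mcomp (seq_d j k) (seq_d i j) = 0.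
Proof.
have [ij|ij] := eqVneq j (i + 1); last by rewrite (seq_shape ij) mcomp0r.
have [jk|jk] := eqVneq k (j + 1); last by rewrite (seq_shape jk) mcomp0l.
case: i ij => [a|a] ij; last first.
  by rewrite (mor_zero_src (seq_d _ j)) ?mcomp0r //; apply: zmod_is_zero.
have ja : j = a.+1 by lia.
have ka : k = a.+2 by lia.
clear ij jk; subst j k.
have := u_cplx a; rewrite -(seq_dE a.+1) -(seq_dE a); exact.
Qed.

Definition seq_cplx : cplx := Cplx seq_shape seq_cd.

End Sequence.

Lemma coresolution_step (Q0 Q1 : lmod A) (u : mor Q0 Q1) : projective Q1 ->
  exists (Q2 : lmod A) (u' : mor Q1 Q2), projective Q2 /\
    forall y, (nak_map u' y == 0) = (y \in limg (nak_map u)).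
Proof.
move=> pr1; have [Q2 [g [pr2 gu]]] := nak_kernel (nak_map u).
by have [u' u'E] := nak_full g pr1 pr2; exists Q2, u'; rewrite u'E.
Qed.

(** The next term of a coresolution depends on the last differential, so the
    recursion runs over differentials. *)
Record stage := Stage {
  st_src : lmod A; st_tgt : lmod A; st_map : mor st_src st_tgt;
  st_srcP : projective st_src; st_tgtP : projective st_tgt }.

Definition next_stage (s : stage) : stage :=
  let Q2 := constructive_indefinite_description _
    (coresolution_step (st_map s) (@st_tgtP s)) in
  let u' := constructive_indefinite_description _ (svalP Q2) in
  @Stage (st_tgt s) (sval Q2) (sval u') (@st_tgtP s) (svalP u').1.

Lemma next_stageE s y :
  (nak_map (st_map (next_stage s)) y == 0) = (y \in limg (nak_map (st_map s))).
Proof.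
rewrite /next_stage; case: constructive_indefinite_description => Q2 /= H.
by case: constructive_indefinite_description => u' /= [_].
Qed.

Lemma coresolution_seq M : exists (Q : nat -> lmod A)
  (u : forall k, mor (Q k) (Q k.+1)) (i : mor M (nak (Q 0%N))),
  [/\ forall k, projective (Q k), (forall x, i x = 0 -> x = 0),
      (forall y, (nak_map (u 0%N) y == 0) = (y \in limg i))
    & forall k y, (nak_map (u k.+1) y == 0) = (y \in limg (nak_map (u k)))].
Proof.
(* A map out of [M] with the zero submodule as kernel. *)
have [Q0 [i [pr0 i0]]] := nak_kernel (0 : mor (zmod A) M).
have [Q1 [g [pr1 g0]]] := nak_kernel i.
have [u0 u0E] := nak_full g pr0 pr1.
pose st k := iter k next_stage (Stage u0 pr0 pr1).
exists (fun k => st_src (st k)), (fun k => st_map (st k)), i; split.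
- by move=> k; apply: st_srcP.
- move=> x /eqP; rewrite i0 => /mor_imgP[y ->]; exact: mor0.
- by move=> y; rewrite /= u0E g0.
by move=> k y; apply: next_stageE.
Qed.

End Coresolutions.

(** * Coresolutions of finite length *)

Section Truncation.
Variables (K : fieldType) (A : falgType K).
Notation cplx := (cplx A).
Implicit Types (M N : lmod A).

Section Subcomplex.
Variables (C : cplx) (U : forall i, {vspace C i}).
Hypothesis U_act : forall i a x, x \in U i -> lact (C i) a x \in U i.
Hypothesis U_d : forall i j x, x \in U i -> cd C i j x \in U j.

Let S i := submod (U_act (i := i)).

Definition subc_incl i : mor (S i) (C i) := sub_incl (U_act (i := i)).

Lemma subc_d_exists i j :
  exists d : mor (S i) (S j), mcomp (subc_incl j) d = mcomp (cd C i j) (subc_incl i).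
Proof.
apply: mor_corestrict => [x|x]; first exact: sub_incl_inj.
rewrite mem_sub_incl mcompE; apply: U_d.
by rewrite -(mem_sub_incl (U_act (i := i))); apply/mor_imgP; exists x.
Qed.

Definition subc_d i j : mor (S i) (S j) :=
  sval (constructive_indefinite_description _ (subc_d_exists i j)).

Lemma subc_dE i j : mcomp (subc_incl j) (subc_d i j) = mcomp (cd C i j) (subc_incl i).
Proof. exact: (svalP (constructive_indefinite_description _ (subc_d_exists i j))). Qed.

Lemma subc_incl_mono N i (f g : mor N (S i)) :
  mcomp (subc_incl i) f = mcomp (subc_incl i) g -> f = g.
Proof.
move=> fg; apply: mor_ext => x; apply/eqP; rewrite -subr_eq0; apply/eqP.
apply: (@sub_incl_inj _ _ _ _ (U_act (i := i))).
by rewrite lfB -!mcompE -/(subc_incl i) fg subrr.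
Qed.

Lemma subc_shape i j : j != i + 1 -> subc_d i j = 0.
Proof.
by move=> ij; apply: subc_incl_mono; rewrite subc_dE cd_shape // mcomp0l mcomp0r.
Qed.

Lemma subc_cd i j k : mcomp (subc_d j k) (subc_d i j) = 0.
Proof.
apply: subc_incl_mono.
by rewrite mcompA subc_dE -mcompA subc_dE mcompA cd_cd mcomp0l mcomp0r.
Qed.

Definition subc : cplx := Cplx subc_shape subc_cd.

Lemma subc_retract i (r : mor (C i) (C i)) :
  (forall x, r x \in U i) -> (forall x, x \in U i -> r x = x) ->
  exists p : mor (C i) (subc i),
    mcomp p (subc_incl i) = mid _ /\ mcomp (subc_incl i) p = r.
Proof.
move=> rU rid.
have [||p pE] := @mor_corestrict _ _ _ _ _ (subc_incl i) r.
- exact: sub_incl_inj.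
- by move=> x; rewrite mem_sub_incl.
exists p; split=> //; apply: subc_incl_mono.
rewrite mcompA pE mcomp1r; apply: mor_ext => x; rewrite mcompE rid //.
by rewrite -(mem_sub_incl (U_act (i := i))); apply/mor_imgP; exists x.
Qed.

Lemma subc_zero i : (forall x, x \in U i -> x = 0) -> is_zero (subc i).
Proof.
move=> U0 x; apply: (@sub_incl_inj _ _ _ _ (U_act (i := i))); apply: U0.
by rewrite -(mem_sub_incl (U_act (i := i))); apply/mor_imgP; exists x.
Qed.

End Subcomplex.

(** An infinite coresolution of [M] is the image under [nak] of a complex of
    projective modules, which is truncated after degree [n] to its subcomplex
    with the cocycles in degree [n]. The generalized inverse of the differential
    out of degree [n] makes the cocycles a direct summand, so the truncation
    stays projective and [nak] preserves its inclusion. *)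
Lemma coresolution_exists n M : (1 <= n)%N -> gldim_le A n ->
  exists S : cplx, [/\ proj_bounded S, forall i, i < 0 -> is_zero (S i),
    forall i : int, n%:Z < i -> is_zero (S i) & qres (stalk M) (nakC S) 0].
Proof.
move=> n1 gl.
have [Q [u [io [prQ io0 u0E uE]]]] := coresolution_seq M.
have [t tE] := cosyzygy_split prQ uE (fun C => gldim_pd C gl).
pose T := seq_cplx prQ uE.
have Tneg i : i < 0 -> is_zero (T i) by case: i => // k _; apply: zmod_is_zero.
have T_d k : cd T k k.+1 = u k :> mor (Q k) (Q k.+1) by exact: seq_dE.
pose U (i : int) : {vspace T i} :=
  if i < n%:Z then fullv else if i == n then cocycles T i else 0%VS.
have U_lt i : i < n%:Z -> U i = fullv by rewrite /U => ->.
have U_n : U n = cocycles T n by rewrite /U ltxx eqxx.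
have U_gt (i : int) : n%:Z < i -> U i = 0%VS.
  by move=> ni; rewrite /U ltNge ltW //= gt_eqF.
have U_act i a x : x \in U i -> lact (T i) a x \in U i.
  have [ni|ni|ni] := ltgtP i n%:Z.
  - by rewrite U_lt // !memvf.
  - by rewrite U_gt // !memv0 => /eqP->; rewrite lf0.
  subst i; rewrite U_n !(cocP _ (erefl (n%:Z + 1))) => /eqP dx.
  by rewrite morE dx lf0.
have U_d i j x : x \in U i -> cd T i j x \in U j.
  have [ij|ij] := eqVneq j (i + 1); last by rewrite cd_shape // mor0 mem0v.
  have [nj|nj|nj] := ltgtP j n%:Z.
  - by rewrite (U_lt j) // memvf.
  - have [ni|ni|ni] := ltgtP i n%:Z; first by lia.
      by rewrite (U_gt i) // memv0 => /eqP->; rewrite lf0 mem0v.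
    subst i; rewrite U_n (cocP _ ij) => /eqP->; exact: mem0v.
  by move=> _; clear ij; subst j; rewrite U_n (cocP _ (erefl (n%:Z + 1))) cd_cd0.
pose S := subc U_act U_d; pose inc i : mor (S i) (T i) := subc_incl U_act i.
have retr i : exists r : mor (T i) (T i), [/\ forall x, r x \in U i,
    forall x, x \in U i -> r x = x & i < n%:Z -> r = mid _].
  have [ni|ni|->] := ltgtP i n%:Z.
  - by exists (mid _); split=> // x; rewrite ?midE // U_lt // memvf.
  - exists 0; split=> [x|x|]; last by [].
      by rewrite mor0 mem0v.
    by rewrite U_gt // memv0 => /eqP->; rewrite lf0.
  have cocE (x : Q n) : (x \in (U n : {vspace Q n})) = (u n x == 0).
    rewrite -(T_d n) -[X in _ = X](@cocP _ _ T n n.+1 x) ?U_n //; lia.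
  (* The projection onto the kernel of [u n] given by the generalized inverse. *)
  exists ((mid (Q n) - mcomp t (u n)) : mor (Q n) (Q n)); split=> [x|x|].
  - rewrite (cocE _) -mcompE mcompBr mcomp1r tE subrr mor0 //.
  - by rewrite (cocE _) => /eqP ux; rewrite morB midE mcompE ux lf0 subr0.
  by move=> ni; lia.
have ret i : exists p : mor (T i) (S i),
    mcomp p (inc i) = mid _ /\ (i < n%:Z -> mcomp (inc i) p = mid _).
  have [r [rU rid r1]] := retr i; have [p [pi ip]] := subc_retract U_act U_d rU rid.
  by exists p; split=> // /r1 <-.
have S_neg i : i < 0 -> is_zero (S i).
  by move=> i0; apply: subc_zero => x _; apply: Tneg.
have S_gt i : n%:Z < i -> is_zero (S i).
  by move=> ni; apply: subc_zero => x; rewrite U_gt // memv0 => /eqP.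
have T_proj i : projective (T i).
  by case: i => k; [apply: prQ | apply: projective_zero (@zmod_is_zero _ A)].
exists S; split=> //; first split.
- move=> i; have [p [pi _]] := ret i; exact: projective_retract pi (T_proj i).
- exists n => i ni; have [i0|i0] := ltrP i 0; first exact: S_neg.
  by apply: S_gt; lia.
have inc_d i j : mcomp (inc j) (cd S i j) = mcomp (cd T i j) (inc i).
  exact: subc_dE.
have inc_inj i (y : nak (S i)) : nak_map (inc i) y = 0 -> y = 0.
  have [p [pi _]] := ret i => y0.
  by rewrite -[y]midE -nak_map1 -pi nak_map_comp mcompE y0 lf0.
have nak_inc_d i j (y : nak (S i)) :
    nak_map (inc j) (nak_map (cd S i j) y) = nak_map (cd T i j) (nak_map (inc i) y).
  by rewrite -!mcompE -!nak_map_comp inc_d.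
have n0 : (0 : int) < n%:Z by lia.
have [p0 [p0i ip0]] := ret 0.
pose e : mor M (nakC S 0) := mcomp (nak_map p0) io.
have inc_e x : nak_map (inc 0) (e x) = io x.
  by rewrite -mcompE mcompA -nak_map_comp ip0 // nak_map1 mcomp1l.
apply: (@from_stalk_qres _ _ M (nakC S) 0 e).
- by move=> x ex; apply: io0; rewrite -inc_e ex lf0.
- move=> y; rewrite (@cocP _ _ (nakC S) 0 1 y) //.
  have -> : (cd (nakC S) 0 1 y == 0) = (nak_map (u 0%N) (nak_map (inc 0) y) == 0).
    rewrite -(T_d 0%N) -(nak_inc_d 0 1 y).
    apply/eqP/eqP => y0; last exact: (@inc_inj 1 (nak_map (cd S 0 1) y) y0).
    have {}y0 : nak_map (cd S 0 1) y = 0 := y0.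
    by rewrite y0 lf0.
  rewrite u0E; apply/mor_imgP/mor_imgP => [[x yE]|[x ->]]; exists x => //.
  have: nak_map (inc 0) (y - e x) = 0 by rewrite lfB inc_e yE subrr.
  by move=> y0; have := inc_inj _ _ y0; move/eqP; rewrite subr_eq0 => /eqP.
- by move=> i i0; apply/acyclic_zero/nak_zero/S_neg.
- move=> i i0; have [ni|ni] := ltrP n%:Z i.
    exact/acyclic_zero/nak_zero/S_gt.
  have [k ik] : exists k, i = Posz k.+1.
    by case: i i0 {ni} => // -[|k] // _; exists k.
  subst i; apply/(@acyclicP _ _ (nakC S) k.+1 k k.+2); try lia.
  move=> y dy.
  have : nak_map (u k.+1) (nak_map (inc k.+1) y) == 0.
    have {}dy : nak_map (cd S k.+1 k.+2) y = 0 := dy.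
    by rewrite -(T_d k.+1) -(nak_inc_d k.+1 k.+2 y) dy lf0.
  rewrite uE => /mor_imgP[w wE].
  have [p [pi ip]] := ret k.
  exists (nak_map p w); apply/eqP; rewrite -subr_eq0; apply/eqP/inc_inj.
  rewrite lfB wE -(T_d k) [X in _ - X]nak_inc_d.
  by rewrite -[nak_map (inc k) _]mcompE -nak_map_comp ip ?nak_map1 ?midE ?subrr //; lia.
move=> x /(@cobP _ _ _ _ (-1))[] // y ->.
have y0 : y = 0 := nak_zero (S_neg (-1) isT) y.
by rewrite y0 lf0.
Qed.

End Truncation.

(** * Orbits of modules under the shifted Nakayama functor *)

Section Orbits.
Variables (K : fieldType) (A : falgType K) (n : nat).
Hypothesis n_ge1 : (1 <= n)%N.
Hypothesis gl : gldim_le A n.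
Notation cplx := (cplx A).
Notation regl := (regl A).
Notation DA := (dual (regr A)).
Implicit Types (M N X : lmod A) (C P S Y : cplx).

Lemma qres_shift_self C k : qres (shift C k) C k.
Proof.
apply/qres_shift; have comm i j :
    mcomp (cd (shift C k) i j) (mid (shift C k i))
    = mcomp (mid (shift C k j)) (cd (shift C k) i j).
  by rewrite mcomp1l mcomp1r.
exists (ChMap comm) => i; split=> [x _|y yc] /=; first by rewrite midE.
by exists y => //; rewrite midE subrr mem0v.
Qed.

Lemma shift_proj_bounded P k : proj_bounded P -> proj_bounded (shift P k).
Proof.
move=> [prP [N PN]]; split=> [i|]; first exact: prP.
by exists (N + absz k)%N => i iN; apply: (PN (i + k)); lia.
Qed.

Lemma nu_resolution M : exists P, [/\ proj_bounded P,
  qres P (stalk M) (- n%:Z) & forall i, i < 0 -> is_zero (P i)].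
Proof.
have [R [RM Rn]] := gl M; have [prR R0 _] := RM.
exists (shift R (- n%:Z)); split.
- apply: shift_proj_bounded; split=> //; exists n => i ni.
  by have [i0|i0] := ltrP 0 i; [apply: R0 | apply: Rn; lia].
- rewrite -[- n%:Z]addr0; apply: qres_comp (resolution_qres RM).
  by rewrite addr0; apply: qres_shift_self.
by move=> i i0; apply: (Rn (i - n%:Z)); lia.
Qed.

(** The image of a resolution of length [n], shifted by [n], starts in degree 0;
    if it has no cohomology above, it is quasi-isomorphic to its kernel there. *)
Lemma nu_stalk_right M : exists Y, [/\ bounded Y, nu_ n (stalk M) Y &
  (forall j, 0 < j -> acyclic_at Y j) -> exists N, nu_ n (stalk M) (stalk N)].
Proof.
have [P [bP PM P0]] := nu_resolution M.
have bY : bounded (nakC P) by case: bP => _; apply: nakC_bounded.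
exists (nakC P); split=> // [|ac].
  by apply/nu_E; exists P; split=> //; apply: derived_iso_refl.
have [N [i [i0 iE]]] := kernel_exists (cd (nakC P) 0 1).
exists N; apply/nu_E; exists P; split=> //; apply/derived_isoE.
exists (stalk N); split; [exact: stalk_bounded | | exact: qres_refl].
apply: (@from_stalk_qres _ _ N (nakC P) 0 i) => // [y|j j0|x].
- by rewrite iE (@cocP _ _ (nakC P) 0 1).
- exact/acyclic_zero/nak_zero/P0.
move=> /(@cobP _ _ _ _ (-1))[] // y ->.
by rewrite (nak_zero (P0 (-1) isT) y) lf0.
Qed.

(** A coresolution of [M] is the image of a complex [S] ending in degree [n]; if
    [S] has no cohomology below, it is quasi-isomorphic to its cokernel there. *)
Lemma nu_stalk_left M : exists Y, [/\ bounded Y, nu_ n Y (stalk M) &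
  (forall j, 0 < j -> acyclic_at Y (- j)) -> exists N, nu_ n (stalk N) (stalk M)].
Proof.
have [S [bS S0 Sn SM]] := coresolution_exists M n_ge1 gl.
have bS' := proj_bounded_above bS.
have SY : qres S (shift S n) (- n%:Z).
  apply: (qres_lift bS') (qres_shift_self S n).
  by rewrite addNr; apply: qres_refl.
have iso : derived_iso (nakC S) (stalk M).
  apply/derived_isoE; exists (stalk M); split=> //; first exact: stalk_bounded.
  exact: qres_refl.
exists (shift S n); split; first by case: (shift_proj_bounded n bS).
  by apply/nu_E; exists S.
move=> ac; have [N [p [pS pE]]] := cokernel_exists (cd S (n%:Z - 1) n).
exists N; apply/nu_E; exists S; split=> //.
apply: (@to_stalk_qres _ _ S N n p pS) => [x|i ni|x].
- by rewrite pE.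
- have [ni'|ni'] := ltrP n%:Z i; first exact/acyclic_zero/Sn.
  apply/(acyclic_qres _ SY).
  have -> : i + - n%:Z = - (n%:Z - i) by lia.
  by apply: ac; lia.
by rewrite (@cocP _ _ _ _ (n%:Z + 1)) //; apply/eqP/(Sn (n%:Z + 1)); lia.
Qed.

Lemma regl_resolvable : resolvable (stalk regl).
Proof. exact: gldim_resolvable gl. Qed.

(** The cohomology of the image of a module under [nu_n] is concentrated in
    degrees 0 to [n], and its vanishing in positive degrees is tested on the
    preimages of the regular module; so the images can be replaced by modules
    one after the other. *)
Lemma forward_orbit M :
  (forall i, exists C, nu_iter n i C (stalk regl) /\
     forall j, 0 < j -> RH C (stalk M) j) ->
  forall i, exists N, nu_iter n i (stalk M) (stalk N).
Proof.
move=> H; elim=> [|i [N MN]].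
  by exists M; apply: derived_iso_refl; apply: stalk_bounded.
have [Y [bY NY Yac]] := nu_stalk_right N.
have MY := nu_iter_rcons bY MN NY.
case: Yac => [j j0|N' NN']; last first.
  by exists N'; apply: nu_iter_rcons NN' => //; apply: stalk_bounded.
have [C [CA CM]] := H i.+1.
apply/RH_regl/(RH_nu_iter _ CA MY regl_resolvable); exact: CM.
Qed.

(** Dually, preimages under [nu_n] live in degrees [-n] to 0, and the vanishing in
    negative degrees is tested on the images of the dual of the regular
    module. *)
Lemma backward_orbit M :
  (forall i, exists I, nu_iter n i (stalk DA) I /\
     forall j, 0 < j -> RH (stalk M) I j) ->
  forall i, exists N, nu_iter n i (stalk N) (stalk M).
Proof.
move=> H; elim=> [|i [N NM]].
  by exists M; apply: derived_iso_refl; apply: stalk_bounded.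
have [Y [bY YN Yac]] := nu_stalk_left N.
have YM : nu_iter n i.+1 Y (stalk M).
  by exists (stalk N); split=> //; apply: stalk_bounded.
case: Yac => [j j0|N' NN']; last first.
  by exists N', (stalk N); split=> //; apply: stalk_bounded.
have rM := gldim_resolvable M gl.
have [I [DI MI]] := H i.+1.
apply/(RH_dual _ (iter_resolvable YM rM))/(RH_nu_iter _ YM DI rM); exact: MI.
Qed.

Lemma nu_pow_opp i X Y : nu_pow n (- i%:Z) (stalk X) Y <-> nu_iter n i Y (stalk X).
Proof. by case: i => [|i] //=; split; apply: derived_iso_sym. Qed.

Hypothesis A_inf : forall i : nat, nu_pow_in_mod n (- i%:Z) (stalk regl).

(** Morphisms from [nu_n^-i A] to shifts of [DA] are dual to the cohomology of
    [nu_n^-i A]. *)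
Lemma injective_orbit i : exists I, nu_iter n i (stalk DA) (stalk I).
Proof.
apply: forward_orbit => {}i; have [N [bN /nu_pow_opp NA Nmod]] := A_inf i.
exists N; split=> // j j0.
apply/RH_dual; first exact: iter_resolvable NA regl_resolvable.
by apply: Nmod; lia.
Qed.

(** The preimages of [A] are known to have cohomology in degree 0 only; as
    the images of [DA] are modules, they can be chosen to be modules. *)
Lemma projective_orbit i : exists N, nu_iter n i (stalk N) (stalk regl).
Proof.
apply: backward_orbit => {}i; have [I DI] := injective_orbit i.
exists (stalk I); split=> // j j0.
by apply/RH_regl/stalk_acyclic; lia.
Qed.

Lemma stalk_in_mod M : in_mod (stalk M).
Proof. by move=> j; apply: stalk_acyclic. Qed.

Lemma regular_orbit X : n_regular n X ->
  forall i : int, nu_pow_in_mod n i (stalk X).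
Proof.
move=> regX.
have RHP N i j : nu_iter n i (stalk N) (stalk regl) -> 0 < j ->
    RH (stalk N) (stalk X) j.
  case: j => // j NA j0; apply/(ext_zeroE _ _ _ gl).
  have [] := regX j j0; move=> + _; apply; apply: add_self.
  by exists i; apply/nu_pow_opp.
have RHI I i j : nu_iter n i (stalk DA) (stalk I) -> 0 < j ->
    RH (stalk X) (stalk I) j.
  case: j => // j DI j0; apply/(ext_zeroE _ _ _ gl).
  by have [_] := regX j j0; apply; apply: add_self; exists i.
case=> k.
  have [|N XN] := @forward_orbit X _ k.
    move=> i; have [N NA] := projective_orbit i; exists (stalk N); split=> //.
    by move=> j; apply: RHP NA.
  exists (stalk N); split=> //; [exact: stalk_bounded | exact: stalk_in_mod].
have [|N NX] := @backward_orbit X _ k.+1.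
  move=> i; have [I DI] := injective_orbit i; exists (stalk I); split=> //.
  by move=> j; apply: RHI DI.
exists (stalk N); split=> //; [exact: stalk_bounded | exact: stalk_in_mod].
Qed.

Lemma orbit_regular X : (forall i : int, nu_pow_in_mod n i (stalk X)) ->
  n_regular n X.
Proof.
move=> Xmod i i0; have rX := gldim_resolvable X gl.
split=> M addM; apply/(ext_zeroE _ _ _ gl).
  apply: (add_closed (T := fun M => RH (stalk M) (stalk X) i)) addM.
  - exact/RH_zero_src/zmod_is_zero.
  - move=> N N1 N2 a1 b1 a2 b2 id12; apply: (RH_src_sum id12 gl).
  move=> N [k /nu_pow_opp NA].
  have [Y [bY XY Ymod]] := Xmod k.
  by apply/(RH_nu_iter _ NA XY regl_resolvable)/RH_regl/Ymod; lia.
apply: (add_closed (T := fun M => RH (stalk X) (stalk M) i)) addM.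
- exact/RH_zero_tgt/zmod_is_zero.
- move=> N N1 N2 a1 b1 a2 b2 id12; apply: (RH_tgt_sum id12) rX.
move=> N [k DN].
have [Y [bY /nu_pow_opp YX Ymod]] := Xmod (- k%:Z).
apply/(RH_nu_iter _ YX DN rX)/RH_dual; first exact: iter_resolvable YX rX.
by apply: Ymod; lia.
Qed.

End Orbits.

Theorem proposition4p15 (K : fieldType) (A : falgType K) (n : nat)
    (n_ge1 : (1 <= n)%N) (A_inf : n_rep_infinite A n) (X : lmod A) :
  n_regular n X <-> forall i : int, nu_pow_in_mod n i (stalk X).
Proof.
have [gl Ainf] := A_inf; split; first exact: regular_orbit.
exact: orbit_regular.
Qed.
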